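(* The decision problem \textsc{Klondike} is NP-complete: given a generalized Klondike instance (as defined in the context) in its initial configuration, decide whether the player can move all cards to the suit stacks.
   Context: Generalized Klondike is played with a deck of $m$ suits, each containing $n$ cards of ranks $1,\dots,n$; each suit is colored red or black. There are $m$ suit stacks and one or more build stacks (no pile stack or talon). A stack is an ordered list of cards. Each card in a build stack is face-up or face-down; the face-up cards on a build stack always form a contiguous block of topmost cards, called a card block. In the initial configuration all cards lie face-down in the build stacks (which may have different lengths), and the suit stacks are empty. Acceptance: an empty suit stack accepts only a card of rank $1$; a nonempty suit stack with top card $t$ accepts card $c$ iff $c$ has the same suit as $t$ and rank one higher. A nonempty card block with top card $t$ accepts card $c$ iff $c$ and $t$ have suits of different colors and the rank of $c$ is one less than the rank of $t$; an empty build stack accepts nothing. A move is one of: (1) if all cards of a build stack are face-down, turn its top card face-up (creating a singleton card block); (2) move an entire card block $p$ onto the top of another card block $q$, provided $q$ accepts the bottom card of $p$; (3) move the top card $c$ of a card block to a suit stack that accepts $c$. The player wins if all cards end up on the suit stacks. The input size is measured in the number of cards and stacks. *)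

(* Defs.v *)
From Stdlib Require Import Relation_Operators.
From mathcomp Require Import all_boot zify.

Set Implicit Arguments.
Unset Strict Implicit.
Unset Printing Implicit Defensive.

Definition bits := seq bool.
Definition language := bits -> Prop.

Inductive direction := MoveLeft | Stay | MoveRight.

Section Tapes.
Variable aux : Type.

(* [None] is the blank and [Some (inl b)] the bit b; [aux] holds the remaining
   symbols of the tape alphabet. *)
Definition symbol := option (bool + aux).

(* A two-way infinite tape: [before] lists the cells to the left of the head,
   nearest first, and [after] those to its right; all other cells are blank. *)
Record tape := Tape { before : seq symbol; under : symbol; after : seq symbol }.

Definition write_move (s : symbol) (d : direction) (t : tape) : tape :=
  match d with
  | MoveLeft => Tape (behead (before t)) (head None (before t)) (s :: after t)
  | Stay => Tape (before t) s (after t)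
  | MoveRight => Tape (s :: before t) (head None (after t)) (behead (after t))
  end.

Definition input_tape (x : bits) : tape :=
  let s := [seq Some (inl b) | b <- x] in Tape [::] (head None s) (behead s).

Fixpoint leading_bits (s : seq symbol) : bits :=
  if s is Some (inl b) :: s' then b :: leading_bits s' else [::].

Definition output_of_tape (t : tape) : bits :=
  leading_bits (under t :: after t).

End Tapes.

(* Deterministic Turing machines with finitely many tapes, at least one; the
   machine halts when [delta] is undefined. *)
Record machine := Machine {
  extra_tapes : nat;
  aux_symbol : finType;
  state : finType;
  start : state;
  delta : state -> {ffun 'I_extra_tapes.+1 -> symbol aux_symbol} ->
    option (state * {ffun 'I_extra_tapes.+1 -> symbol aux_symbol * direction})
}.

Section Runs.
Variable M : machine.

Record mconfig := MConfig {
  control : state M;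
  tapes : {ffun 'I_(extra_tapes M).+1 -> tape (aux_symbol M)}
}.

Definition transition (c : mconfig) :=
  delta (control c) [ffun i => under (tapes c i)].

Definition halted (c : mconfig) : bool := ~~ isSome (transition c).

Definition mstep (c : mconfig) : mconfig :=
  if transition c is Some (q, act)
  then MConfig q [ffun i => write_move (act i).1 (act i).2 (tapes c i)]
  else c.

(* Tape 0 carries the input and the output. *)
Definition initial (x : bits) : mconfig :=
  MConfig (start M) [ffun i => input_tape _ (if i == ord0 then x else [::])].

Definition output (c : mconfig) : bits := output_of_tape (tapes c ord0).

Definition outputs_within (x y : bits) (t : nat) : Prop :=
  exists2 u, u <= t &
    halted (iter u mstep (initial x)) /\ output (iter u mstep (initial x)) = y.

End Runs.

Definition polytime (f : bits -> bits) : Prop :=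
  exists (M : machine) (a d : nat),
    forall x, outputs_within M x (f x) (a * size x ^ d + a).

Definition polytime_pred (p : pred bits) : Prop :=
  polytime (fun x => [:: p x]).

(* Self-delimiting code of a list: every item is preceded by [true], and
   [false] marks the end. *)
Definition encode_seq (T : Type) (e : T -> bits) (s : seq T) : bits :=
  foldr (fun x r => true :: e x ++ r) [:: false] s.

Definition encode_pair (x y : bits) : bits :=
  encode_seq (fun b => [:: b]) x ++ y.

Definition in_NP (L : language) : Prop :=
  exists V : pred bits, polytime_pred V /\
  exists a d : nat, forall x,
    L x <-> exists2 y : bits, size y <= a * size x ^ d + a & V (encode_pair x y).

Definition poly_reducible (L K : language) : Prop :=
  exists2 f : bits -> bits, polytime f & forall x, L x <-> K (f x).

Definition NP_hard (K : language) : Prop :=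
  forall L : language, in_NP L -> poly_reducible L K.

Definition NP_complete (K : language) : Prop := in_NP K /\ NP_hard K.

(* (suit, rank), with suits numbered from 0 and ranks from 1. *)
Definition card := (nat * nat)%type.
Definition suit (c : card) : nat := c.1.
Definition rank (c : card) : nat := c.2.

(* All lists of cards run from the topmost card to the bottommost one. *)
Definition stack := seq card.

(* [colors] has one entry per suit; [true] stands for red, [false] for black. *)
Record instance := Instance {
  colors : seq bool;
  max_rank : nat;
  initial_builds : seq stack
}.

Section Game.
Variable I : instance.

Definition num_suits : nat := size (colors I).

Definition color (c : card) : bool := nth false (colors I) (suit c).

Definition deck : seq card :=
  [seq (s, r) | s <- iota 0 num_suits, r <- iota 1 (max_rank I)].

Definition valid : bool :=
  [&& 0 < num_suits, 0 < max_rank I, 0 < size (initial_builds I)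
    & perm_eq (flatten (initial_builds I)) deck].

(* The whole stack is [block ++ face_down]: [block] is its face-up part. *)
Record build_stack := Build { block : stack; face_down : stack }.

Definition empty_build : build_stack := Build [::] [::].

Record config := Config {
  suit_stacks : seq stack;
  build_stacks : seq build_stack
}.

Definition initial_config : config :=
  Config (nseq num_suits [::]) [seq Build [::] s | s <- initial_builds I].

Definition suit_accepts (s : stack) (c : card) : bool :=
  if s is t :: _ then (suit c == suit t) && (rank c == (rank t).+1)
  else rank c == 1.

Definition block_accepts (q : stack) (c : card) : bool :=
  if q is t :: _ then (color c != color t) && ((rank c).+1 == rank t)
  else false.

Inductive move : config -> config -> Prop :=
| TurnUp ss bs i c d :
    nth empty_build bs i = Build [::] (c :: d) ->
    move (Config ss bs)
         (Config ss (set_nth empty_build bs i (Build [:: c] d)))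
(* The bottom card of the moved block is [b]. *)
| MoveBlock ss bs i j p b d q e :
    i != j ->
    nth empty_build bs i = Build (rcons p b) d ->
    nth empty_build bs j = Build q e ->
    block_accepts q b ->
    move (Config ss bs)
         (Config ss (set_nth empty_build
                       (set_nth empty_build bs i (Build [::] d))
                       j (Build (rcons p b ++ q) e)))
| MoveToSuit ss bs i k c p d :
    nth empty_build bs i = Build (c :: p) d ->
    k < size ss ->
    suit_accepts (nth [::] ss k) c ->
    move (Config ss bs)
         (Config (set_nth [::] ss k (c :: nth [::] ss k))
                 (set_nth empty_build bs i (Build p d))).

Definition won (g : config) : Prop :=
  {subset deck <= flatten (suit_stacks g)}.

Definition winnable : Prop :=
  exists2 g, clos_refl_trans_1n config move initial_config g & won g.

Definition num_cards : nat := size deck.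
Definition num_stacks : nat := num_suits + size (initial_builds I).

End Game.

Definition encode_nat (n : nat) : bits := encode_seq (fun _ : unit => [::]) (nseq n tt).

Definition encode_card (c : card) : bits :=
  encode_nat (suit c) ++ encode_nat (rank c).

(* Numbers are written in unary; [size_encode] below shows that the length of
   the code is polynomially related to the number of cards and stacks. *)
Definition encode (I : instance) : bits :=
  encode_seq (fun b => [:: b]) (colors I) ++ encode_nat (max_rank I) ++
  encode_seq (encode_seq encode_card) (initial_builds I).

Definition klondike : language :=
  fun w => exists I : instance, [/\ valid I, w = encode I & winnable I].

Lemma encode_seq_prefix (T : Type) (e : T -> bits) :
  (forall x y u v, e x ++ u = e y ++ v -> x = y /\ u = v) ->
  forall s t u v, encode_seq e s ++ u = encode_seq e t ++ v -> s = t /\ u = v.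
Proof.
move=> eP; elim=> [|x s IHs] [|y t] u v //= []; first by [].
by rewrite -!catA => /eP[-> /IHs[-> ->]].
Qed.

Lemma encode_nat_prefix m n u v :
  encode_nat m ++ u = encode_nat n ++ v -> m = n /\ u = v.
Proof.
case/encode_seq_prefix=> [[] [] //|/(congr1 size)].
by rewrite !size_nseq.
Qed.

Lemma encode_inj : injective encode.
Proof.
case=> [c n b] [c' n' b']; rewrite /encode /=.
case/encode_seq_prefix=> [x y u v /= [-> ->] //|-> /encode_nat_prefix[->]].
rewrite -[LHS]cats0 -[RHS]cats0.
case/encode_seq_prefix=> [s t u v|-> _ //].
apply: encode_seq_prefix => -[s1 r1] [s2 r2] u' v'.
by rewrite /encode_card /= -!catA => /encode_nat_prefix[-> /encode_nat_prefix[-> ->]].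
Qed.

Lemma size_encode_seq (T : Type) (e : T -> bits) s :
  size (encode_seq e s) = (sumn [seq (size (e x)).+1 | x <- s]).+1.
Proof. by elim: s => //= x s IHs; rewrite size_cat IHs addSn addnS. Qed.

Lemma size_encode_nat n : size (encode_nat n) = n.+1.
Proof. by elim: n => //= n; rewrite /encode_nat /= => ->. Qed.

Lemma size_encode I : valid I ->
  num_cards I + num_stacks I <= size (encode I)
    <= 8 * (num_cards I + num_stacks I) ^ 2.
Proof.
case/and4P=> m_gt0 n_gt0 b_gt0 permI.
have sz_deck : num_cards I = num_suits I * max_rank I.
  by rewrite /num_cards /deck size_allpairs !size_iota.
have sz_flat : size (flatten (initial_builds I)) = num_cards I.
  exact: perm_size.
have deckP c : c \in flatten (initial_builds I) ->
    size (encode_card c) <= num_suits I + max_rank I + 1.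
  rewrite (perm_mem permI) => /allpairsP[[s r] /= [sI rI ->]].
  move: sI rI; rewrite !mem_iota /encode_card size_cat !size_encode_nat /=; lia.
have sz_builds bs (K := num_suits I + max_rank I + 1) :
    {in flatten bs, forall c, size (encode_card c) <= K} ->
    size (flatten bs) + size bs
      <= size (encode_seq (encode_seq encode_card) bs)
      <= K.+1 * size (flatten bs) + 2 * size bs + 1.
  move=> bsP; rewrite size_encode_seq; elim: bs bsP => [|s bs IHbs] bsP.
    by rewrite /= !muln0.
  have /IHbs : {in flatten bs, forall c, size (encode_card c) <= K}.
    by move=> c cbs; apply: bsP; rewrite mem_cat cbs orbT.
  have : size s <= sumn [seq (size (encode_card c)).+1 | c <- s] <= K.+1 * size s.
    have: {in s, forall c, size (encode_card c) <= K}.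
      by move=> c cs; apply: bsP; rewrite mem_cat cs.
    elim: (s) => [|c s' IHs] sP //=.
    have := sP c (mem_head _ _).
    have /IHs : {in s', forall c, size (encode_card c) <= K}.
      by move=> c' c's; apply: sP; rewrite in_cons c's orbT.
    rewrite /= mulnS; move: (sumn _) (muln _ _) => x y; lia.
  rewrite /= size_encode_seq size_cat mulnDr.
  move: (sumn _) (sumn _) (K.+1 * size s) (K.+1 * size (flatten bs)) => x y z t.
  lia.
have := sz_builds _ deckP.
rewrite /encode !size_cat size_encode_nat [size (encode_seq _ (colors I))]size_encode_seq.
have -> : sumn [seq (size [:: b]).+1 | b <- colors I] = 2 * num_suits I.
  by rewrite /num_suits; elim: (colors I) => //= b s ->; lia.
rewrite sz_flat /num_stacks; move: (size (encode_seq _ _)) => x.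
rewrite sz_deck expnS expn1.
have [] : num_suits I <= num_suits I * max_rank I /\
  max_rank I <= num_suits I * max_rank I by nia.
move: m_gt0 b_gt0; move: (num_suits I) (max_rank I) (size _) => m n B.
move: (m * n) => N m_gt0 B_gt0 m_le n_le /andP[x_ge x_le].
apply/andP; split.
  lia.
have : (m + n + 1).+1 * N <= 2 * (N * N) + 2 * N by nia.
nia.
Qed.

(* Main.v *)
(** A winning play has polynomially many moves: each card is turned up once and
    played to a suit stack once, and between two such events a block can only be
    merged into another one. The list of the configurations of a winning play is
    therefore a certificate.

    Hardness goes through satisfiability of CNF formulas. For every literal [l]
    there is a pile in which a "choice card" covers the rank 1 token of [l]. The
    choice cards of [x] and of [not x] can only be moved onto the same black
    card, so that the tokens of at most one of the two literals get released.
    For an occurrence of [l] in the clause [k] there is a pile in which a further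
    token of [l] covers a black card, and this card accepts a card covering the
    card of rank [k] of suit 0. The key card, next in suit 0 after all these,
    covers all the remaining cards of the deck, some of which are needed to play
    the choice cards and the clause cards. Hence the key card can be reached
    exactly when all clauses are satisfied, and afterwards the game is won by
    playing everything in the order of the deck.

    A polynomial-time verifier is turned into a formula by a tableau whose cells
    are indexed by their distance to the heads. At every step the content of a
    cell and the control state determine the next content near the heads, so
    Horn clauses describe the computation, and the only other clauses let each
    cell initially at the position of a certificate bit take some value.

    Polynomial-time computability is established by programming in a while
    language on stacks of bits, compiled to multi-tape machines, and by a library
    of functions on data encoded as binary trees. *)

From Stdlib Require Import Relation_Operators FunctionalExtensionality.
From HB Require Import structures.
From mathcomp Require Import all_boot zify.
Require Import Defs.

Set Implicit Arguments.
Unset Strict Implicit.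
Unset Printing Implicit Defensive.

(** * A while language on stacks of bits *)

(** The obstacle to soundness is a player moving cards in unintended ways. As long as all cards
    under the key card are face down, the deck itself prevents this. Rank [K.+2] of suits 0 and 1 is
    among them, so choice and clause cards, which have higher ranks, cannot reach their suit stacks.
    The only black cards elsewhere are the receiving ones, of rank at least [K.+4], so neither a
    token nor the key card, of rank at most [K.+1], fits onto any block. It therefore suffices to
    look at the moment when the first card under the key card is turned up: every card uncovered by
    then tells where its former cover must lie.

    In the tableau, distances to the heads let a single index address all tapes at once, although
    their heads move independently. A cell may satisfy several values at a time; soundness only
    follows the consequences of one chosen initial content, which is why implications are enough.

    For the programs, the recurring difficulty is iteration: a fold stays polynomial only if its
    intermediate results do, so size bounds accompany every time bound. *)

(* [Put] occurs only in the compiled form of [Push]; [exec] gives it no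
   meaning. *)
Inductive cmd :=
| Skip
| Push of nat & bool
| Put of nat & bool
| Pop of nat
| Seq of cmd & cmd
| If of nat & cmd & cmd
| While of nat & bool & bool & cmd.

Lemma cmd_eq_dec (c d : cmd) : {c = d} + {c <> d}.
Proof. by decide equality; apply: eq_comparable. Qed.

HB.instance Definition _ := hasDecEq.Build cmd (compareP cmd_eq_dec).

Definition store := nat -> bits.

Definition upd (s : store) (r : nat) (v : bits) : store :=
  fun i => if i == r then v else s i.

Definition guard (t f : bool) (v : bits) : bool :=
  if v is b :: _ then if b then t else f else false.

(* The cost is the exact number of steps of the compiled machine. *)
Inductive exec : cmd -> store -> store -> nat -> Prop :=
| ExecSkip s : exec Skip s s 1
| ExecPush r b s : exec (Push r b) s (upd s r (b :: s r)) 2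
| ExecPop r s : exec (Pop r) s (upd s r (behead (s r))) 1
| ExecSeq c1 c2 s s1 s2 n1 n2 :
    exec c1 s s1 n1 -> exec c2 s1 s2 n2 -> exec (Seq c1 c2) s s2 (n1 + n2).+1
| ExecIf r c1 c2 s s' n :
    exec (if guard true false (s r) then c1 else c2) s s' n ->
    exec (If r c1 c2) s s' n.+1
| ExecWhileTrue r t f c s s1 s2 n1 n2 :
    guard t f (s r) -> exec c s s1 n1 -> exec (While r t f c) s1 s2 n2 ->
    exec (While r t f c) s s2 (n1 + n2).+1
| ExecWhileFalse r t f c s :
    ~~ guard t f (s r) -> exec (While r t f c) s s 1.

(** No step adds more than one bit to a stack. Time bounds thus double as bounds on the size of
    results, which [pf_size] exploits. *)
Lemma exec_size c s s' n i : exec c s s' n -> size (s' i) <= size (s i) + n.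
Proof.
elim=> {c s s' n} //=; rewrite /upd.
- by move=> *; lia.
- by move=> r b s; case: eqP => [->|_] /=; lia.
- by move=> r s; case: eqP => [->|_]; rewrite ?size_behead; lia.
- by move=> c1 c2 s s1 s2 n1 n2 _ IH1 _ IH2; lia.
- by move=> r c1 c2 s s' n _ IH; lia.
- by move=> r t f c s s1 s2 n1 n2 _ _ IH1 _ IH2; lia.
- by move=> *; lia.
Qed.

(** * Compilation to Turing machines *)

Fixpoint fits (R : nat) (c : cmd) : bool :=
  match c with
  | Skip => true
  | Push r _ | Put r _ | Pop r => r <= R
  | Seq c1 c2 => fits R c1 && fits R c2
  | If r c1 c2 => [&& r <= R, fits R c1 & fits R c2]
  | While r _ _ c1 => (r <= R) && fits R c1
  end.

Fixpoint max_register (c : cmd) : nat :=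
  match c with
  | Skip => 0
  | Push r _ | Put r _ | Pop r => r
  | Seq c1 c2 => maxn (max_register c1) (max_register c2)
  | If r c1 c2 => maxn r (maxn (max_register c1) (max_register c2))
  | While r _ _ c1 => maxn r (max_register c1)
  end.

Lemma fits_max_register c R : max_register c <= R -> fits R c.
Proof.
elim: c => //= [c1 IH1 c2 IH2|r c1 IH1 c2 IH2|r _ _ c IH];
  rewrite !geq_max; case/andP.
- by move=> /IH1-> /IH2.
- by move=> -> /andP[/IH1-> /IH2].
- by move=> -> /IH.
Qed.

(* The continuations that arise while running [c] before [k]. *)
Fixpoint conts (c : cmd) (k : seq cmd) : seq (seq cmd) :=
  (c :: k) :: match c with
  | Push r b => [:: Put r b :: k]
  | Seq c1 c2 => conts c1 (c2 :: k) ++ conts c2 k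
  | If _ c1 c2 => conts c1 k ++ conts c2 k
  | While _ _ _ c1 => conts c1 (c :: k)
  | _ => [::]
  end.

Notation sym := (symbol void).

Definition sym_guard (t f : bool) (a : sym) : bool :=
  if a is Some (inl b) then if b then t else f else false.

Definition next_cont (c : cmd) (u : nat -> sym) (k : seq cmd) : seq cmd :=
  match c with
  | Push r b => Put r b :: k
  | Seq c1 c2 => [:: c1, c2 & k]
  | If r c1 c2 => (if sym_guard true false (u r) then c1 else c2) :: k
  | While r t f c1 => if sym_guard t f (u r) then [:: c1, c & k] else k
  | _ => k
  end.

Definition tape_action (c : cmd) (i : nat) (a : sym) : sym * direction :=
  match c with
  | Push r _ => if i == r then (a, MoveLeft) else (a, Stay)
  | Put r b => if i == r then (Some (inl b), Stay) else (a, Stay)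
  | Pop r => if i == r then (None, MoveRight) else (a, Stay)
  | _ => (a, Stay)
  end.

Section Compile.
Variables (R : nat) (prog : cmd).

Definition all_conts : seq (seq cmd) := [::] :: conts prog [::].

(** The continuations arising from a fixed program form a finite list, as a loop resumes with itself
    in front of the same continuation. Their positions serve as control states, and the machine
    halts at the empty continuation. *)
Definition cont_state (k : seq cmd) : 'I_(size all_conts).+1 :=
  inord (index k all_conts).

Lemma nth_cont_state k : k \in all_conts -> nth [::] all_conts (cont_state k) = k.
Proof.
move=> kS; rewrite inordK ?nth_index //.
by rewrite ltnS ltnW // index_mem.
Qed.

Definition compiled_delta (q : 'I_(size all_conts).+1)
    (u : {ffun 'I_R.+1 -> sym}) :=
  if nth [::] all_conts q is c :: k
  then Some (cont_state (next_cont c (fun r => u (inord r)) k),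
             [ffun i : 'I_R.+1 => tape_action c i (u i)])
  else None.

Definition compiled : machine := Machine (cont_state [:: prog]) compiled_delta.

Notation tape := (tape void).

(** The head stands on the top of the stack, which extends to the right: a pop erases and moves
    right, a push moves left and then writes. Blanks may follow the bottom of the stack, and for the
    empty stack [m] is positive, so a blank under the head tests emptiness. *)
Definition stack_tape (t : tape) (s : bits) : Prop :=
  all (fun a : sym => ~~ isSome a) (before t) /\
  exists m, under t :: after t = [seq Some (inl b) | b <- s] ++ nseq m None.

Definition stack_tapes (T : {ffun 'I_R.+1 -> tape}) (s : store) : Prop :=
  forall i : 'I_R.+1, stack_tape (T i) (s i).

Definition mconf (k : seq cmd) (T : {ffun 'I_R.+1 -> tape}) : mconfig compiled :=
  MConfig (cont_state k : state compiled) T.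

Lemma mstep_compiled c k T : c :: k \in all_conts ->
  mstep (mconf (c :: k) T) =
  mconf (next_cont c (fun r => under (T (inord r))) k)
        [ffun i : 'I_R.+1 => let a := tape_action c i (under (T i)) in
                   write_move a.1 a.2 (T i)].
Proof.
move=> ckS; rewrite /mstep /transition /= /compiled_delta nth_cont_state //.
rewrite /mconf; congr MConfig; last by apply/ffunP=> i; rewrite !ffunE.
congr cont_state; case: c {ckS} => //= [r c1 c2|r t f c1]; by rewrite ffunE.
Qed.

Local Arguments write_move : simpl never.

Lemma write_move_id (t : tape) : write_move (under t) Stay t = t.
Proof. by case: t. Qed.

Lemma sym_guardE T s r t f : stack_tapes T s -> r <= R ->
  sym_guard t f (under (T (inord r))) = guard t f (s r).
Proof.
move=> Ts rR; have [_ [m]] := Ts (inord r); rewrite inordK //.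
by case: (s r) => [|b v] /=; case: m => [|m] //= [-> _].
Qed.

Lemma stack_tape_pop t s : stack_tape t s ->
  stack_tape (write_move None MoveRight t) (behead s).
Proof.
case: t => bf u af [/= bfP [m E]]; rewrite /write_move; split => //=.
case: s E => [|b s] /= E.
  case: m E => [|m] //= [_ ->]; case: m => [|m]; first by exists 1.
  by exists m.+1.
case: E => _ ->; case: s => [|b' s]; last by exists m.
by case: m => [|m]; [exists 1 | exists m.+1].
Qed.

Lemma stack_tape_push t s b : stack_tape t s ->
  stack_tape (write_move (Some (inl b)) Stay (write_move (under t) MoveLeft t)) (b :: s).
Proof.
case: t => bf u af [/= bfP [m E]]; rewrite /write_move; split => /=; first by case: bf bfP => //= a l /andP[].
by exists m; rewrite E.
Qed.

Lemma subset_conts c k : c :: k \in conts c k.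
Proof. by case: c => *; rewrite mem_head. Qed.

(** The continuation [k] is arbitrary so that the induction passes through [Seq] and [While], which
    run their first part in front of a longer continuation. The inclusion of [conts c k] keeps all
    continuations met among the states of the machine. *)
Lemma compiledP c s s' n : exec c s s' n ->
  forall k T, fits R c -> {subset conts c k <= all_conts} -> k \in all_conts ->
  stack_tapes T s ->
  exists2 T', iter n (@mstep compiled) (mconf (c :: k) T) = mconf k T'
            & stack_tapes T' s'.
Proof.
have stays c' T0 s0 : (forall i a, tape_action c' i a = (a, Stay)) ->
    stack_tapes T0 s0 ->
    stack_tapes [ffun i : 'I_R.+1 => let a := tape_action c' i (under (T0 i)) in
                   write_move a.1 a.2 (T0 i)] s0.
  by move=> E T0s i; rewrite ffunE /= E /= write_move_id.
elim=> {c s s' n}.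
- move=> s k T _ kS k_in Ts; rewrite /= mstep_compiled ?kS ?mem_head //=.
  by eexists; [reflexivity|exact: (stays Skip)].
- move=> r b s k T /= rR kS k_in Ts.
  rewrite mstep_compiled ?kS ?mem_head //= mstep_compiled ?kS ?mem_seq1 ?inE ?eqxx ?orbT //=.
  eexists; first reflexivity.
  move=> i; rewrite !ffunE /upd; case: eqP => [E|_] /=; last by rewrite !write_move_id.
  by have := stack_tape_push b (Ts i); rewrite -E.
- move=> r s k T /= rR kS k_in Ts; rewrite mstep_compiled ?kS ?mem_head //=.
  eexists; first reflexivity.
  move=> i; rewrite !ffunE /upd; case: eqP => [E|_] /=; last by rewrite !write_move_id.
  by have := stack_tape_pop (Ts i); rewrite -E.
- move=> c1 c2 s s1 s2 n1 n2 _ IH1 _ IH2 k T /= /andP[f1 f2] kS k_in Ts.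
  rewrite -iterS iterSr addnC iterD mstep_compiled ?kS ?mem_head //=.
  have c2k : c2 :: k \in all_conts.
    by apply: kS; rewrite inE mem_cat subset_conts !orbT.
  have sub1 : {subset conts c1 (c2 :: k) <= all_conts}.
    by move=> x xc; apply: kS; rewrite inE mem_cat xc orbT.
  have [//|T1 -> T1s] := IH1 _ _ f1 sub1 c2k (stays (Seq c1 c2) _ _ _ Ts).
  apply: IH2 => // x xc; apply: kS; by rewrite inE mem_cat xc !orbT.
- move=> r c1 c2 s s' n _ IH k T /= /and3P[rR f1 f2] kS k_in Ts.
  rewrite -iterS iterSr mstep_compiled ?kS ?mem_head //= (sym_guardE _ _ Ts) //.
  apply: IH => //; first by case: ifP.
    by move=> x xc; apply: kS; rewrite inE mem_cat; case: ifP xc => _ ->; rewrite ?orbT.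
  exact: (stays (If r c1 c2)).
- move=> r t f c s s1 s2 n1 n2 g _ IH1 _ IH2 k T fc kS k_in Ts.
  have /andP[rR fc1] := fc.
  rewrite iterSr addnC iterD mstep_compiled ?kS ?subset_conts //= (sym_guardE _ _ Ts) // g.
  have wk : While r t f c :: k \in all_conts by apply: kS; rewrite subset_conts.
  have sub1 : {subset conts c (While r t f c :: k) <= all_conts}.
    by move=> x xc; apply: kS; rewrite inE xc orbT.
  have [//|T1 -> T1s] := IH1 _ _ fc1 sub1 wk (stays (While r t f c) _ _ _ Ts).
  exact: IH2.
- move=> r t f c s g k T fc kS k_in Ts; have /andP[rR _] := fc.
  rewrite /= mstep_compiled ?kS ?subset_conts //= (sym_guardE _ _ Ts) // (negbTE g).
  by eexists; [reflexivity|exact: (stays (While r t f c))].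
Qed.

End Compile.

Definition input_store (x : bits) : store := upd (fun=> [::]) 0 x.

Lemma exec_polytime (c : cmd) (f : bits -> bits) (a d : nat) :
  (forall x, exists s n, [/\ exec c (input_store x) s n, s 0 = f x
                           & n <= a * size x ^ d + a]) ->
  polytime f.
Proof.
move=> cP; pose R := max_register c; exists (compiled R c), a, d => x.
have [s [n [cx sx n_le]]] := cP x; exists n => //.
have c_fits : fits R c by exact: fits_max_register.
have inS : {subset conts c [::] <= all_conts c} by move=> k kc; rewrite inE kc orbT.
pose T0 := [ffun i : 'I_R.+1 => input_tape void (if i == ord0 then x else [::])].
have T0s : stack_tapes T0 (input_store x).
  move=> i; rewrite ffunE /input_store /upd -val_eqE /=.
  case: ifP => _; last by split => //=; exists 1.
  by split => //=; case: (x) => [|b y]; [exists 1|exists 0; rewrite /= cats0].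
have [//|T' -> T's] := compiledP cx c_fits inS _ T0s.
split.
  by rewrite /halted /transition /= /compiled_delta nth_cont_state ?mem_head.
rewrite /output /output_of_tape; have [_ [m ->]] := T's ord0; rewrite /= sx.
by elim: (f x) => [|b l /= ->] //; case: m.
Qed.

(** * Polynomial bounds *)

(** The base [n.+2] is at least 2 for every [n], so that a larger exponent absorbs constants, sums
    and products and no coefficient has to be carried along. *)
Definition poly_bounded (p : nat -> nat) : Prop :=
  exists d, forall n, p n <= n.+2 ^ d.

Lemma poly_bounded_le p q :
  (forall n, p n <= q n) -> poly_bounded q -> poly_bounded p.
Proof. by move=> pq [d qd]; exists d => n; apply: leq_trans (qd n). Qed.

Lemma poly_bounded_exp d : poly_bounded (fun n => n.+2 ^ d).
Proof. by exists d => n; apply: leqnn. Qed.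

Lemma poly_bounded_const a : poly_bounded (fun=> a).
Proof.
exists a => n; apply: leq_trans (ltnW (ltn_expl a (isT : 1 < 2))) _.
by case: a => [|a]; rewrite ?expn0 ?leq_exp2r.
Qed.

Lemma poly_bounded_id : poly_bounded id.
Proof. by exists 1 => n; rewrite expn1; lia. Qed.

Lemma poly_bounded_mul p q :
  poly_bounded p -> poly_bounded q -> poly_bounded (fun n => p n * q n).
Proof. by move=> [d pd] [e qe]; exists (d + e) => n; rewrite expnD leq_mul. Qed.

Lemma poly_bounded_add p q :
  poly_bounded p -> poly_bounded q -> poly_bounded (fun n => p n + q n).
Proof.
move=> [d pd] [e qe]; exists (maxn d e).+1 => n; rewrite expnS.
have := leq_pexp2l (isT : 0 < n.+2) (leq_maxl d e).
have := leq_pexp2l (isT : 0 < n.+2) (leq_maxr d e).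
have := pd n; have := qe n; nia.
Qed.

Lemma poly_bounded_comp p q :
  poly_bounded p -> poly_bounded q -> poly_bounded (fun n => p (q n)).
Proof.
(* As [n.+2] is at least 2, [n.+2 ^ e + 2 <= 4 * n.+2 ^ e <= n.+2 ^ e.+2]. *)
move=> [d pd] [e qe]; exists (e.+2 * d) => n; apply: leq_trans (pd _) _.
case: (posnP d) => [-> |d0]; first by rewrite muln0.
rewrite expnM leq_exp2r // !expnS.
by have := qe n; have := expn_gt0 n.+2 e; nia.
Qed.

Lemma poly_boundedS p : poly_bounded p -> poly_bounded (fun n => (p n).+1).
Proof.
move=> pp; apply: poly_bounded_le (poly_bounded_add pp (poly_bounded_const 1)) => n.
by lia.
Qed.

Ltac poly_bound :=
  solve [repeat first
    [ assumption
    | exact: poly_bounded_id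
    | exact: poly_bounded_const
    | exact: poly_bounded_exp
    | apply: poly_boundedS
    | apply: poly_bounded_add
    | apply: poly_bounded_mul
    | match goal with H : poly_bounded ?p |- poly_bounded (fun n => ?p (@?q n)) =>
        apply: (poly_bounded_comp H (q := q)) end ]].

(** * Binary trees as universal data *)

Inductive tree := Leaf | Node of tree & tree.

Fixpoint code (t : tree) : bits :=
  if t is Node a b then true :: code a ++ code b else [:: false].

Class rep (T : Type) := Rep { enc : T -> tree }.

#[export] Instance rep_tree : rep tree := Rep id.
#[export] Instance rep_unit : rep unit := Rep (fun=> Leaf).
#[export] Instance rep_bool : rep bool :=
  Rep (fun b => if b then Node Leaf Leaf else Leaf).
#[export] Instance rep_nat : rep nat := Rep (fun n => iter n (Node Leaf) Leaf).
#[export] Instance rep_prod (A B : Type) (rA : rep A) (rB : rep B) : rep (A * B) :=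
  Rep (fun p => Node (enc p.1) (enc p.2)).
#[export] Instance rep_seq (A : Type) (rA : rep A) : rep (seq A) :=
  Rep (foldr (fun a t => Node (enc a) t) Leaf).

Definition sz (A : Type) {rA : rep A} (a : A) : nat := size (code (enc a)).
Arguments sz {A rA} a.

Lemma size_code_gt0 t : 0 < size (code t). Proof. by case: t. Qed.

Lemma sz_pair (A B : Type) {rA : rep A} {rB : rep B} (a : A) (b : B) :
  sz (a, b) = (sz a + sz b).+1.
Proof. by rewrite /sz /= size_cat. Qed.

Lemma sz_cons (A : Type) {rA : rep A} (a : A) s : sz (a :: s) = (sz a + sz s).+1.
Proof. by rewrite /sz /= size_cat. Qed.

Lemma sz_cat (A : Type) {rA : rep A} (s t : seq A) : (sz (s ++ t)).+1 = sz s + sz t.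
Proof. by elim: s => [|a s IHs] //=; rewrite !sz_cons; lia. Qed.

Lemma sz_nat n : sz n = n.*2.+1.
Proof. by elim: n => //= n; rewrite /sz /= => ->; lia. Qed.

Lemma size_le_sz (A : Type) {rA : rep A} (s : seq A) : size s <= sz s.
Proof. by elim: s => //= a s IHs; rewrite sz_cons; lia. Qed.

Lemma sz_gt0 (A : Type) {rA : rep A} (a : A) : 0 < sz a.
Proof. exact: size_code_gt0. Qed.

(** * Straight-line programs *)

Definition does (c : cmd) (s f : store) (n : nat) : Prop :=
  exists2 m, m <= n & exec c s f m.

Lemma does_weak c s f g n m : f = g -> n <= m -> does c s f n -> does c s g m.
Proof. by move=> -> nm [k kn H]; exists k => //; apply: leq_trans nm. Qed.

Lemma does_seq f c1 c2 s g n1 n2 :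
  does c1 s f n1 -> does c2 f g n2 -> does (Seq c1 c2) s g (n1 + n2).+1.
Proof.
move=> [m1 le1 H1] [m2 le2 H2]; exists (m1 + m2).+1; first by rewrite ltnS leq_add.
exact: ExecSeq H1 H2.
Qed.

Lemma does_if r c1 c2 s f n :
  does (if guard true false (s r) then c1 else c2) s f n ->
  does (If r c1 c2) s f n.+1.
Proof. by move=> [m le H]; exists m.+1 => //; apply: ExecIf. Qed.

Lemma does_while f r t e c s g n1 n2 :
  guard t e (s r) -> does c s f n1 -> does (While r t e c) f g n2 ->
  does (While r t e c) s g (n1 + n2).+1.
Proof.
move=> b [m1 le1 H1] [m2 le2 H2]; exists (m1 + m2).+1; first by rewrite ltnS leq_add.
exact: ExecWhileTrue H1 H2.
Qed.

Lemma does_done r t e c s : ~~ guard t e (s r) -> does (While r t e c) s s 1.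
Proof. by move=> b; exists 1 => //; apply: ExecWhileFalse. Qed.

Lemma does_skip s : does Skip s s 1.
Proof. by exists 1 => //; apply: ExecSkip. Qed.

Lemma does_push r b s : does (Push r b) s (upd s r (b :: s r)) 2.
Proof. by exists 2 => //; apply: ExecPush. Qed.

Lemma does_pop r s : does (Pop r) s (upd s r (behead (s r))) 1.
Proof. by exists 1 => //; apply: ExecPop. Qed.

Ltac store_ext :=
  apply: functional_extensionality => ?; rewrite /upd;
  repeat (case: eqP => [?|?]); subst; try reflexivity; try (exfalso; lia);
  try congruence.

Ltac reads := rewrite /upd ?eqxx;
  repeat (case: eqP => [?|?]); subst; try reflexivity; try (exfalso; lia);
  try assumption; try congruence.

Definition copy_top r q := If r (Push q true) (Push q false).

Lemma does_copy_top r q s b v : s r = b :: v ->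
  does (copy_top r q) s (upd s q (b :: s q)) 3.
Proof. by move=> E; apply: does_if; rewrite E; case: b E => _; apply: does_push. Qed.

Definition mv r q := While r true true (Seq (copy_top r q) (Pop r)).

Lemma does_mv r q v w s f :
  r <> q -> s r = v -> s q = w -> f = upd (upd s q (catrev v w)) r [::] ->
  does (mv r q) s f (6 * size v).+1.
Proof.
move=> rq; elim: v w s f => [|b v IH] w s f Er Eq ->.
  by apply: does_weak (does_done _ _); rewrite ?Er //; store_ext.
pose s1 := upd (upd s q (b :: w)) r v.
have step : does (Seq (copy_top r q) (Pop r)) s s1 5.
  apply: does_weak _ _ (does_seq (does_copy_top q Er) (does_pop _ _)) => //.
  by rewrite /s1; store_ext; rewrite Er.
apply: (@does_weak _ _ _ _ _ _ erefl _ (does_while _ step (IH (b :: w) s1 _ _ _ _))).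
- by move=> /=; lia.
- by rewrite Er; case: (b).
- by rewrite /s1; reads.
- by rewrite /s1; reads.
- by rewrite /s1; store_ext.
Qed.

Definition clear r := While r true true (Pop r).

Lemma does_clear r v s : s r = v -> does (clear r) s (upd s r [::]) (2 * size v).+1.
Proof.
elim: v s => [|b v IH] s E.
  by apply: does_weak (does_done _ _); rewrite ?E //; store_ext.
apply: (@does_weak _ _ _ _ _ _ _ _ (does_while _ (does_pop _ _) (IH _ _))).
- by store_ext.
- by rewrite /=; lia.
- by rewrite E; case: (b).
- by reads; rewrite E.
Qed.

Definition dup r p q :=
  While r true true (Seq (copy_top r p) (Seq (copy_top r q) (Pop r))).

Lemma does_dup r p q v w x s f :
  r <> p -> r <> q -> p <> q -> s r = v -> s p = w -> s q = x ->
  f = upd (upd (upd s p (catrev v w)) q (catrev v x)) r [::] ->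
  does (dup r p q) s f (10 * size v).+1.
Proof.
move=> rp rq pq; elim: v w x s f => [|b v IH] w x s f Er Ep Eq ->.
  by apply: does_weak (does_done _ _); rewrite ?Er //; store_ext.
pose s1 := upd (upd (upd s p (b :: w)) q (b :: x)) r v.
have Er1 : upd s p (b :: s p) r = b :: v by reads.
have step : does (Seq (copy_top r p) (Seq (copy_top r q) (Pop r))) s s1 9.
  apply: does_weak _ _ (does_seq (does_copy_top p Er)
    (does_seq (does_copy_top q Er1) (does_pop _ _))) => //.
  by rewrite /s1; store_ext; rewrite Er.
apply: (@does_weak _ _ _ _ _ _ erefl _ (does_while _ step (IH (b :: w) (b :: x) s1 _ _ _ _ _))).
- by move=> /=; lia.
- by rewrite Er; case: (b).
- by rewrite /s1; reads.
- by rewrite /s1; reads.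
- by rewrite /s1; reads.
- by rewrite /s1; store_ext.
Qed.

(* Register [c] counts in unary the subtrees still to be read. *)
Definition split_loop r q c :=
  While c true true
    (If r (Seq (Pop r) (Seq (Push q true) (Push c true)))
          (Seq (Pop r) (Seq (Push q false) (Pop c)))).

Definition split r q c := Seq (Push c true) (split_loop r q c).

(** A flat loop traverses the tree, so its run does not decompose along subtrees. The statement is
    therefore in continuation form: whatever the loop does once [t] has been moved, it also does
    from the start, at an extra cost linear in the code of [t]. The claims for two subtrees then
    chain. *)
Lemma does_split_loop r q c t : r <> q -> r <> c -> q <> c ->
  forall w x u s g n, s r = code t ++ w -> s q = x -> s c = true :: u ->
  does (split_loop r q c) (upd (upd (upd s r w) q (catrev (code t) x)) c u) g n ->
  does (split_loop r q c) s g (n + 12 * size (code t)).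
Proof.
move=> rq rc qc; elim: t => [|a IHa b IHb] w x u s g n Er Eq Ec H.
  have step : does (If r (Seq (Pop r) (Seq (Push q true) (Push c true)))
                         (Seq (Pop r) (Seq (Push q false) (Pop c)))) s
                (upd (upd (upd s r w) q (false :: x)) c u) 7.
    apply: does_if; rewrite Er /=.
    apply: does_weak _ _ (does_seq (does_pop _ _)
      (does_seq (does_push _ _ _) (does_pop _ _))) => //.
    by store_ext; rewrite ?Er ?Ec ?Eq.
  by apply: does_weak erefl _ (does_while _ step H); rewrite ?Ec //=; lia.
pose s1 := upd (upd (upd s r (code a ++ code b ++ w)) q (true :: x)) c [:: true, true & u].
have step : does (If r (Seq (Pop r) (Seq (Push q true) (Push c true)))
                       (Seq (Pop r) (Seq (Push q false) (Pop c)))) s s1 8.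
  apply: does_if; rewrite Er /=.
  apply: does_weak _ _ (does_seq (does_pop _ _)
    (does_seq (does_push _ _ _) (does_push _ _ _))) => //.
  by rewrite /s1; store_ext; rewrite ?Er ?Ec ?Eq //= catA.
have H1 : does (split_loop r q c) s1 g (n + 12 * size (code b) + 12 * size (code a)).
  apply: (IHa (code b ++ w) (true :: x) (true :: u)); rewrite /s1; [by reads|by reads|by reads|].
  apply: (IHb w (catrev (code a) (true :: x)) u); [by reads|by reads|by reads|].
  by move: H; rewrite /= catrev_catl; congr (does _ _ _ _); rewrite /s1; store_ext.
by apply: does_weak erefl _ (does_while _ step H1); rewrite ?Ec //= size_cat; lia.
Qed.

Lemma does_split r q c t w x s f : r <> q -> r <> c -> q <> c ->
  s r = code t ++ w -> s q = x -> s c = [::] ->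
  f = upd (upd s r w) q (catrev (code t) x) ->
  does (split r q c) s f (12 * size (code t) + 4).
Proof.
move=> rq rc qc Er Eq Ec ->.
apply: does_weak erefl _ (does_seq (does_push _ _ _) (does_split_loop (t := t) rq rc qc
  (w := w) (x := x) (u := [::]) (n := 1) _ _ _ _)); [lia|by reads|by reads|by rewrite /upd eqxx Ec|].
by apply: does_weak (does_done _ _) => //; [store_ext|reads].
Qed.

(** * Polynomial-time functions on encoded data *)

(** Register 0 carries argument and result. The other registers below [k] are scratch space, found
    and left empty, and those from [k] on keep their content. Data saved above the scratch space of
    a program thus survive its run, which makes programs composable. *)
Definition pf (A B : Type) {rA : rep A} {rB : rep B} (f : A -> B) : Prop :=
  exists c k p, poly_bounded p /\ forall a s,
    s 0 = code (enc a) -> (forall i, 0 < i < k -> s i = [::]) ->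
    does c s (upd s 0 (code (enc (f a)))) (p (sz a)).
Arguments pf {A B rA rB} f.

Section Closure.
Context {A : Type} {rA : rep A}.

Lemma pf_size (B : Type) {rB : rep B} (f : A -> B) : pf f ->
  exists2 q, poly_bounded q & forall a, sz (f a) <= q (sz a).
Proof.
move=> [c [k [p [pp H]]]]; exists (fun n => n + p n); first by poly_bound.
move=> a; have [//|//|m m_le /exec_size] := H a (upd (fun=> [::]) 0 (code (enc a))).
  by case.
by move/(_ 0); rewrite /upd /= -/(sz a) -/(sz (f a)); lia.
Qed.

(** Only codes matter to a program, so a function may change its type as long as the codes of its
    values agree. This transports operations on trees to pairs, lists, numbers and records. *)
Lemma pf_enc (B C : Type) {rB : rep B} {rC : rep C} (f : A -> B) (g : A -> C) :
  (forall a, enc (f a) = enc (g a)) -> pf f -> pf g.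
Proof.
move=> fg [c [k [p [pp H]]]]; exists c, k, p; split=> // a s Es ks.
by rewrite -fg; apply: H.
Qed.

Lemma pf_ext (B : Type) {rB : rep B} (f g : A -> B) : f =1 g -> pf f -> pf g.
Proof. by move=> fg; apply: pf_enc => a; rewrite fg. Qed.

Lemma pf_id : pf (fun a : A => a).
Proof.
exists Skip, 0, (fun=> 1); split; first by poly_bound.
by move=> a s Es _; apply: does_weak (does_skip _) => //; store_ext.
Qed.

Lemma pf_comp (B C : Type) {rB : rep B} {rC : rep C} (g : B -> C) (f : A -> B) :
  pf g -> pf f -> pf (fun a => g (f a)).
Proof.
move=> [c [k [p [pp H]]]] pff; have [q qq Hq] := pf_size pff.
move: pff => [c' [k' [p' [pp' H']]]].
(* [p] need not be monotone, so the cost of the second program is bounded through the monotone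
   function [n.+2 ^ d]. *)
have [d pd] := pp.
exists (Seq c' c), (maxn k k'), (fun n => (p' n + (q n).+2 ^ d).+1); split.
  by have ? := poly_bounded_comp (poly_bounded_exp d) qq; poly_bound.
move=> a s Es ks; apply: (does_weak _ _ (does_seq (H' a s Es _) (H (f a) _ _ _))).
- by store_ext.
- rewrite ltnS leq_add2l; apply: leq_trans (pd _) _.
  by case: (d) => // e; rewrite leq_exp2r // !ltnS Hq.
- by move=> i ik; apply: ks; lia.
- by [].
- by move=> i ik; rewrite /upd; case: eqP => [?|_]; [lia|apply: ks; lia].
Qed.

Fixpoint push_all (w : bits) : cmd :=
  if w is b :: w' then Seq (push_all w') (Push 0 b) else Skip.

Lemma does_push_all w s : does (push_all w) s (upd s 0 (w ++ s 0)) (4 * size w).+1.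
Proof.
elim: w s => [|b w IH] s /=.
  by apply: does_weak (does_skip _) => //; store_ext.
by apply: does_weak (does_seq (IH _) (does_push _ _ _)); [store_ext|lia].
Qed.

Lemma pf_const (B : Type) {rB : rep B} (b : B) : pf (fun _ : A => b).
Proof.
exists (Seq (clear 0) (push_all (code (enc b)))), 0.
exists (fun n => (2 * n).+1 + (4 * sz b).+1 + 1); split; first by poly_bound.
move=> a s Es _; apply: does_weak (does_seq (does_clear Es) (does_push_all _ _)).
  by store_ext; rewrite /upd /= cats0.
by rewrite /sz; lia.
Qed.

(* Registers [K] and [K.+1] hold reversed copies while a subprogram is running
   on the others. *)
Let st (s : store) K (x y z : bits) := upd (upd (upd s 0 x) K y) K.+1 z.

Lemma pf_node (f g : A -> tree) : pf f -> pf g -> pf (fun a => Node (f a) (g a)).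
Proof.
move=> pff pfg; have [q qq Hq] := pf_size pff; have [q' qq' Hq'] := pf_size pfg.
move: pff pfg => [c [k [p [pp H]]]] [c' [k' [p' [pp' H']]]].
pose K := (maxn k k').+1.
(* Each of the two programs consumes the argument, so two copies are made first. Moving a stack
   reverses it, hence a copy is restored when it is moved back. Both results are parked in the same
   way and finally put behind the bit [true] of the node. *)
exists (Seq (dup 0 K K.+1) (Seq (mv K.+1 0) (Seq c' (Seq (mv 0 K.+1) (Seq (mv K 0)
  (Seq c (Seq (mv 0 K) (Seq (mv K.+1 0) (Seq (mv K 0) (Push 0 true)))))))))), K.+2.
exists (fun n => 22 * n + p n + p' n + 12 * q n + 12 * q' n + 30).
split; first by poly_bound.
move=> a s Es ks; set v := code (enc a) in Es.
set F := code (enc (f a)); set G := code (enc (g a)).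
have rv (w : bits) : size (catrev w [::]) = size w by rewrite catrevE cats0 size_rev.
have vK (w u : bits) : catrev (catrev w [::]) u = w ++ u.
  by rewrite !catrevE cats0 revK.
have H1 : does (dup 0 K K.+1) s (st s K [::] (catrev v [::]) (catrev v [::])) (10 * size v).+1.
  apply: does_dup Es _ _ _; rewrite /K /st; [lia|lia|lia|apply: ks|apply: ks|];
    [lia|lia|by store_ext].
have H2 : does (mv K.+1 0) (st s K [::] (catrev v [::]) (catrev v [::]))
    (st s K v (catrev v [::]) [::]) (6 * size v).+1.
  rewrite -(rv v); apply: (does_mv (v := catrev v [::]) (w := [::])); rewrite /st /K ?vK ?cats0;
    [lia|by reads|by reads|by store_ext].
have H3 : does c' (st s K v (catrev v [::]) [::]) (st s K G (catrev v [::]) [::]) (p' (sz a)).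
  apply: does_weak _ (leqnn _) (H' a _ _ _); rewrite /st /K; [by store_ext|by reads|].
  by move=> i ik; rewrite /upd; do 3![case: eqP => [?|_]; try lia]; apply: ks; lia.
have H4 : does (mv 0 K.+1) (st s K G (catrev v [::]) [::])
    (st s K [::] (catrev v [::]) (catrev G [::])) (6 * size G).+1.
  by apply: (does_mv (v := G) (w := [::])); rewrite /st /K; [lia|reads|reads|store_ext].
have H5 : does (mv K 0) (st s K [::] (catrev v [::]) (catrev G [::]))
    (st s K v [::] (catrev G [::])) (6 * size v).+1.
  rewrite -(rv v); apply: (does_mv (v := catrev v [::]) (w := [::])); rewrite /st /K ?vK ?cats0;
    [lia|by reads|by reads|by store_ext].
have H6 : does c (st s K v [::] (catrev G [::])) (st s K F [::] (catrev G [::])) (p (sz a)).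
  apply: does_weak _ (leqnn _) (H a _ _ _); rewrite /st /K; [by store_ext|by reads|].
  by move=> i ik; rewrite /upd; do 3![case: eqP => [?|_]; try lia]; apply: ks; lia.
have H7 : does (mv 0 K) (st s K F [::] (catrev G [::]))
    (st s K [::] (catrev F [::]) (catrev G [::])) (6 * size F).+1.
  by apply: (does_mv (v := F) (w := [::])); rewrite /st /K; [lia|reads|reads|store_ext].
have H8 : does (mv K.+1 0) (st s K [::] (catrev F [::]) (catrev G [::]))
    (st s K G (catrev F [::]) [::]) (6 * size G).+1.
  rewrite -(rv G); apply: (does_mv (v := catrev G [::]) (w := [::])); rewrite /st /K ?vK ?cats0;
    [lia|by reads|by reads|by store_ext].
have H9 : does (mv K 0) (st s K G (catrev F [::]) [::])
    (st s K (F ++ G) [::] [::]) (6 * size F).+1.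
  rewrite -(rv F); apply: (does_mv (v := catrev F [::]) (w := G)); rewrite /st /K ?vK ?cats0;
    [lia|by reads|by reads|by store_ext].
apply: does_weak (does_seq H1 (does_seq H2 (does_seq H3 (does_seq H4 (does_seq H5
  (does_seq H6 (does_seq H7 (does_seq H8 (does_seq H9 (does_push _ _ _)))))))))).
  rewrite /st; store_ext; rewrite -?/(st _ _ _ _ _).
  - by symmetry; apply: ks; lia.
  - by symmetry; apply: ks; lia.
by have := Hq a; have := Hq' a; rewrite /sz -/v -/F -/G; lia.
Qed.

End Closure.

Definition left_child (t : tree) : tree := if t is Node a _ then a else Leaf.
Definition right_child (t : tree) : tree := if t is Node _ b then b else Leaf.

Lemma size_catrev_nil (T : Type) (w : seq T) : size (catrev w [::]) = size w.
Proof. by rewrite catrevE cats0 size_rev. Qed.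

Lemma catrev_catrev_nil (T : Type) (w u : seq T) :
  catrev (catrev w [::]) u = w ++ u.
Proof. by rewrite !catrevE cats0 revK. Qed.

Lemma sz_node (a b : tree) : sz (Node a b) = (size (code a) + size (code b)).+1.
Proof. by rewrite /sz /= size_cat. Qed.

Lemma pf_left_child : pf left_child.
Proof.
exists (If 0 (Seq (Pop 0) (Seq (split 0 1 2) (Seq (clear 0) (mv 1 0)))) Skip), 3.
exists (fun n => 20 * n + 20); split; first by poly_bound.
move=> t s Es ks; have [s1 s2] : s 1 = [::] /\ s 2 = [::] by rewrite !ks.
apply: does_weak (erefl _) _ (does_if (n := 20 * sz t + 19) _); first by lia.
rewrite Es; case: t Es => [|a b] /= Es.
  by apply: does_weak (does_skip _); [store_ext; rewrite Es|lia].
pose x := catrev (code a) [::].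
have H2 : does (split 0 1 2) (upd s 0 (code a ++ code b)) (upd (upd s 0 (code b)) 1 x)
    (12 * size (code a) + 4).
  by apply: (does_split (t := a) (w := code b) (x := [::])); [lia|lia|lia|reads|reads|reads|store_ext].
have H3 : does (clear 0) (upd (upd s 0 (code b)) 1 x) (upd (upd s 0 [::]) 1 x)
    (2 * size (code b)).+1.
  by apply: does_weak (does_clear (v := code b) _); [store_ext|lia|reads].
have H4 : does (mv 1 0) (upd (upd s 0 [::]) 1 x) (upd s 0 (code a)) (6 * size (code a)).+1.
  rewrite -(size_catrev_nil (code a)); apply: (does_mv (v := x) (w := [::])).
  - by [].
  - by reads.
  - by reads.
  - by rewrite catrev_catrev_nil cats0; store_ext.
apply: does_weak (does_seq (f := upd s 0 (code a ++ code b)) (n1 := 1) _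
  (does_seq H2 (does_seq H3 H4))) => //; last first.
  by apply: does_weak (does_pop _ _) => //; store_ext; rewrite Es.
by rewrite sz_node; lia.
Qed.

Lemma pf_right_child : pf right_child.
Proof.
exists (If 0 (Seq (Pop 0) (Seq (split 0 1 2) (clear 1))) Skip), 3.
exists (fun n => 20 * n + 20); split; first by poly_bound.
move=> t s Es ks; have [s1 s2] : s 1 = [::] /\ s 2 = [::] by rewrite !ks.
apply: does_weak (erefl _) _ (does_if (n := 20 * sz t + 19) _); first by lia.
rewrite Es; case: t Es => [|a b] /= Es.
  by apply: does_weak (does_skip _); [store_ext; rewrite Es|lia].
pose x := catrev (code a) [::].
have H2 : does (split 0 1 2) (upd s 0 (code a ++ code b)) (upd (upd s 0 (code b)) 1 x)
    (12 * size (code a) + 4).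
  by apply: (does_split (t := a) (w := code b) (x := [::])); [lia|lia|lia|reads|reads|reads|store_ext].
have H3 : does (clear 1) (upd (upd s 0 (code b)) 1 x) (upd s 0 (code b))
    (2 * size (code a)).+1.
  rewrite -(size_catrev_nil (code a)) -/x.
  by apply: does_weak (does_clear (v := x) _); [store_ext|lia|reads].
apply: does_weak (does_seq (f := upd s 0 (code a ++ code b)) (n1 := 1) _ (does_seq H2 H3)) => //;
  last first.
  by apply: does_weak (does_pop _ _) => //; store_ext; rewrite Es.
by rewrite sz_node; lia.
Qed.

Lemma pf_case (A B : Type) {rA : rep A} {rB : rep B} (c : A -> tree) (f g : A -> B) :
  pf c -> pf f -> pf g -> pf (fun a => if c a is Node _ _ then f a else g a).
Proof.
move=> pfc; have [q qq Hq] := pf_size pfc.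
move: pfc => [c0 [k0 [p0 [pp0 H0]]]] [c1 [k1 [p1 [pp1 H1]]]] [c2 [k2 [p2 [pp2 H2]]]].
pose K := (maxn k0 (maxn k1 k2)).+1.
pose br c' := Seq (clear 0) (Seq (mv K 0) c').
exists (Seq (dup 0 K K.+1) (Seq (mv K.+1 0) (Seq c0 (If 0 (br c1) (br c2))))), K.+2.
exists (fun n => 22 * n + p0 n + p1 n + p2 n + 2 * q n + 30).
split; first by poly_bound.
move=> a s Es ks; set v := code (enc a) in Es; pose x := catrev v [::].
have Ks i : 0 < i < K -> s i = [::] by move=> ?; apply: ks; lia.
have [sK sK1] : s K = [::] /\ s K.+1 = [::] by split; apply: ks; lia.
have K_ne0 : K <> 0 by rewrite /K.
have k0K : k0 < K by rewrite /K; lia.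
have k1K : k1 < K by rewrite /K; lia.
have k2K : k2 < K by rewrite /K; lia.
clearbody K.
have R1 : does (dup 0 K K.+1) s (upd (upd (upd s 0 [::]) K x) K.+1 x) (10 * size v).+1.
  by apply: does_dup Es sK sK1 _; [lia|lia|lia|rewrite /x; store_ext].
have R2 : does (mv K.+1 0) (upd (upd (upd s 0 [::]) K x) K.+1 x) (upd (upd s 0 v) K x)
    (6 * size v).+1.
  rewrite -(size_catrev_nil v); apply: (does_mv (v := x) (w := [::])).
  - by [].
  - by reads.
  - by reads.
  - by rewrite catrev_catrev_nil cats0; store_ext.
have R3 : does c0 (upd (upd s 0 v) K x) (upd (upd s 0 (code (enc (c a)))) K x) (p0 (sz a)).
  apply: does_weak _ (leqnn _) (H0 a _ _ _); [by store_ext|by reads|].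
  by move=> i ik; rewrite /upd; do 2![case: eqP => [?|_]; try lia]; apply: Ks; lia.
have R4 c' p (h : A -> B) : does c' (upd s 0 v) (upd s 0 (code (enc (h a)))) p ->
    does (br c') (upd (upd s 0 (code (enc (c a)))) K x) (upd s 0 (code (enc (h a))))
      (2 * q (sz a) + 6 * sz a + p + 4).
  move=> H.
  have Q1 : does (clear 0) (upd (upd s 0 (code (enc (c a)))) K x) (upd (upd s 0 [::]) K x)
      (2 * sz (c a)).+1.
    by apply: does_weak (does_clear (v := code (enc (c a))) _); [store_ext|rewrite /sz|reads].
  have Q2 : does (mv K 0) (upd (upd s 0 [::]) K x) (upd s 0 v) (6 * size v).+1.
    rewrite -(size_catrev_nil v); apply: (does_mv (v := x) (w := [::])).
    - by [].
    - by reads.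
    - by reads.
    - by rewrite catrev_catrev_nil cats0; store_ext.
  apply: does_weak (erefl _) _ (does_seq Q1 (does_seq Q2 H)).
  by rewrite -/(sz a); have := Hq a; lia.
have R5 c' k p (h : A -> B) : k < K -> (forall a s, s 0 = code (enc a) ->
    (forall i, 0 < i < k -> s i = [::]) -> does c' s (upd s 0 (code (enc (h a)))) (p (sz a))) ->
    does c' (upd s 0 v) (upd s 0 (code (enc (h a)))) (p (sz a)).
  move=> kK H; apply: does_weak _ (leqnn _) (H a _ _ _); [by store_ext|by reads|].
  by move=> i ik; rewrite /upd; case: eqP => [?|_]; [lia|apply: Ks; lia].
have := R4 _ _ _ (R5 _ _ _ _ k1K H1); have := R4 _ _ _ (R5 _ _ _ _ k2K H2).
move=> {R4 R5 H0 H1 H2} Q2 Q1.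
have R4 : does (If 0 (br c1) (br c2)) (upd (upd s 0 (code (enc (c a)))) K x)
    (upd s 0 (code (enc (if c a is Node _ _ then f a else g a))))
    (2 * q (sz a) + 6 * sz a + p1 (sz a) + p2 (sz a) + 5).
  apply: (does_weak (n := (2 * q (sz a) + 6 * sz a + p1 (sz a) + p2 (sz a) + 4).+1) erefl).
    by lia.
  have Etop : upd (upd s 0 (code (enc (c a)))) K x 0 = code (enc (c a)) by reads.
  apply: does_if; rewrite Etop; case: (c a) Q1 Q2 => [|l r] /= Q1 Q2.
    by apply: does_weak (erefl _) _ Q2; lia.
  by apply: does_weak (erefl _) _ Q1; lia.
apply: does_weak (erefl _) _ (does_seq R1 (does_seq R2 (does_seq R3 R4))).
by rewrite -/(sz a); lia.
Qed.

Lemma pf_tree (A B : Type) {rA : rep A} {rB : rep B} (f : A -> B) :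
  pf f -> pf (fun a => enc (f a)).
Proof. exact: pf_enc. Qed.

Section Fold.
Context (E A S : Type) {rE : rep E} {rA : rep A} {rS : rep S}.
Variables (l : E -> seq A) (s0 : E -> S) (h : A * S -> S) (b : nat -> nat).

Let fold (s : S) (u : seq A) : S := foldl (fun s a => h (a, s)) s u.

(** Iterating a polynomial-time step may blow up, for instance by repeated doubling. The bound on
    the accumulator after every prefix of the list excludes this, and then each round costs a fixed
    polynomial in the size of the input. *)
Lemma pf_foldl_bounded : pf l -> pf s0 -> pf h -> poly_bounded b ->
  (forall e u v, l e = u ++ v -> sz (fold (s0 e) u) <= b (sz e)) ->
  pf (fun e => fold (s0 e) (l e)).
Proof.
move=> pfl pfs0 pfh pb Hb; have [q qq Hq] := pf_size pfl.
have [c1 [k1 [p1 [pp1 H1]]]] := pf_node (pf_tree pfl) (pf_tree pfs0).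
move: pfh => [c2 [k2 [p2 [[d pd] H2]]]].
pose K := (maxn k1 k2).+3.
(* Register [K] holds the rest of the list and register 0 the accumulator. Putting the code of the
   next item and a bit [true] in front of the accumulator makes it the code of the pair to which [h]
   is applied. *)
pose body := Seq (Pop K) (Seq (split K K.+1 K.+2) (Seq (mv K.+1 0) (Seq (Push 0 true) c2))).
pose loop := While K true false body.
exists (Seq c1 (Seq (Pop 0) (Seq (split 0 K.+1 K.+2) (Seq (mv K.+1 K) (Seq loop (Pop K)))))).
pose step n := 18 * q n + (q n + b n).+3 ^ d + 20.
exists K.+3, (fun n => p1 n + 18 * q n + q n * step n + 40); split.
  rewrite /step; have ? := poly_bounded_comp (poly_bounded_exp d) (poly_boundedS (poly_bounded_add qq pb)).
  by poly_bound.
move=> e s Es ks.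
have Ks i : 0 < i < K -> s i = [::] by move=> ?; apply: ks; lia.
have [sK sK1 sK2] : [/\ s K = [::], s K.+1 = [::] & s K.+2 = [::]] by split; apply: ks; lia.
have K_gt0 : 0 < K by rewrite /K.
have k1K : k1 < K by rewrite /K; lia.
have k2K : k2 < K by rewrite /K; lia.
clearbody K.
pose st x y := upd (upd s 0 x) K y.
have loopP v u : l e = u ++ v ->
    does loop (st (code (enc (fold (s0 e) u))) (code (enc v)))
      (st (code (enc (fold (s0 e) (l e)))) [:: false]) (size v * step (sz e)).+1.
  elim: v u => [|x v IH] u El.
    apply: does_weak (does_done _ _) => //.
      by rewrite El cats0.
    by rewrite /st /upd eqxx.
  have El' : l e = rcons u x ++ v by rewrite cat_rcons.
  set y := fold (s0 e) u.
  have Ey : h (x, y) = fold (s0 e) (rcons u x) by rewrite /fold foldl_rcons.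
  have sz_x : sz x <= q (sz e).
    by have := Hq e; rewrite El; have := sz_cat (rA := rA) u (x :: v); rewrite sz_cons; have := sz_gt0 (rA := rep_seq rA) u; lia.
  have B1 : does (Pop K) (st (code (enc y)) (code (enc (x :: v))))
      (st (code (enc y)) (code (enc x) ++ code (enc v))) 1.
    by apply: does_weak (does_pop _ _) => //; rewrite /st; store_ext; reads.
  pose z := catrev (code (@enc A rA x)) [::].
  have B2 : does (split K K.+1 K.+2) (st (code (enc y)) (code (enc x) ++ code (enc v)))
      (upd (st (code (enc y)) (code (enc v))) K.+1 z) (12 * sz x + 4).
    apply: (does_split (t := enc x) (w := code (enc v)) (x := [::])); rewrite /st;
      [lia|lia|lia|by reads|by reads|by reads|by rewrite /z; store_ext].
  have B3 : does (mv K.+1 0) (upd (st (code (enc y)) (code (enc v))) K.+1 z)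
      (st (code (enc x) ++ code (enc y)) (code (enc v))) (6 * sz x).+1.
    rewrite /sz -(size_catrev_nil (code (enc x))).
    apply: (does_mv (v := z) (w := code (enc y))); rewrite /st.
    - by [].
    - by reads.
    - by reads.
    - by rewrite catrev_catrev_nil; store_ext.
  have B4 : does (Push 0 true) (st (code (enc x) ++ code (enc y)) (code (enc v)))
      (st (code (enc (x, y))) (code (enc v))) 2.
    by apply: does_weak (does_push _ _ _) => //; rewrite /st; store_ext; reads.
  have B5 : does c2 (st (code (enc (x, y))) (code (enc v)))
      (st (code (enc (fold (s0 e) (rcons u x)))) (code (enc v))) ((q (sz e) + b (sz e)).+3 ^ d).
    rewrite -Ey; apply: does_weak _ _ (H2 (x, y) _ _ _).
    - by rewrite /st; store_ext.
    - apply: leq_trans (pd _) _; rewrite sz_pair.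
      have := Hb _ _ _ El; rewrite -/y; case: (d) => // d' ?.
      by rewrite leq_exp2r //; lia.
    - by rewrite /st; reads.
    - by move=> i ik; rewrite /st /upd; do 2![case: eqP => [?|_]; try lia]; apply: Ks; lia.
  apply: does_weak (erefl _) _ (does_while _ (does_seq B1 (does_seq B2 (does_seq B3
    (does_seq B4 B5)))) (IH _ El')); last by rewrite /st /upd eqxx.
  by rewrite /= mulSn /step; lia.
set L := code (enc (l e)); set S0 := code (enc (s0 e)).
have sz_l : size L <= q (sz e) by exact: Hq.
have R1 : does c1 s (upd s 0 (true :: L ++ S0)) (p1 (sz e)).
  by apply: H1 => // i ik; apply: Ks; lia.
have R2 : does (Pop 0) (upd s 0 (true :: L ++ S0)) (upd s 0 (L ++ S0)) 1.
  by apply: does_weak (does_pop _ _) => //; store_ext; reads.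
pose z := catrev L [::].
have R3 : does (split 0 K.+1 K.+2) (upd s 0 (L ++ S0)) (upd (upd s 0 S0) K.+1 z)
    (12 * size L + 4).
  by apply: (does_split (t := enc (l e)) (w := S0) (x := [::])); [lia|lia|lia|reads|reads|reads|rewrite /z; store_ext].
have R4 : does (mv K.+1 K) (upd (upd s 0 S0) K.+1 z) (st S0 L) (6 * size L).+1.
  rewrite -(size_catrev_nil L); apply: (does_mv (v := z) (w := [::])); rewrite /st.
  - by lia.
  - by reads.
  - by reads.
  - by rewrite catrev_catrev_nil cats0; store_ext.
have R5 := loopP (l e) [::] erefl.
have R6 : does (Pop K) (st (code (enc (fold (s0 e) (l e)))) [:: false])
    (upd s 0 (code (enc (fold (s0 e) (l e))))) 1.
  by apply: does_weak (does_pop _ _) => //; rewrite /st; store_ext; reads.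
apply: does_weak (erefl _) _ (does_seq R1 (does_seq R2 (does_seq R3 (does_seq R4
  (does_seq R5 R6))))).
have le_l : size (l e) <= q (sz e) by apply: leq_trans (size_le_sz _) sz_l.
have : size (l e) * step (sz e) <= q (sz e) * step (sz e) by rewrite leq_mul2r le_l orbT.
by lia.
Qed.

End Fold.

(** * Conversion between raw bit strings and encoded data *)

Definition encode_input : cmd :=
  Seq (mv 0 1) (Seq (Push 0 false)
   (While 1 true true
     (Seq (If 1 (Seq (Push 0 false) (Seq (Push 0 false) (Seq (Push 0 true) (Push 0 true))))
                (Seq (Push 0 false) (Push 0 true)))
          (Pop 1)))).

Lemma does_encode_input x :
  does encode_input (input_store x) (upd (fun=> [::]) 0 (code (enc x))) (30 * size x + 10).
Proof.
have H1 : does (mv 0 1) (input_store x) (upd (fun=> [::]) 1 (rev x)) (6 * size x).+1.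
  apply: (does_mv (v := x) (w := [::])) => //.
  by rewrite /input_store -[catrev _ _]/(rev x); store_ext.
have H2 : does (Push 0 false) (upd (fun=> [::]) 1 (rev x))
    (upd (upd (fun=> [::]) 1 (rev x)) 0 [:: false]) 2.
  by apply: does_weak (does_push _ _ _).
have loopP u v : does (While 1 true true
     (Seq (If 1 (Seq (Push 0 false) (Seq (Push 0 false) (Seq (Push 0 true) (Push 0 true))))
                (Seq (Push 0 false) (Push 0 true)))
          (Pop 1))) (upd (upd (fun=> [::]) 1 (rev u)) 0 (code (enc v)))
    (upd (fun=> [::]) 0 (code (enc (u ++ v)))) (20 * size u).+1.
  elim/last_ind: u v => [|u b IH] v.
    by apply: does_weak (does_done _ _) => //; store_ext.
  rewrite rev_rcons.
  have step : does (Seq (If 1 (Seq (Push 0 false) (Seq (Push 0 false)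
        (Seq (Push 0 true) (Push 0 true)))) (Seq (Push 0 false) (Push 0 true))) (Pop 1))
      (upd (upd (fun=> [::]) 1 (b :: rev u)) 0 (code (enc v)))
      (upd (upd (fun=> [::]) 1 (rev u)) 0 (code (enc (b :: v)))) 16.
    have H3 : does (Pop 1) (upd (upd (fun=> [::]) 1 (b :: rev u)) 0 (code (enc (b :: v))))
        (upd (upd (fun=> [::]) 1 (rev u)) 0 (code (enc (b :: v)))) 1.
      by apply: does_weak (does_pop _ _) => //; store_ext.
    apply: does_weak (erefl _) _ (does_seq (n1 := 12) _ H3) => //.
    apply: does_if; case: b {H3} => /=.
      by apply: does_weak (does_seq (does_push _ _ _) (does_seq (does_push _ _ _)
        (does_seq (does_push _ _ _) (does_push _ _ _)))) => //; store_ext.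
    by apply: does_weak (does_seq (does_push _ _ _) (does_push _ _ _)) => //; store_ext.
  rewrite cat_rcons; apply: does_weak (erefl _) _ (does_while _ step (IH _)).
    by rewrite size_rcons; lia.
  by case: b {step}.
have := loopP x [::]; rewrite cats0 => H3.
by apply: does_weak (erefl _) _ (does_seq H1 (does_seq H2 H3)); lia.
Qed.

Definition decode_output : cmd :=
  Seq (While 0 true false
    (Seq (Pop 0) (If 0 (Seq (Push 1 true) (Seq (Pop 0) (Seq (Pop 0) (Pop 0))))
                       (Seq (Push 1 false) (Pop 0)))))
   (Seq (Pop 0) (mv 1 0)).

Lemma does_decode_output (x : bits) s : s 1 = [::] -> s 0 = code (enc x) ->
  does decode_output s (upd s 0 x) (30 * size x + 10).
Proof.
move=> s1 s0.
have loopP u v : does (While 0 true false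
    (Seq (Pop 0) (If 0 (Seq (Push 1 true) (Seq (Pop 0) (Seq (Pop 0) (Pop 0))))
                       (Seq (Push 1 false) (Pop 0)))))
    (upd (upd s 1 v) 0 (code (enc u))) (upd (upd s 1 (catrev u v)) 0 [:: false]) (20 * size u).+1.
  elim: u v => [|b u IH] v.
    by apply: does_weak (does_done _ _) => //; store_ext.
  have step : does (Seq (Pop 0) (If 0 (Seq (Push 1 true) (Seq (Pop 0) (Seq (Pop 0) (Pop 0))))
                       (Seq (Push 1 false) (Pop 0))))
      (upd (upd s 1 v) 0 (code (enc (b :: u)))) (upd (upd s 1 (b :: v)) 0 (code (enc u))) 14.
    apply: does_weak (erefl _) _ (does_seq (does_pop _ _) (does_if (n := 8) _)) => //.
    case: b => /=.
      by apply: does_weak (does_seq (does_push _ _ _) (does_seq (does_pop _ _)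
          (does_seq (does_pop _ _) (does_pop _ _)))) => //; store_ext.
    by apply: does_weak (does_seq (does_push _ _ _) (does_pop _ _)) => //; store_ext.
  by apply: does_weak (erefl _) _ (does_while _ step (IH _)) => //=; lia.
have := loopP x [::]; set f := upd _ 0 (code _) => H1.
have {H1} H1 : does (While 0 true false
    (Seq (Pop 0) (If 0 (Seq (Push 1 true) (Seq (Pop 0) (Seq (Pop 0) (Pop 0))))
                       (Seq (Push 1 false) (Pop 0)))))
    s (upd (upd s 1 (catrev x [::])) 0 [:: false]) (20 * size x).+1.
  by move: H1; congr (does _ _ _ _); rewrite /f; store_ext.
have H2 : does (Pop 0) (upd (upd s 1 (catrev x [::])) 0 [:: false])
    (upd (upd s 1 (catrev x [::])) 0 [::]) 1.
  by apply: does_weak (does_pop _ _) => //; store_ext.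
have H3 : does (mv 1 0) (upd (upd s 1 (catrev x [::])) 0 [::]) (upd s 0 x) (6 * size x).+1.
  rewrite -(size_catrev_nil x); apply: (does_mv (v := catrev x [::]) (w := [::])) => //.
  by rewrite catrev_catrev_nil cats0; store_ext.
by apply: does_weak (erefl _) _ (does_seq H1 (does_seq H2 H3)); lia.
Qed.

Lemma sz_bits (x : seq bool) : sz x <= 4 * size x + 1.
Proof. by elim: x => // b x IH; rewrite sz_cons /=; have : sz b <= 3 by [case: b]; lia. Qed.

Lemma pf_polytime (f : seq bool -> seq bool) : pf f -> polytime f.
Proof.
move=> pff; have [q [e' qq] Hq] := pf_size pff; move: pff => [c [k [p [[e pp] H]]]].
have [d Hd] : poly_bounded (fun n => 30 * n + (4 * n + 1).+2 ^ e + 30 * (4 * n + 1).+2 ^ e' + 30).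
  have lin : poly_bounded (fun n => 4 * n + 1) by poly_bound.
  have ? := poly_bounded_comp (poly_bounded_exp e) lin.
  have ? := poly_bounded_comp (poly_bounded_exp e') lin.
  by poly_bound.
have mono m n i : m <= n -> m.+2 ^ i <= n.+2 ^ i by case: i => // i mn; rewrite leq_exp2r.
(* The coefficient [3 ^ d] turns [n.+2 ^ d] into the required form [a * n ^ d + a]: [n.+2 <= 3 * n]
   for positive [n], and [2 ^ d <= 3 ^ d] covers [n = 0]. *)
apply: (@exec_polytime (Seq encode_input (Seq c decode_output)) f (3 ^ d) d) => y; pose x : seq bool := y; rewrite -/x.
have H1 := does_encode_input x.
pose s : store := upd (fun=> [::]) 0 (code (@enc (seq bool) (rep_seq rep_bool) x)).
have [//|[]//|n2 le2 H2] := H x s.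
have H3 : does decode_output (upd s 0 (code (enc (f x)))) (upd s 0 (f x)) (30 * size (f x) + 10).
  by apply: does_weak (does_decode_output _ _) => //; store_ext.
have {H2} H2 : does c s (upd s 0 (code (enc (f x)))) n2 by exists n2.
have [n n_le E] := does_seq H1 (does_seq H2 H3).
exists (upd s 0 (f x)), n; split=> //.
have szx := sz_bits x.
have B1 := mono _ _ e szx; have B2 := mono _ _ e' szx; have := pp (@sz (seq bool) (rep_seq rep_bool) x).
have := qq (@sz (seq bool) (rep_seq rep_bool) x); have := Hq x; have := size_le_sz (rA := rep_bool) (f x); have := Hd (size x).
have : (size x).+2 ^ d <= 3 ^ d * size x ^ d + 3 ^ d.
  case: (size x) => [|m]; last first.
    by rewrite -expnMn; apply: leq_trans (leq_addr _ _); case: (d) => // d'; rewrite leq_exp2r //; lia.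
  by apply: leq_trans (leq_addl _ _); case: (d) => // d'; rewrite leq_exp2r.
by move: (3 ^ d * size x ^ d) => u; move: (3 ^ d) => v; lia.
Qed.

(** * A library of polynomial-time functions *)

Section Basic.
Context {E : Type} {rE : rep E}.
Section Poly.
Context {A B : Type} {rA : rep A} {rB : rep B}.

Lemma pf_pair (f : E -> A) (g : E -> B) :
  pf f -> pf g -> pf (fun e => (f e, g e)).
Proof. by move=> pff pfg; apply: pf_enc (pf_node (pf_tree pff) (pf_tree pfg)). Qed.

Lemma pf_fst (f : E -> A * B) : pf f -> pf (fun e => (f e).1).
Proof. by move=> pff; apply: pf_enc (pf_comp pf_left_child (pf_tree pff)). Qed.

Lemma pf_snd (f : E -> A * B) : pf f -> pf (fun e => (f e).2).
Proof. by move=> pff; apply: pf_enc (pf_comp pf_right_child (pf_tree pff)). Qed.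

Lemma pf_if (b : E -> bool) (f g : E -> A) :
  pf b -> pf f -> pf g -> pf (fun e => if b e then f e else g e).
Proof.
move=> pfb pff pfg; apply: pf_ext (pf_case (pf_tree pfb) pff pfg) => e.
by case: (b e).
Qed.

Lemma pf_cons (f : E -> A) (l : E -> seq A) :
  pf f -> pf l -> pf (fun e => f e :: l e).
Proof. by move=> pff pfl; apply: pf_enc (pf_node (pf_tree pff) (pf_tree pfl)). Qed.

Lemma pf_behead (l : E -> seq A) : pf l -> pf (fun e => behead (l e)).
Proof.
move=> pfl; apply: pf_enc (pf_comp pf_right_child (pf_tree pfl)) => e.
by case: (l e).
Qed.

Lemma pf_nilp (l : E -> seq A) : pf l -> pf (fun e => nilp (l e)).
Proof.
move=> pfl.
apply: pf_ext (pf_case (pf_tree pfl) (pf_const false) (pf_const true)) => e.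
by case: (l e).
Qed.

Lemma pf_head (x0 : A) (l : E -> seq A) : pf l -> pf (fun e => head x0 (l e)).
Proof.
move=> pfl; apply: pf_enc (pf_case (pf_tree pfl)
  (pf_comp pf_left_child (pf_tree pfl)) (pf_const (enc x0))) => e.
by case: (l e).
Qed.

End Poly.

Lemma pf_succ (n : E -> nat) : pf n -> pf (fun e => (n e).+1).
Proof. by move=> pfn; apply: pf_enc (pf_node (pf_const Leaf) (pf_tree pfn)). Qed.

Lemma pf_pred (n : E -> nat) : pf n -> pf (fun e => (n e).-1).
Proof.
move=> pfn; apply: pf_enc (pf_comp pf_right_child (pf_tree pfn)) => e.
by case: (n e).
Qed.

Lemma pf_eq0 (n : E -> nat) : pf n -> pf (fun e => n e == 0).
Proof.
move=> pfn.
apply: pf_ext (pf_case (pf_tree pfn) (pf_const false) (pf_const true)) => e.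
by case: (n e).
Qed.

(** A number has the same code as the list of that many units, so folds over lists also provide
    iteration over numbers. *)
Lemma pf_nseq_tt (n : E -> nat) : pf n -> pf (fun e => nseq (n e) tt).
Proof. by apply: pf_enc => e; elim: (n e) => //= k ->. Qed.

Lemma pf_neg (b : E -> bool) : pf b -> pf (fun e => ~~ b e).
Proof.
move=> pfb; apply: pf_ext (pf_if pfb (pf_const false) (pf_const true)) => e.
by case: (b e).
Qed.

Lemma pf_and (b c : E -> bool) : pf b -> pf c -> pf (fun e => b e && c e).
Proof. by move=> pfb pfc; apply: pf_if pfb pfc (pf_const false). Qed.

Lemma pf_or (b c : E -> bool) : pf b -> pf c -> pf (fun e => b e || c e).
Proof. by move=> pfb pfc; apply: pf_if pfb (pf_const true) pfc. Qed.

End Basic.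

Section FoldContext.
Context {E A S : Type} {rE : rep E} {rA : rep A} {rS : rep S}.
Variables (l : E -> seq A) (s0 : E -> S) (h : E -> S -> A -> S).

(** The step function may depend on the environment [e]. It travels inside the accumulator, because
    the step of the basic fold sees only the item and the accumulator. *)
Lemma pf_foldl b :
  pf l -> pf s0 -> pf (fun p : E * S * A => h p.1.1 p.1.2 p.2) ->
  poly_bounded b ->
  (forall e u v, l e = u ++ v -> sz (foldl (h e) (s0 e) u) <= b (sz e)) ->
  pf (fun e => foldl (h e) (s0 e) (l e)).
Proof.
move=> pfl pfs0 pfh pb Hb.
pose h' (p : A * (E * S)) := (p.2.1, h p.2.1 p.2.2 p.1).
have foldE e s u : foldl (fun t a => h' (a, t)) (e, s) u = (e, foldl (h e) s u).
  by elim: u s => //= a u IH s; rewrite -IH.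
have pfh' : pf h'.
  apply: pf_pair; first exact: pf_fst (pf_snd pf_id).
  apply: (pf_comp (f := fun p : A * (E * S) => (p.2, p.1)) pfh).
  exact: pf_pair (pf_snd pf_id) (pf_fst pf_id).
have := @pf_foldl_bounded E A (E * S) rE rA (rep_prod rE rS) l (fun e => (e, s0 e)) h' (fun n => (n + b n).+1).
move=> /(_ pfl (pf_pair pf_id pfs0) pfh') H.
apply: pf_ext (pf_snd (H _ _)) => [e|//|e u v El]; first by rewrite foldE.
- by poly_bound.
- by rewrite foldE sz_pair; have := Hb e u v El; lia.
Qed.

(** If the growth per round depends on the environment and the item but not on the accumulator, all
    accumulators stay polynomial: there are at most as many rounds as the list is long, and each
    adds at most [(sz e + Q).+2 ^ d], where [Q] bounds the code of the list. *)
Lemma pf_foldl_add d :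
  pf l -> pf s0 -> pf (fun p : E * S * A => h p.1.1 p.1.2 p.2) ->
  (forall e s a, sz (h e s a) <= sz s + (sz e + sz a).+2 ^ d) ->
  pf (fun e => foldl (h e) (s0 e) (l e)).
Proof.
move=> pfl pfs0 pfh Hd; have [q qq Hq] := pf_size pfl; have [q' qq' Hq'] := pf_size pfs0.
apply: (@pf_foldl (fun n => q' n + q n * (n + q n).+2 ^ d)) => //.
  have ? := poly_bounded_comp (poly_bounded_exp d) (poly_bounded_add poly_bounded_id qq).
  by poly_bound.
move=> e u v El; have le_s0 := Hq' e.
have : sz u <= q (sz e).
  by have := Hq e; rewrite El; have := sz_cat (rA := rA) u v; have := sz_gt0 (rA := rep_seq rA) v; lia.
move: (q _) (q' _) le_s0 => Q Q' le_s0 le_u.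
apply: (@leq_trans (Q' + size u * (sz e + Q).+2 ^ d)); last first.
  by rewrite leq_add2l leq_mul2r (leq_trans (size_le_sz _) le_u) orbT.
elim/last_ind: u le_u {El} => [|u a IH] /=; first by rewrite mul0n addn0.
rewrite -cats1 => le_u; have := sz_cat (rA := rA) u [:: a].
have := sz_gt0 (rA := rep_seq rA) u; have := sz_gt0 (rA := rA) a.
rewrite sz_cons (_ : sz [::] = 1) // => a0 u0 E1.
have le1 : sz u <= Q by lia.
have le2 : sz a <= Q by lia.
rewrite foldl_cat /=; apply: leq_trans (Hd _ _ _) _.
rewrite size_cat addn1 mulSn.
have : (sz e + sz a).+2 ^ d <= (sz e + Q).+2 ^ d.
  by case: (d) => // d'; rewrite leq_exp2r //; lia.
by have := IH le1; move: (_ ^ d) (_ ^ d) (_ * _); lia.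
Qed.

End FoldContext.

(** Brings an output bound into the shape expected by [pf_foldl_add]. Strictness pays for the bit
    added when the value is consed to a list. *)
Lemma pf_size_pair (E A B : Type) {rE : rep E} {rA : rep A} {rB : rep B} (f : E * A -> B) :
  pf f -> exists d, forall e a, sz (f (e, a)) < (sz e + sz a).+2 ^ d.
Proof.
move=> pff; have [q [d qd] Hq] := pf_size pff; exists (2 * d).+1 => e a.
have := leq_trans (Hq (e, a)) (qd _); rewrite sz_pair; set x := sz e + sz a => H.
apply: leq_ltn_trans H _; rewrite expnS expnM.
have le : x.+3 ^ d <= (x.+2 ^ 2) ^ d.
  by case: (d) => // d'; rewrite leq_exp2r // expnS expn1; nia.
have : 0 < (x.+2 ^ 2) ^ d by rewrite !expn_gt0.
by move: (_ ^ d) (_ ^ d) le => u v; nia.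
Qed.

Section Lists.
Context {E A : Type} {rE : rep E} {rA : rep A}.

Lemma pf_catrev (l s : E -> seq A) : pf l -> pf s -> pf (fun e => catrev (l e) (s e)).
Proof.
move=> pfl pfs.
apply: (pf_ext (f := fun e => foldl (fun s a => a :: s) (s e) (l e))).
  by move=> e; elim: (l e) (s e) => //=.
apply: (pf_foldl_add (h := fun _ s a => a :: s) (d := 1)) => //.
  exact: pf_cons (pf_snd pf_id) (pf_snd (pf_fst pf_id)).
by move=> e t a; rewrite sz_cons expn1; lia.
Qed.

Lemma pf_rev (l : E -> seq A) : pf l -> pf (fun e => rev (l e)).
Proof. by move=> pfl; apply: pf_catrev pfl (pf_const [::]). Qed.

Lemma pf_cat (l s : E -> seq A) : pf l -> pf s -> pf (fun e => l e ++ s e).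
Proof.
move=> pfl pfs; apply: pf_ext (pf_catrev (pf_rev pfl) pfs) => e.
by rewrite catrevE revK.
Qed.

Lemma pf_size_seq (l : E -> seq A) : pf l -> pf (fun e => size (l e)).
Proof.
move=> pfl; apply: (pf_ext (f := fun e => foldl (fun n a => n.+1) 0 (l e))).
  move=> e; rewrite -[size (l e)]addn0; elim: (l e) 0 => //= a s IH n.
  by rewrite IH addnS.
apply: (pf_foldl_add (h := fun _ n _ => n.+1) (d := 1)) => //; first exact: pf_const.
  exact: pf_succ (pf_snd (pf_fst pf_id)).
by move=> e n a; rewrite !sz_nat; lia.
Qed.

End Lists.

Section Lists.
Context {E A : Type} {rE : rep E} {rA : rep A}.

Lemma pf_map (B : Type) {rB : rep B} (l : E -> seq A) (f : E -> A -> B) :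
  pf l -> pf (fun p : E * A => f p.1 p.2) -> pf (fun e => [seq f e a | a <- l e]).
Proof.
move=> pfl pff; have [d Hd] := pf_size_pair pff.
apply: (pf_ext (f := fun e => rev (foldl (fun s a => f e a :: s) [::] (l e)))).
  move=> e; rewrite -[RHS]revK; congr rev; rewrite -[RHS]cats0.
  elim: (l e) [::] => //= a u IH s; rewrite IH rev_cons cat_rcons //.
apply: pf_rev; apply: (pf_foldl_add (h := fun e s a => f e a :: s) (d := d)) => //.
- exact: pf_const.
- apply: pf_cons (pf_snd (pf_fst pf_id)).
  exact: (pf_comp pff (pf_pair (pf_fst (pf_fst pf_id)) (pf_snd pf_id))).
by move=> e s a; rewrite sz_cons; have := Hd e a; rewrite /=; lia.
Qed.

Lemma pf_flatmap (B : Type) {rB : rep B} (l : E -> seq A) (f : E -> A -> seq B) :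
  pf l -> pf (fun p : E * A => f p.1 p.2) ->
  pf (fun e => flatten [seq f e a | a <- l e]).
Proof.
move=> pfl pff; have [d Hd] := pf_size_pair pff.
apply: (pf_ext (f := fun e => foldl (fun s a => s ++ f e a) [::] (l e))).
  move=> e; rewrite -[RHS]cat0s; elim: (l e) [::] => [|a u IH] s /=; first by rewrite cats0.
  by rewrite IH catA.
apply: (pf_foldl_add (h := fun e s a => s ++ f e a) (d := d)) => //.
- exact: pf_const.
- apply: pf_cat (pf_snd (pf_fst pf_id)) _.
  exact: (pf_comp pff (pf_pair (pf_fst (pf_fst pf_id)) (pf_snd pf_id))).
by move=> e s a; have := sz_cat (rA := rB) s (f e a); have := Hd e a; rewrite /=; lia.
Qed.

End Lists.

Section Lists.
Context {E A : Type} {rE : rep E} {rA : rep A}.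

Lemma pf_flatten (l : E -> seq (seq A)) : pf l -> pf (fun e => flatten (l e)).
Proof.
move=> pfl; apply: pf_ext (pf_flatmap pfl (f := fun _ s => s) (pf_snd pf_id)) => e.
by rewrite map_id.
Qed.

Lemma pf_filter (l : E -> seq A) (p : E -> A -> bool) :
  pf l -> pf (fun q : E * A => p q.1 q.2) -> pf (fun e => [seq a <- l e | p e a]).
Proof.
move=> pfl pfp.
pose g e a := if p e a then [:: a] else [::].
apply: (pf_ext (f := fun e => flatten [seq g e a | a <- l e])).
  by move=> e; elim: (l e) => //= a u ->; rewrite /g; case: (p e a).
apply: pf_flatmap => //.
exact: pf_if pfp (pf_cons (pf_snd pf_id) (pf_const [::])) (pf_const [::]).
Qed.

Lemma pf_all (l : E -> seq A) (p : E -> A -> bool) :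
  pf l -> pf (fun q : E * A => p q.1 q.2) -> pf (fun e => all (p e) (l e)).
Proof.
move=> pfl pfp.
apply: pf_ext (pf_nilp (pf_filter (p := fun e a => ~~ p e a) pfl (pf_neg pfp))) => e.
by elim: (l e) => //= a u <-; case: (p e a).
Qed.

Lemma pf_has (l : E -> seq A) (p : E -> A -> bool) :
  pf l -> pf (fun q : E * A => p q.1 q.2) -> pf (fun e => has (p e) (l e)).
Proof.
move=> pfl pfp; apply: pf_ext (pf_neg (pf_all (p := fun e a => ~~ p e a) pfl (pf_neg pfp))) => e.
by elim: (l e) => //= a u <-; case: (p e a).
Qed.

Lemma pf_iter (n : E -> nat) (s0 : E -> A) (h : E -> A -> A) d :
  pf n -> pf s0 -> pf (fun p : E * A => h p.1 p.2) ->
  (forall e s, sz (h e s) <= sz s + (sz e).+2 ^ d) ->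
  pf (fun e => iter (n e) (h e) (s0 e)).
Proof.
move=> pfn pfs0 pfh Hd.
apply: (pf_ext (f := fun e => foldl (fun s _ => h e s) (s0 e) (nseq (n e) tt))).
  by move=> e; elim: (n e) (s0 e) => //= k IH s; rewrite IH -iterSr.
apply: (pf_foldl_add (h := fun e s _ => h e s) (d := d)) => //.
- exact: pf_nseq_tt.
- exact: (pf_comp pfh (pf_fst pf_id)).
move=> e s a; apply: leq_trans (Hd e s) _; rewrite leq_add2l.
by case: (d) => // d'; rewrite leq_exp2r //; lia.
Qed.

End Lists.

Section Lists.
Context {E A : Type} {rE : rep E} {rA : rep A}.

Lemma pf_drop (n : E -> nat) (l : E -> seq A) :
  pf n -> pf l -> pf (fun e => drop (n e) (l e)).
Proof.
move=> pfn pfl.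
apply: (pf_ext (f := fun e => iter (n e) behead (l e))).
  by move=> e; elim: (n e) => [|k IH]; rewrite ?drop0 //= IH -drop1 drop_drop.
apply: (pf_iter (h := fun=> behead) (d := 0)) => //; first exact: pf_behead (pf_snd pf_id).
by move=> e [|a s] //=; rewrite sz_cons; lia.
Qed.

Lemma pf_take (n : E -> nat) (l : E -> seq A) :
  pf n -> pf l -> pf (fun e => take (n e) (l e)).
Proof.
move=> pfn pfl.
apply: (pf_ext (f := fun e => rev (drop (size (drop (n e) (l e))) (rev (l e))))).
  move=> e; rewrite size_drop; have [le|/ltnW le] := leqP (n e) (size (l e)).
    by rewrite drop_rev subKn ?revK.
  by rewrite drop_rev revK (eqnP le) subn0 take_size take_oversize.
exact: pf_rev (pf_drop (pf_size_seq (pf_drop pfn pfl)) (pf_rev pfl)).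
Qed.

Lemma pf_nth (x0 : A) (l : E -> seq A) (n : E -> nat) :
  pf l -> pf n -> pf (fun e => nth x0 (l e) (n e)).
Proof.
move=> pfl pfn; apply: pf_ext (pf_head x0 (pf_drop pfn pfl)) => e.
by rewrite -nth0 nth_drop addn0.
Qed.

End Lists.

Section Numbers.
Context {E : Type} {rE : rep E}.
Implicit Types m n : E -> nat.

Lemma pf_add m n : pf m -> pf n -> pf (fun e => m e + n e).
Proof.
move=> pfm pfn; apply: (pf_ext (f := fun e => iter (m e) succn (n e))).
  by move=> e; rewrite iter_succn addnC.
apply: (pf_iter (h := fun=> succn) (d := 1)) => //; first exact: pf_succ (pf_snd pf_id).
by move=> e s; rewrite !sz_nat; lia.
Qed.

Lemma pf_sub m n : pf m -> pf n -> pf (fun e => m e - n e).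
Proof.
move=> pfm pfn; apply: (pf_ext (f := fun e => iter (n e) predn (m e))).
  by move=> e; rewrite iter_predn.
apply: (pf_iter (h := fun=> predn) (d := 1)) => //; first exact: pf_pred (pf_snd pf_id).
by move=> e s; rewrite !sz_nat; lia.
Qed.

Lemma pf_mul m n : pf m -> pf n -> pf (fun e => m e * n e).
Proof.
move=> pfm pfn; apply: (pf_ext (f := fun e => size (flatten [seq nseq (n e) tt | _ <- nseq (m e) tt]))).
  by move=> e; elim: (m e) => //= k IH; rewrite size_cat IH size_nseq mulSn.
apply: pf_size_seq; apply: (pf_flatmap (f := fun e _ => nseq (n e) tt)); first exact: pf_nseq_tt.
by apply: pf_nseq_tt; apply: pf_comp pfn (pf_fst pf_id).
Qed.

Lemma pf_exp n d : pf n -> pf (fun e => n e ^ d).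
Proof.
move=> pfn; elim: d => [|d IH]; first exact: pf_const.
by apply: pf_ext (pf_mul pfn IH) => e; rewrite expnS.
Qed.

Lemma pf_leq m n : pf m -> pf n -> pf (fun e => m e <= n e).
Proof. by move=> pfm pfn; apply: pf_eq0 (pf_sub pfm pfn). Qed.

Lemma pf_eqn m n : pf m -> pf n -> pf (fun e => m e == n e).
Proof.
move=> pfm pfn; apply: pf_ext (pf_and (pf_leq pfm pfn) (pf_leq pfn pfm)) => e.
by rewrite eqn_leq.
Qed.

End Numbers.

Section Numbers.
Context {E : Type} {rE : rep E}.
Implicit Types m n : E -> nat.

Lemma pf_iota m n : pf m -> pf n -> pf (fun e => iota (m e) (n e)).
Proof.
move=> pfm pfn.
have pf0 : pf (fun e => iota 0 (n e)).
  have iotaE (u : seq unit) : foldl (fun s _ => rcons s (size s)) [::] u = iota 0 (size u).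
    elim/last_ind: u => // u a IH; rewrite -cats1 foldl_cat /= IH size_iota size_cat addn1.
    by rewrite -addn1 iotaD cats1.
  apply: (pf_ext (f := fun e => foldl (fun s _ => rcons s (size s)) [::] (nseq (n e) tt))).
    by move=> e; rewrite iotaE size_nseq.
  have [q qq Hq] := pf_size pfn.
  apply: (pf_foldl (h := fun _ s _ => rcons s (size s)) (b := fun k => (2 * q k + 3) * q k + 1)).
  - exact: pf_nseq_tt.
  - exact: pf_const.
  - apply: pf_ext (pf_cat (pf_snd (pf_fst pf_id))
      (pf_cons (pf_size_seq (pf_snd (pf_fst pf_id))) (pf_const [::]))) => p.
    by rewrite cats1.
  - by poly_bound.
  move=> e u v El; rewrite iotaE.
  have le_u : size u <= q (sz e).
    have := Hq e; have := congr1 size El; rewrite size_nseq size_cat sz_nat; lia.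
  have szi k j : sz (iota j k) <= (2 * (j + k) + 3) * k + 1.
    elim: k j => [|k IH] j; first by rewrite muln0.
    by rewrite /= sz_cons sz_nat; have := IH j.+1; nia.
  apply: leq_trans (szi _ _) _; rewrite add0n leq_add2r.
  by rewrite leq_mul // leq_add2r leq_mul2l.
apply: pf_ext (pf_map (f := fun e i => m e + i) pf0 _) => [e|].
  by rewrite -iotaDl addn0.
exact: pf_add (pf_comp pfm (pf_fst pf_id)) (pf_snd pf_id).
Qed.

Lemma pf_odd n : pf n -> pf (fun e => odd (n e)).
Proof.
move=> pfn; apply: (pf_ext (f := fun e => iter (n e) negb false)).
  by move=> e; elim: (n e) => //= k ->.
apply: (pf_iter (h := fun=> negb) (d := 2)) => //; first exact: pf_const.
  exact: pf_neg (pf_snd pf_id).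
by move=> e [] //=; rewrite /sz /=; have := sz_gt0 (rA := rE) e; rewrite /sz expnS expn1; nia.
Qed.

End Numbers.

Section Numbers.
Context {E : Type} {rE : rep E}.
Implicit Types m n : E -> nat.

Lemma pf_half n : pf n -> pf (fun e => (n e)./2).
Proof.
move=> pfn; apply: (pf_ext (f := fun e => size [seq i <- iota 0 (n e) | odd i])).
  move=> e; elim: (n e) => // k IH.
  have -> : iota 0 k.+1 = rcons (iota 0 k) k by rewrite -[k.+1]addn1 iotaD add0n cats1.
  by rewrite filter_rcons fun_if size_rcons IH [RHS]uphalf_half; case: (odd k).
apply: pf_size_seq; apply: (pf_filter (p := fun _ => odd)); first exact: pf_iota (pf_const 0) pfn.
exact: pf_odd (pf_snd pf_id).
Qed.

End Numbers.

(** * Polynomial-time decidable equality *)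

Definition pf_equality (T : eqType) {rT : rep T} : Prop :=
  pf (fun p : T * T => p.1 == p.2).
Arguments pf_equality T {rT}.

Lemma pf_eq (E : Type) (T : eqType) {rE : rep E} {rT : rep T} (f g : E -> T) :
  pf_equality T -> pf f -> pf g -> pf (fun e => f e == g e).
Proof. by move=> eqT pff pfg; apply: (pf_comp eqT (pf_pair pff pfg)). Qed.

Lemma pf_equality_nat : pf_equality nat.
Proof. exact: pf_eqn (pf_fst pf_id) (pf_snd pf_id). Qed.

Lemma pf_equality_bool : pf_equality bool.
Proof.
apply: pf_ext (pf_if (pf_fst pf_id) (pf_snd pf_id) (pf_neg (pf_snd pf_id))).
by case=> [[] []].
Qed.

Lemma pf_equality_prod (T U : eqType) {rT : rep T} {rU : rep U} :
  pf_equality T -> pf_equality U -> pf_equality (T * U)%type.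
Proof.
move=> eqT eqU; apply: pf_and; apply: pf_eq => //;
  [exact: pf_fst (pf_fst pf_id)|exact: pf_fst (pf_snd pf_id)
  |exact: pf_snd (pf_fst pf_id)|exact: pf_snd (pf_snd pf_id)].
Qed.

Lemma pf_equality_seq (T : eqType) {rT : rep T} (x0 : T) :
  pf_equality T -> pf_equality (seq T).
Proof.
move=> eqT.
pose t (p : seq T * seq T) i := nth x0 p.1 i == nth x0 p.2 i.
apply: (pf_ext (f := fun p => (size p.1 == size p.2) && all (t p) (iota 0 (size p.1)))).
  move=> [u v]; apply/andP/eqP => [[/eqP /= uv /allP H]|/= ->]; last first.
    by split=> //; apply/allP=> i _; rewrite /t.
  apply: (eq_from_nth (x0 := x0)) => // i iu; apply/eqP; apply: H.
  by rewrite mem_iota.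
apply: pf_and.
  exact: pf_eqn (pf_size_seq (pf_fst pf_id)) (pf_size_seq (pf_snd pf_id)).
apply: pf_all; first exact: pf_iota (pf_const 0) (pf_size_seq (pf_fst pf_id)).
by apply: pf_eq => //; apply: pf_nth;
  [exact: pf_fst (pf_fst pf_id)|exact: pf_snd pf_id
  |exact: pf_snd (pf_fst pf_id)|exact: pf_snd pf_id].
Qed.

Lemma pf_mem (E : Type) (T : eqType) {rE : rep E} {rT : rep T} (x : E -> T) (l : E -> seq T) :
  pf_equality T -> pf x -> pf l -> pf (fun e => x e \in l e).
Proof.
move=> eqT pfx pfl.
apply: (pf_ext (f := fun e => has (fun y => x e == y) (l e))).
  by move=> e; elim: (l e) => //= y u IH; rewrite inE -IH.
apply: (pf_has (p := fun e y => x e == y)) => //.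
by apply: pf_eq => //; [exact: pf_comp pfx (pf_fst pf_id)|exact: pf_snd pf_id].
Qed.

Lemma pf_perm_eq (E : Type) (T : eqType) {rE : rep E} {rT : rep T} (l s : E -> seq T) :
  pf_equality T -> pf l -> pf s -> pf (fun e => perm_eq (l e) (s e)).
Proof.
move=> eqT pfl pfs.
pose c (k : E * T -> seq T) (p : E * T) := size [seq y <- k p | y == p.2].
have pfc k : pf k -> pf (c k).
  move=> pfk; apply: pf_size_seq; apply: pf_filter => //.
  by apply: pf_eq => //; [exact: pf_snd pf_id|exact: pf_snd (pf_fst pf_id)].
apply: (pf_ext (f := fun e => all (fun x => c (fun p => l p.1) (e, x) == c (fun p => s p.1) (e, x))
                                  (l e ++ s e))).
  by move=> e; rewrite /perm_eq; apply: eq_all => x; rewrite /c !size_filter.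
apply: pf_all; first exact: pf_cat.
apply: pf_eqn.
  apply: (pf_ext (f := c (fun p => l p.1))); first by case.
  by apply: pfc; apply: pf_comp pfl (pf_fst pf_id).
apply: (pf_ext (f := c (fun p => s p.1))); first by case.
by apply: pfc; apply: pf_comp pfs (pf_fst pf_id).
Qed.

(** * Klondike is in NP *)

Definition build_pair (b : build_stack) := (block b, face_down b).
Definition pair_build (p : stack * stack) := Build p.1 p.2.
Lemma build_pairK : cancel build_pair pair_build. Proof. by case. Qed.
HB.instance Definition _ := Equality.copy build_stack (can_type build_pairK).

Definition config_pair (g : config) := (suit_stacks g, build_stacks g).
Definition pair_config (p : seq stack * seq build_stack) := Config p.1 p.2.
Lemma config_pairK : cancel config_pair pair_config. Proof. by case. Qed.
HB.instance Definition _ := Equality.copy config (can_type config_pairK).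

#[export] Instance rep_build : rep build_stack :=
  Rep (fun b => Node (enc (block b)) (enc (face_down b))).
#[export] Instance rep_config : rep config :=
  Rep (fun g => Node (enc (suit_stacks g)) (enc (build_stacks g))).
#[export] Instance rep_instance : rep instance :=
  Rep (fun I => Node (enc (colors I)) (Node (enc (max_rank I)) (enc (initial_builds I)))).

Section Records.
Context {E : Type} {rE : rep E}.

Lemma pf_block (b : E -> build_stack) : pf b -> pf (fun e => block (b e)).
Proof. by move=> pfb; apply: pf_enc (pf_comp pf_left_child (pf_tree pfb)). Qed.

Lemma pf_face_down (b : E -> build_stack) : pf b -> pf (fun e => face_down (b e)).
Proof. by move=> pfb; apply: pf_enc (pf_comp pf_right_child (pf_tree pfb)). Qed.

Lemma pf_Build (p d : E -> stack) : pf p -> pf d -> pf (fun e => Build (p e) (d e)).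
Proof. by move=> pfp pfd; apply: pf_enc (pf_pair pfp pfd). Qed.

Lemma pf_suit_stacks (g : E -> config) : pf g -> pf (fun e => suit_stacks (g e)).
Proof. by move=> pfg; apply: pf_enc (pf_comp pf_left_child (pf_tree pfg)). Qed.

Lemma pf_build_stacks (g : E -> config) : pf g -> pf (fun e => build_stacks (g e)).
Proof. by move=> pfg; apply: pf_enc (pf_comp pf_right_child (pf_tree pfg)). Qed.

Lemma pf_Config (ss : E -> seq stack) (bs : E -> seq build_stack) :
  pf ss -> pf bs -> pf (fun e => Config (ss e) (bs e)).
Proof. by move=> pfs pfb; apply: pf_enc (pf_pair pfs pfb). Qed.

Lemma pf_colors (I : E -> instance) : pf I -> pf (fun e => colors (I e)).
Proof. by move=> pfI; apply: pf_enc (pf_comp pf_left_child (pf_tree pfI)). Qed.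

Lemma pf_max_rank (I : E -> instance) : pf I -> pf (fun e => max_rank (I e)).
Proof.
by move=> pfI; apply: pf_enc (pf_comp pf_left_child (pf_comp pf_right_child (pf_tree pfI))).
Qed.

Lemma pf_initial_builds (I : E -> instance) : pf I -> pf (fun e => initial_builds (I e)).
Proof.
by move=> pfI; apply: pf_enc (pf_comp pf_right_child (pf_comp pf_right_child (pf_tree pfI))).
Qed.

Lemma pf_Instance (c : E -> seq bool) (n : E -> nat) (b : E -> seq stack) :
  pf c -> pf n -> pf b -> pf (fun e => Instance (c e) (n e) (b e)).
Proof. by move=> pfc pfn pfb; apply: pf_enc (pf_pair pfc (pf_pair pfn pfb)). Qed.

End Records.

(* Redefined below, as [pf] lemmas for further functions become available. *)
Ltac pf_hook := fail.

Ltac pf_step :=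
  cbv beta;
  first
  [ assumption
  | lazymatch goal with
    | |- pf (fun e => @?g e) => fail
    | |- @pf ?A ?B ?rA ?rB ?f => change (@pf A B rA rB (fun e => f e)); cbv beta
    end
  | match goal with H : pf ?h |- pf (fun e => ?h (@?f e)) =>
      apply: (pf_comp H (f := f)) end
  | exact: pf_const
  | pf_hook
  | lazymatch goal with
    | |- pf_equality _ => first [exact: pf_equality_nat | exact: pf_equality_bool]
    | |- pf (fun e => e) => exact: pf_id
    | |- pf (fun e => id e) => exact: pf_id
    | |- pf (fun e => fst (@?f e)) => apply: pf_fst
    | |- pf (fun e => snd (@?f e)) => apply: pf_snd
    | |- pf (fun e => (@?f e, @?g e)) => apply: pf_pair
    | |- pf (fun e => andb (@?f e) (@?g e)) => apply: pf_and
    | |- pf (fun e => orb (@?f e) (@?g e)) => apply: pf_or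
    | |- pf (fun e => negb (@?f e)) => apply: pf_neg
    | |- pf (fun e => block (@?f e)) => apply: pf_block
    | |- pf (fun e => face_down (@?f e)) => apply: pf_face_down
    | |- pf (fun e => Build (@?f e) (@?g e)) => apply: pf_Build
    | |- pf (fun e => suit_stacks (@?f e)) => apply: pf_suit_stacks
    | |- pf (fun e => build_stacks (@?f e)) => apply: pf_build_stacks
    | |- pf (fun e => Config (@?f e) (@?g e)) => apply: pf_Config
    | |- pf (fun e => colors (@?f e)) => apply: pf_colors
    | |- pf (fun e => max_rank (@?f e)) => apply: pf_max_rank
    | |- pf (fun e => initial_builds (@?f e)) => apply: pf_initial_builds
    | |- pf (fun e => Instance (@?f e) (@?g e) (@?h e)) => apply: pf_Instance
    | |- pf (fun e => S (@?f e)) => apply: pf_succ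
    | |- pf (fun e => predn (@?f e)) => apply: pf_pred
    | |- pf (fun e => addn (@?f e) (@?g e)) => apply: pf_add
    | |- pf (fun e => subn (@?f e) (@?g e)) => apply: pf_sub
    | |- pf (fun e => muln (@?f e) (@?g e)) => apply: pf_mul
    | |- pf (fun e => expn (@?f e) _) => apply: pf_exp
    | |- pf (fun e => leq (@?f e) (@?g e)) => apply: pf_leq
    | |- pf (fun e => odd (@?f e)) => apply: pf_odd
    | |- pf (fun e => half (@?f e)) => apply: pf_half
    | |- pf (fun e => @eq_op _ (@?f e) (@?g e)) => apply: pf_eq
    | |- pf (fun e => iota (@?f e) (@?g e)) => apply: pf_iota
    | |- pf (fun e => size (@?f e)) => apply: pf_size_seq
    | |- pf (fun e => rev (@?f e)) => apply: pf_rev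
    | |- pf (fun e => nilp (@?f e)) => apply: pf_nilp
    | |- pf (fun e => behead (@?f e)) => apply: pf_behead
    | |- pf (fun e => head _ (@?f e)) => apply: pf_head
    | |- pf (fun e => nth _ (@?f e) (@?g e)) => apply: pf_nth
    | |- pf (fun e => take (@?f e) (@?g e)) => apply: pf_take
    | |- pf (fun e => drop (@?f e) (@?g e)) => apply: pf_drop
    | |- pf (fun e => cat (@?f e) (@?g e)) => apply: pf_cat
    | |- pf (fun e => cons (@?f e) (@?g e)) => apply: pf_cons
    | |- pf (fun e => flatten (map (@?f e) (@?l e))) => apply: (pf_flatmap (f := f))
    | |- pf (fun e => flatten (@?l e)) => apply: pf_flatten
    | |- pf (fun e => map (@?f e) (@?l e)) => apply: (pf_map (f := f))
    | |- pf (fun e => filter (@?f e) (@?l e)) => apply: (pf_filter (p := f))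
    | |- pf (fun e => all (@?f e) (@?l e)) => apply: (pf_all (p := f))
    | |- pf (fun e => has (@?f e) (@?l e)) => apply: (pf_has (p := f))
    | |- pf _ => apply: pf_if
    end ].

Ltac pf_solve := repeat pf_step.

Lemma pf_equality_card : pf_equality card.
Proof. exact: pf_equality_prod pf_equality_nat pf_equality_nat. Qed.

Lemma pf_equality_stack : pf_equality stack.
Proof. exact: pf_equality_seq (0, 0) pf_equality_card. Qed.

Lemma pf_equality_build : pf_equality build_stack.
Proof.
apply: (pf_ext (f := fun p => (block p.1 == block p.2) && (face_down p.1 == face_down p.2))).
  by case=> [[p d] [q e]]; rewrite -[RHS](inj_eq (can_inj build_pairK)).
by apply: pf_and; apply: pf_eq; [exact: pf_equality_stack|pf_solve|pf_solve
  |exact: pf_equality_stack|pf_solve|pf_solve].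
Qed.

Lemma pf_equality_config : pf_equality config.
Proof.
apply: (pf_ext (f := fun p => (suit_stacks p.1 == suit_stacks p.2)
                              && (build_stacks p.1 == build_stacks p.2))).
  by case=> [[p d] [q e]]; rewrite -[RHS](inj_eq (can_inj config_pairK)).
apply: pf_and; apply: pf_eq; first exact: pf_equality_seq [::] pf_equality_stack.
- by pf_solve.
- by pf_solve.
- exact: pf_equality_seq empty_build pf_equality_build.
- by pf_solve.
- by pf_solve.
Qed.

(** * Moves as a polynomial-time list of successors *)

Definition put_nth (T : Type) (s : seq T) i y := take i s ++ y :: drop i.+1 s.

Lemma put_nthE (T : Type) (x0 : T) s i y : i < size s -> set_nth x0 s i y = put_nth s i y.
Proof. by move=> lt; rewrite set_nthE lt. Qed.

Lemma size_put_nth (T : Type) (s : seq T) i y : i < size s -> size (put_nth s i y) = size s.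
Proof. by move=> lt; rewrite /put_nth size_cat /= size_takel ?size_drop; lia. Qed.

Definition turn_successors (g : config) (i : nat) : seq config :=
  let b := nth empty_build (build_stacks g) i in
  if nilp (block b) && ~~ nilp (face_down b) then
    [:: Config (suit_stacks g) (put_nth (build_stacks g) i
          (Build [:: head (0, 0) (face_down b)] (behead (face_down b))))]
  else [::].

Definition block_successors (I : instance) (g : config) (i j : nat) : seq config :=
  let a := nth empty_build (build_stacks g) i in
  let b := nth empty_build (build_stacks g) j in
  if [&& ~~ (i == j), ~~ nilp (block a) & block_accepts I (block b) (head (0, 0) (rev (block a)))]
  then [:: Config (suit_stacks g)
             (put_nth (put_nth (build_stacks g) i (Build [::] (face_down a)))
                      j (Build (block a ++ block b) (face_down b)))]
  else [::].

Definition suit_successors (g : config) (i k : nat) : seq config :=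
  let b := nth empty_build (build_stacks g) i in
  let s := nth [::] (suit_stacks g) k in
  let c := head (0, 0) (block b) in
  if ~~ nilp (block b) && suit_accepts s c
  then [:: Config (put_nth (suit_stacks g) k (c :: s))
                  (put_nth (build_stacks g) i (Build (behead (block b)) (face_down b)))]
  else [::].

Definition successors (I : instance) (g : config) : seq config :=
  let bs := iota 0 (size (build_stacks g)) in
  flatten [seq turn_successors g i ++
               flatten [seq block_successors I g i j | j <- bs] ++
               flatten [seq suit_successors g i k | k <- iota 0 (size (suit_stacks g))]
          | i <- bs].

Lemma nth_build_lt (bs : seq build_stack) i :
  nth empty_build bs i <> empty_build -> i < size bs.
Proof. by case: ltnP => // le; rewrite nth_default. Qed.

(** Beyond the list of build stacks [nth] returns the empty one, which can be neither the source nor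
    the target of a move. Hence trying the indices of existing stacks finds all moves, and [set_nth]
    never lengthens the list. *)
Lemma move_successors I g g' : move I g g' <-> g' \in successors I g.
Proof.
split=> [|/flatten_mapP[i]].
- case=> [ss bs i c d Ei|ss bs i j p b d q e ij Ei Ej acc|ss bs i k c p d Ei k_lt acc].
  + have i_lt : i < size bs by apply: nth_build_lt; rewrite Ei.
    apply/flatten_mapP; exists i; first by rewrite mem_iota.
    by rewrite mem_cat /turn_successors /= Ei /= inE put_nthE // eqxx.
  + have i_lt : i < size bs by apply: nth_build_lt; rewrite Ei; case: (p).
    have j_lt : j < size bs by apply: nth_build_lt; rewrite Ej => -[E]; rewrite E in acc.
    apply/flatten_mapP; exists i; first by rewrite mem_iota.
    rewrite !mem_cat; apply/orP; right; apply/orP; left.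
    apply/flatten_mapP; exists j; first by rewrite mem_iota.
    rewrite /block_successors /= Ei Ej /= rev_rcons /= (negbTE ij) acc.
    rewrite (_ : nilp _ = false) /=; last by case: (p).
    by rewrite inE (put_nthE _ _ i_lt) put_nthE ?size_put_nth ?eqxx.
  + have i_lt : i < size bs by apply: nth_build_lt; rewrite Ei.
    apply/flatten_mapP; exists i; first by rewrite mem_iota.
    rewrite !mem_cat; apply/orP; right; apply/orP; right.
    apply/flatten_mapP; exists k; first by rewrite mem_iota.
    by rewrite /suit_successors /= Ei /= acc inE !put_nthE ?eqxx.
- rewrite mem_iota /= add0n => i_lt; case: g i_lt => ss bs /= i_lt; rewrite !mem_cat => /or3P[].
  + rewrite /turn_successors /=; case Ei: (nth _ bs i) => [[|x p] [|c d]] //=.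
    by rewrite inE => /eqP->; rewrite -(put_nthE empty_build) //; apply: TurnUp Ei.
  + case/flatten_mapP=> j; rewrite mem_iota /= add0n => j_lt.
    rewrite /block_successors /=; case Ei: (nth _ bs i) => [p d] /=.
    case Ej: (nth _ bs j) => [q e] /=; case/lastP: p Ei => [|p b] Ei; first by rewrite andbF.
    rewrite rev_rcons /=; case: ifP => // /and3P[ij _ acc]; rewrite inE => /eqP->.
    rewrite -(put_nthE empty_build _ (i := j)) ?size_put_nth // -(put_nthE empty_build) //.
    exact: MoveBlock Ei Ej acc.
  + case/flatten_mapP=> k; rewrite mem_iota /= add0n => k_lt.
    rewrite /suit_successors /=; case Ei: (nth _ bs i) => [[|c p] d] //=.
    case: ifP => // acc; rewrite inE => /eqP->.
    by rewrite -(put_nthE [::]) // -(put_nthE empty_build) //; apply: MoveToSuit Ei _ acc.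
Qed.

Section PolyGame.
Context {E : Type} {rE : rep E}.

Lemma pf_put_nth (T : Type) {rT : rep T} (s : E -> seq T) (i : E -> nat) (y : E -> T) :
  pf s -> pf i -> pf y -> pf (fun e => put_nth (s e) (i e) (y e)).
Proof. by move=> pfs pfi pfy; rewrite /put_nth; pf_solve. Qed.

Lemma pf_color (I : E -> instance) (c : E -> card) :
  pf I -> pf c -> pf (fun e => color (I e) (c e)).
Proof. by move=> pfI pfc; rewrite /color /suit; pf_solve. Qed.

Lemma pf_suit_accepts (s : E -> stack) (c : E -> card) :
  pf s -> pf c -> pf (fun e => suit_accepts (s e) (c e)).
Proof.
move=> pfs pfc.
apply: (pf_ext (f := fun e => if nilp (s e) then (c e).2 == 1 else
   ((c e).1 == (head (0, 0) (s e)).1) && ((c e).2 == (head (0, 0) (s e)).2.+1))).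
  by move=> e; case: (s e).
by pf_solve.
Qed.

Lemma pf_block_accepts (I : E -> instance) (q : E -> stack) (c : E -> card) :
  pf I -> pf q -> pf c -> pf (fun e => block_accepts (I e) (q e) (c e)).
Proof.
move=> pfI pfq pfc; pose t e := head (0, 0) (q e).
apply: (pf_ext (f := fun e => if nilp (q e) then false
   else ~~ (color (I e) (c e) == color (I e) (t e)) && ((c e).2.+1 == (t e).2))).
  by move=> e; rewrite /t; case: (q e).
have pft : pf t by rewrite /t; pf_solve.
have ? := pf_color pfI pfc; have ? := pf_color pfI pft.
by pf_solve.
Qed.

End PolyGame.

Ltac pf_hook ::=
  lazymatch goal with
  | |- pf (fun e => put_nth (@?s e) (@?i e) (@?y e)) => apply: pf_put_nth
  | |- pf (fun e => suit_accepts (@?s e) (@?c e)) => apply: pf_suit_accepts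
  | |- pf (fun e => block_accepts (@?I e) (@?q e) (@?c e)) => apply: pf_block_accepts
  end.

Lemma pf_successors (E : Type) {rE : rep E} (I : E -> instance) (g : E -> config) :
  pf I -> pf g -> pf (fun e => successors (I e) (g e)).
Proof.
move=> pfI pfg; rewrite /successors /turn_successors /block_successors /suit_successors /=.
by pf_solve.
Qed.

(** * Decoding of inputs and certificates *)

(** The preorder code is read from right to left with a stack of finished trees: when the bit [true]
    of a node is met, its two children are the topmost trees, the left one on top. This makes
    parsing a plain fold. *)
Definition parse_step (st : seq tree) (b : bool) : seq tree :=
  if b then Node (head Leaf st) (head Leaf (behead st)) :: behead (behead st)
  else Leaf :: st.

Definition parse (w : seq bool) : tree := head Leaf (foldl parse_step [::] (rev w)).

Lemma parse_code t : parse (code t) = t.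
Proof.
have H st w : foldl parse_step st (rev (code t ++ w)) = t :: foldl parse_step st (rev w).
  elim: t w => [|a IHa b IHb] w; rewrite /= ?rev_cons -?cats1 foldl_cat //=.
  by rewrite -catA IHa IHb.
by have := H [::] [::]; rewrite cats0 /parse => ->.
Qed.

Lemma pf_parse (E : Type) {rE : rep E} (w : E -> seq bool) : pf w -> pf (fun e => parse (w e)).
Proof.
move=> pfw; apply: pf_head.
apply: (pf_foldl_add (h := fun _ => parse_step) (d := 2)); [by pf_solve|by pf_solve| |].
  rewrite /parse_step; apply: pf_if; [by pf_solve| |by pf_solve].
  apply: pf_cons; last by pf_solve.
  by apply: pf_node; pf_solve.
move=> e s b; have : 8 <= (sz e + sz b).+2 ^ 2.
  by have := sz_gt0 (rA := rE) e; have := sz_gt0 (rA := rep_bool) b; rewrite expnS expn1; nia.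
move: (_ ^ 2) => k k8; apply: (@leq_trans (sz s + 8)); last by rewrite leq_add2l.
case: b {k k8}; rewrite /parse_step; last by rewrite sz_cons (_ : sz Leaf = 1) //; lia.
have szN a c : sz (Node a c) = (sz a + sz c).+1 by rewrite sz_node.
have sz0 : sz (Nil tree) = 1 by [].
have szL : sz Leaf = 1 by [].
case: s => [|x [|y s]]; simpl; rewrite !sz_cons szN ?sz0 ?szL; lia.
Qed.

(** Every tree is the code of the list of subtrees hanging off its right spine, so this conversion
    is the identity on codes. *)
Definition tree_seq : tree -> seq tree :=
  fix loop t := if t is Node a b then a :: loop b else [::].

Lemma enc_tree_seq t : enc (tree_seq t) = t.
Proof. by elim: t => //= a _ b IHb; rewrite IHb. Qed.

Lemma pf_tree_seq (E : Type) {rE : rep E} (t : E -> tree) :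
  pf t -> pf (fun e => tree_seq (t e)).
Proof. by apply: pf_enc => e; rewrite enc_tree_seq. Qed.

(** This decoder and the following ones are total and left inverse to [enc]. A malformed certificate
    also decodes to something, which the verifier then checks like any other claim. *)
Definition dec_nat (t : tree) : nat := size (tree_seq t).
Definition dec_bool (t : tree) : bool := ~~ nilp (tree_seq t).
Definition dec_seq (A : Type) (d : tree -> A) (t : tree) : seq A :=
  [seq d x | x <- tree_seq t].
Definition dec_card (t : tree) : card := (dec_nat (left_child t), dec_nat (right_child t)).
Definition dec_stack : tree -> stack := dec_seq dec_card.
Definition dec_build (t : tree) : build_stack :=
  Build (dec_stack (left_child t)) (dec_stack (right_child t)).
Definition dec_config (t : tree) : config :=
  Config (dec_seq dec_stack (left_child t)) (dec_seq dec_build (right_child t)).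
Definition dec_instance (t : tree) : instance :=
  Instance (dec_seq dec_bool (left_child t)) (dec_nat (left_child (right_child t)))
           (dec_seq dec_stack (right_child (right_child t))).

Lemma dec_natK n : dec_nat (enc n) = n.
Proof. by elim: n => //= n IHn; rewrite /dec_nat /= -/(dec_nat _) IHn. Qed.

Lemma dec_boolK b : dec_bool (enc b) = b. Proof. by case: b. Qed.

Lemma dec_seqK (A : Type) {rA : rep A} (d : tree -> A) :
  (forall a, d (enc a) = a) -> forall s : seq A, dec_seq d (enc s) = s.
Proof. by move=> dK; elim=> //= a s IHs; rewrite /dec_seq /= dK -/(dec_seq _ _) IHs. Qed.

Lemma dec_cardK c : dec_card (enc c) = c.
Proof. by case: c => s r; rewrite /dec_card /= !dec_natK. Qed.

Lemma dec_stackK (s : stack) : dec_stack (enc s) = s. Proof. exact: dec_seqK dec_cardK s. Qed.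

Lemma dec_buildK b : dec_build (enc b) = b.
Proof. by case: b => p d; rewrite /dec_build /= !dec_stackK. Qed.

Lemma dec_configK g : dec_config (enc g) = g.
Proof.
by case: g => ss bs; rewrite /dec_config /= (dec_seqK dec_stackK) (dec_seqK dec_buildK).
Qed.

Lemma dec_instanceK I : dec_instance (enc I) = I.
Proof.
by case: I => c n b; rewrite /dec_instance /= (dec_seqK dec_boolK) dec_natK (dec_seqK dec_stackK).
Qed.

Lemma pf_dec_seq (E A : Type) {rE : rep E} {rA : rep A} (d : tree -> A) (t : E -> tree) :
  pf d -> pf t -> pf (fun e => dec_seq d (t e)).
Proof.
move=> pfd pft; apply: (pf_map (f := fun _ => d)); first exact: pf_tree_seq.
exact: pf_comp pfd (pf_snd pf_id).
Qed.

Lemma pf_dec_nat : pf dec_nat.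
Proof. exact: pf_size_seq (pf_tree_seq pf_id). Qed.

Lemma pf_dec_stack : pf dec_stack.
Proof.
apply: pf_dec_seq pf_id; apply: pf_pair.
  exact: pf_comp pf_dec_nat pf_left_child.
exact: pf_comp pf_dec_nat pf_right_child.
Qed.

Lemma pf_dec_config : pf dec_config.
Proof.
apply: pf_Config; apply: pf_dec_seq;
  [exact: pf_dec_stack|exact: pf_left_child| |exact: pf_right_child].
apply: pf_Build; first exact: pf_comp pf_dec_stack pf_left_child.
exact: pf_comp pf_dec_stack pf_right_child.
Qed.

Lemma pf_dec_instance : pf dec_instance.
Proof.
apply: pf_Instance.
- apply: pf_dec_seq pf_left_child; exact: pf_neg (pf_nilp (pf_tree_seq pf_id)).
- exact: pf_comp pf_dec_nat (pf_comp pf_left_child pf_right_child).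
- exact: pf_dec_seq pf_dec_stack (pf_comp pf_right_child pf_right_child).
Qed.

(* Moves one item of the self-delimited first component to the accumulator. *)
Definition unpair_step (p : seq bool * seq bool) : seq bool * seq bool :=
  if head false p.2 then (head false (behead p.2) :: p.1, behead (behead p.2)) else p.

(** A round consumes two bits until the end mark is reached and does nothing from then on, so
    [size z] rounds suffice. *)
Definition unpair (z : seq bool) : seq bool * seq bool :=
  let p := iter (size z) unpair_step ([::], z) in (rev p.1, behead p.2).

Lemma unpair_encode (x y : bits) : unpair (encode_pair x y) = (x, y).
Proof.
have stop n u : iter n unpair_step (u, false :: y) = (u, false :: y) by elim: n => //= n ->.
have H u n : size x <= n ->
    iter n unpair_step (u, encode_pair x y) = (catrev x u, false :: y).
  elim: x u n => [|b x IH] u n xn; first exact: stop.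
  by case: n xn => // n xn; rewrite iterSr; apply: IH.
rewrite /unpair H; first by rewrite /= /rev catrev_catrev_nil cats0.
by rewrite size_cat size_encode_seq; elim: (x) => //= b u; lia.
Qed.

Lemma pf_unpair : pf unpair.
Proof.
have H : pf (fun z => iter (size z) unpair_step ([::], z)).
  apply: (pf_iter (h := fun=> unpair_step) (d := 2)); [by pf_solve|by pf_solve| |].
    by rewrite /unpair_step; pf_solve.
  move=> z [u [|[] [|b v]]] //=; rewrite /unpair_step ?leq_addr //= !sz_pair !sz_cons.
    by rewrite (_ : sz [::] = 1) // (_ : sz false = 1) // (_ : sz true = 3) //; lia.
  by rewrite (_ : sz true = 3) //; lia.
exact: pf_pair (pf_rev (pf_fst H)) (pf_behead (pf_snd H)).
Qed.

Lemma encode_seqE (T : Type) (e : T -> bits) (s : seq T) :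
  encode_seq e s = flatten [seq true :: e x | x <- s] ++ [:: false].
Proof. by elim: s => //= x s ->; rewrite -catA. Qed.

Lemma pf_encode_seq (E T : Type) {rE : rep E} {rT : rep T} (e : T -> seq bool) (s : E -> seq T) :
  pf e -> pf s -> pf (fun a => encode_seq e (s a)).
Proof.
move=> pfe pfs; apply: (pf_ext (f := fun a => flatten [seq true :: e x | x <- s a] ++ [:: false])).
  by move=> a; rewrite encode_seqE.
by pf_solve.
Qed.

Lemma pf_encode_nat (E : Type) {rE : rep E} (n : E -> nat) :
  pf n -> pf (fun e => encode_nat (n e)).
Proof.
move=> pfn; apply: (pf_encode_seq (e := fun _ : unit => [::])); first exact: pf_const.
exact: pf_nseq_tt.
Qed.

Lemma pf_encode (E : Type) {rE : rep E} (I : E -> instance) : pf I -> pf (fun e => encode (I e)).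
Proof.
move=> pfI; apply: pf_cat.
  by apply: (pf_encode_seq (e := fun b => [:: b])); pf_solve.
apply: pf_cat; first by apply: pf_encode_nat; pf_solve.
apply: (pf_encode_seq (e := encode_seq encode_card)); last by pf_solve.
apply: (pf_encode_seq (e := encode_card)); last exact: pf_id.
by rewrite /encode_card /suit /rank; apply: pf_cat; apply: pf_encode_nat; pf_solve.
Qed.

Lemma pf_deck (E : Type) {rE : rep E} (I : E -> instance) : pf I -> pf (fun e => deck (I e)).
Proof. by move=> pfI; rewrite /deck /num_suits; pf_solve. Qed.

Lemma pf_valid (E : Type) {rE : rep E} (I : E -> instance) : pf I -> pf (fun e => valid (I e)).
Proof.
move=> pfI; rewrite /valid /num_suits; do 3![apply: pf_and; first by pf_solve].
by apply: pf_perm_eq; [exact: pf_equality_card|pf_solve|apply: pf_deck].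
Qed.

Definition wonb (I : instance) (g : config) : bool :=
  all (fun c => c \in flatten (suit_stacks g)) (deck I).

Lemma wonP I g : reflect (won I g) (wonb I g).
Proof. exact: allP. Qed.

Definition winning_play (I : instance) (gs : seq config) : bool :=
  path (fun g g' => g' \in successors I g) (initial_config I) gs &&
  wonb I (last (initial_config I) gs).

Lemma pf_winning_play : pf (fun p : instance * seq config => winning_play p.1 p.2).
Proof.
pose g0 (I : instance) := Config [seq [::] | _ <- colors I] [seq Build [::] s | s <- initial_builds I].
pose c0 := Config [::] [::].
(* The path condition becomes a test of every index: item [i] of the play is compared with item [i]
   of the list that starts with the initial configuration. *)
apply: (pf_ext (f := fun p : instance * seq config =>
  all (fun i => nth c0 p.2 i \in successors p.1 (nth c0 (g0 p.1 :: p.2) i)) (iota 0 (size p.2)) &&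
  all (fun c => c \in flatten (suit_stacks (nth c0 (g0 p.1 :: p.2) (size p.2)))) (deck p.1))).
  move=> [I gs] /=; have -> : g0 I = initial_config I.
    by rewrite /initial_config /g0 /num_suits; congr Config; elim: (colors I) => //= b c ->.
  rewrite -last_nth /winning_play; congr (_ && _).
  apply/allP/(pathP c0) => H i; first by move=> i_lt; apply: H; rewrite mem_iota.
  by rewrite mem_iota => ?; apply: H.
have pfg0 : pf g0 by rewrite /g0; pf_solve.
apply: pf_and; last first.
  apply: (pf_all (p := fun q c => c \in flatten (suit_stacks (nth c0 (g0 q.1 :: q.2) (size q.2))))).
    by apply: pf_deck; pf_solve.
  by apply: pf_mem; [exact: pf_equality_card|pf_solve|pf_solve].
apply: (pf_all (p := fun q i => nth c0 q.2 i \in successors q.1 (nth c0 (g0 q.1 :: q.2) i))).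
  by pf_solve.
by apply: pf_mem; [exact: pf_equality_config|pf_solve|apply: pf_successors; pf_solve].
Qed.

Lemma winnableP I : winnable I <-> exists gs, winning_play I gs.
Proof.
rewrite /winning_play; split=> [[g + /wonP]|[gs /andP[+ /wonP g_won]]].
  elim=> [g0 g0_won|g0 g1 g2 /move_successors g01 _ IH /IH[gs /andP[gsP gsw]]].
    by exists [::].
  by exists (g1 :: gs); rewrite /= g01 gsP.
move=> gsP; exists (last (initial_config I) gs) => //; move: gsP => {g_won}.
elim: gs (initial_config I) => [|g1 gs IH] g0 /=; first by move=> _; apply: rt1n_refl.
by case/andP=> /move_successors g01 /IH; apply: rt1n_trans.
Qed.

(** * Length of a play and size of its configurations *)

Lemma sumn_put_nth (T : Type) (F : T -> nat) (x0 : T) s i y : i < size s ->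
  sumn (map F (set_nth x0 s i y)) + F (nth x0 s i) = sumn (map F s) + F y.
Proof.
elim: s i => [|x s IH] [|i] //= i_lt; first by lia.
by have := IH i i_lt; lia.
Qed.

Lemma sz_seqE (A : Type) {rA : rep A} (s : seq A) :
  sz s = (sumn [seq (sz a).+1 | a <- s]).+1.
Proof. by elim: s => //= a s IH; rewrite sz_cons IH; lia. Qed.

Lemma sz_set_nth (A : Type) {rA : rep A} (x0 : A) s i y : i < size s ->
  sz (set_nth x0 s i y) + sz (nth x0 s i) = sz s + sz y.
Proof.
move=> i_lt; rewrite !sz_seqE.
by have /= := sumn_put_nth (fun a => (@sz A rA a).+1) x0 y i_lt; lia.
Qed.

Lemma sz_build (p d : stack) : sz (Build p d) = (sz p + sz d).+1.
Proof. by rewrite /sz /= size_cat. Qed.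

Lemma sz_config ss bs : sz (Config ss bs) = (sz ss + sz bs).+1.
Proof. by rewrite /sz /= size_cat. Qed.

(** A move only carries cards from one list to another, and a card contributes the same number of
    bits to the code of whichever list contains it. *)
Lemma move_sz I g g' : move I g g' -> sz g' = sz g.
Proof.
case=> [ss bs i c d Ei|ss bs i j p b d q e ij Ei Ej acc|ss bs i k c p d Ei k_lt acc];
  rewrite !sz_config.
- have i_lt : i < size bs by apply: nth_build_lt; rewrite Ei.
  have := sz_set_nth (rA := rep_build) empty_build (Build [:: c] d) i_lt.
  by rewrite Ei !sz_build !sz_cons; unfold stack, card in *; lia.
- have i_lt : i < size bs by apply: nth_build_lt; rewrite Ei; case: (p).
  have j_lt : j < size bs by apply: nth_build_lt; rewrite Ej => -[E]; rewrite E in acc.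
  have := sz_set_nth (rA := rep_build) empty_build (Build [::] d) i_lt.
  have j_lt' : j < size (set_nth empty_build bs i (Build [::] d)).
    by rewrite size_set_nth (maxn_idPr _).
  have := sz_set_nth (rA := rep_build) empty_build (Build (rcons p b ++ q) e) j_lt'.
  rewrite nth_set_nth /= eq_sym (negbTE ij) Ei Ej !sz_build.
  have := sz_cat (rA := rep_prod rep_nat rep_nat) (rcons p b) q; unfold stack, card in *.
  by rewrite (_ : sz [::] = 1) //; lia.
- have i_lt : i < size bs by apply: nth_build_lt; rewrite Ei.
  have := sz_set_nth (rA := rep_build) empty_build (Build p d) i_lt.
  have := sz_set_nth (rA := rep_seq (rep_prod rep_nat rep_nat)) [::] (c :: nth [::] ss k) k_lt.
  by rewrite Ei !sz_build !sz_cons; unfold stack, card in *; lia.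
Qed.

(** The weights make every move pay. Turning a card up replaces 3 by 2, one for the card and one for
    the new block; a merge leaves one nonempty block less; a card played to a suit stack no longer
    counts. *)
Definition potential (b : build_stack) : nat :=
  3 * size (face_down b) + size (block b) + ~~ nilp (block b).

Definition total_potential (g : config) : nat := sumn [seq potential b | b <- build_stacks g].

Lemma move_potential I g g' : move I g g' -> total_potential g' < total_potential g.
Proof.
rewrite /total_potential.
case=> [ss bs i c d Ei|ss bs i j p b d q e ij Ei Ej acc|ss bs i k c p d Ei k_lt acc] /=.
- have i_lt : i < size bs by apply: nth_build_lt; rewrite Ei.
  have := sumn_put_nth potential empty_build (Build [:: c] d) i_lt.
  by rewrite Ei /potential /=; lia.
- have i_lt : i < size bs by apply: nth_build_lt; rewrite Ei; case: (p).
  have j_lt : j < size bs by apply: nth_build_lt; rewrite Ej => -[E]; rewrite E in acc.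
  have := sumn_put_nth potential empty_build (Build [::] d) i_lt.
  have j_lt' : j < size (set_nth empty_build bs i (Build [::] d)).
    by rewrite size_set_nth (maxn_idPr _).
  have := sumn_put_nth potential empty_build (Build (rcons p b ++ q) e) j_lt'.
  rewrite nth_set_nth /= eq_sym (negbTE ij) Ei Ej /potential /= size_cat size_rcons.
  by case: q acc {Ej} => //= t q _; rewrite /nilp size_cat !size_rcons /=; lia.
- have i_lt : i < size bs by apply: nth_build_lt; rewrite Ei.
  have := sumn_put_nth potential empty_build (Build p d) i_lt.
  by rewrite Ei /potential /=; case: p {Ei} => //= *; lia.
Qed.

Lemma play_bounds I g gs : path (fun g g' => g' \in successors I g) g gs ->
  size gs <= total_potential g /\ sz gs <= size gs * (sz g).+1 + 1.
Proof.
elim: gs g => [|g' gs IH] g /=; first by [].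
case/andP=> /move_successors gg' /IH[].
have := move_potential gg'; have := move_sz gg'; rewrite sz_cons => -> ? ? ?; nia.
Qed.

Lemma sz_encode_seq (T : Type) {rT : rep T} (e : T -> bits) k (s : seq T) :
  1 <= k -> (forall x, sz x < k * (size (e x)).+1) -> sz s <= k * size (encode_seq e s).
Proof.
move=> k1 H; rewrite sz_seqE size_encode_seq; elim: s => [|x s IH] /=; first by lia.
by have := H x; nia.
Qed.

Lemma sz_encode_nat n : sz n <= 2 * size (encode_nat n).
Proof. by rewrite sz_nat size_encode_nat; lia. Qed.

Lemma sz_encode I : sz I <= 3 * size (encode I) + 2.
Proof.
have -> : sz I = (sz (colors I) + (sz (max_rank I) + sz (initial_builds I)).+1).+1.
  by rewrite /sz /= !size_cat /= !size_cat.
rewrite /encode !size_cat.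
have := @sz_encode_seq bool rep_bool (fun b => [:: b]) 3 (colors I) isT.
have := sz_encode_nat (max_rank I).
have H : forall s, sz s <= 3 * size (encode_seq encode_card s).
  move=> s; apply: sz_encode_seq => // -[a r]; rewrite sz_pair size_cat !size_encode_nat !sz_nat /=.
  by lia.
have := @sz_encode_seq stack (rep_seq (rep_prod rep_nat rep_nat)) (encode_seq encode_card) 3 (initial_builds I) isT.
move=> H1 H2 H3.
have {}H1 : sz (initial_builds I) <= 3 * size (encode_seq (encode_seq encode_card) (initial_builds I)).
  by apply: H1 => s; have := H s; unfold stack, card in *; lia.
have {}H3 : sz (colors I) <= 3 * size (encode_seq (fun b => [:: b]) (colors I)).
  by apply: H3; case.
by lia.
Qed.

(** The certificate repeats the instance as a tree. Encoding that copy again and comparing the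
    result with the input takes the place of parsing the input. *)
Definition verifier (z : seq bool) : bool :=
  let p := unpair z in let t := parse p.2 in
  let I := dec_instance (left_child t) in
  [&& encode I == p.1, valid I & winning_play I (dec_seq dec_config (right_child t))].

Lemma pf_verifier : pf verifier.
Proof.
have pft : pf (fun z => parse (unpair z).2) by apply: pf_parse; apply: pf_snd; apply: pf_unpair.
have pfI : pf (fun z => dec_instance (left_child (parse (unpair z).2))).
  exact: pf_comp pf_dec_instance (pf_comp pf_left_child pft).
have pfg : pf (fun z => dec_seq dec_config (right_child (parse (unpair z).2))).
  exact: pf_dec_seq pf_dec_config (pf_comp pf_right_child pft).
apply: pf_and.
  apply: pf_eq; [exact: pf_equality_seq false pf_equality_bool|exact: pf_encode|].
  exact: pf_fst pf_unpair.
apply: pf_and; first exact: pf_valid.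
exact: (pf_comp pf_winning_play (pf_pair pfI pfg)).
Qed.

Lemma klondike_certificate (w y : bits) :
  verifier (encode_pair w y) -> klondike w.
Proof.
rewrite /verifier unpair_encode /= => /and3P[/eqP Ew Iv Iw].
by exists (dec_instance (left_child (parse y))); split=> //; apply/winnableP; eexists; exact: Iw.
Qed.

Lemma verifier_certificate I gs : valid I -> winning_play I gs ->
  verifier (encode_pair (encode I) (code (enc (I, gs)))).
Proof.
move=> Iv Iw; rewrite /verifier unpair_encode parse_code /=.
by rewrite dec_instanceK (dec_seqK dec_configK) eqxx Iv.
Qed.

(** A play has at most [3 * sz I] moves and configurations of size at most [5 * sz I], and [sz I] is
    linear in [size (encode I)]. The constant 1000 generously absorbs the resulting coefficients. *)
Lemma size_certificate I gs : path (fun g g' => g' \in successors I g) (initial_config I) gs ->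
  size (code (enc (I, gs))) <= 1000 * size (encode I) ^ 2 + 1000.
Proof.
move=> gsP; have [le1 le2] := play_bounds gsP; rewrite -/(sz (I, gs)) sz_pair.
have szI := sz_encode I.
have sz_I : sz I = (sz (colors I) + (sz (max_rank I) + sz (initial_builds I)).+1).+1.
  by rewrite /sz /= !size_cat /= !size_cat.
have sz_g0 : sz (initial_config I) <= 5 * sz I.
  rewrite /initial_config sz_config.
  have : sz (nseq (num_suits I) [::] : seq stack) <= 2 * sz (colors I) + 1.
    rewrite /num_suits; elim: (colors I) => //= b c IH; rewrite !sz_cons.
    by rewrite (_ : @sz stack _ [::] = 1) //; have := sz_gt0 (rA := rep_bool) b; lia.
  have : sz [seq Build [::] s | s <- initial_builds I] <= 3 * sz (initial_builds I).
    elim: (initial_builds I) => //= s b IH; rewrite !sz_cons sz_build.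
    by rewrite (_ : @sz stack _ [::] = 1) //; unfold stack, card in *; lia.
  by lia.
have pot : total_potential (initial_config I) <= 3 * sz I.
  have : total_potential (initial_config I) <= 3 * sz (initial_builds I).
    rewrite /total_potential /=; elim: (initial_builds I) => //= s b IH; rewrite sz_cons.
    rewrite {1}/potential /nilp /=; have := size_le_sz (rA := rep_prod rep_nat rep_nat) s.
    by unfold stack, card in *; lia.
  by lia.
have H : size gs * (sz (initial_config I)).+1 <= 3 * sz I * (5 * sz I).+1.
  by rewrite leq_mul // (leq_trans le1).
have cc := leq_mul szI szI; have d2 : size (encode I) <= size (encode I) * size (encode I).
  by case: (size _) => // d; rewrite leq_pmull.
move: (sz (initial_config I)) (sz gs) (sz I) (size (encode I)) (size gs) le2 H szI cc d2.
move=> a b c d e; rewrite expnS expn1; move: (e * _) => k le2 H szI cc d2.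
have {}H : k <= 15 * (c * c) + 3 * c by apply: leq_trans H _; lia.
have {}cc : c * c <= 9 * (d * d) + 12 * d + 4 by apply: leq_trans cc _; lia.
by move: (c * c) (d * d) H cc d2 => C D; lia.
Qed.

Lemma klondike_in_NP : in_NP klondike.
Proof.
exists verifier; split.
  by apply: pf_polytime; apply: pf_cons; [exact: pf_verifier|exact: pf_const].
exists 1000, 2 => x; split=> [[I [Iv -> /winnableP[gs gsP]]]|[y _]]; last exact: klondike_certificate.
exists (code (enc (I, gs))); last exact: verifier_certificate.
by apply: size_certificate; case/andP: gsP.
Qed.

(** * Invariants of the game *)

Definition cards (b : build_stack) : seq card := block b ++ face_down b.

Definition multiplicity (g : config) (c : card) : nat :=
  sumn [seq count_mem c s | s <- suit_stacks g] +
  sumn [seq count_mem c (cards b) | b <- build_stacks g].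

Definition lies_on (g : config) (c y : card) : Prop :=
  exists i p q, block (nth empty_build (build_stacks g) i) = p ++ [:: c, y & q].

Lemma uniq_nth_flatten (T : eqType) (l : seq (seq T)) i :
  uniq (flatten l) -> i < size l -> uniq (nth [::] l i).
Proof.
elim: l i => [|s l IH] [|i] //=; rewrite cat_uniq => /and3P[? _ lu] //.
exact: IH.
Qed.

Section Invariant.
Variable I : instance.
Hypothesis I_valid : valid I.
Let L := initial_builds I.

(* The bottom card of a block is the one that was turned up last in its
   stack; every other card of the block lies on a card that accepts it. *)
Definition stack_inv (l : stack) (b : build_stack) : Prop :=
  exists u, l = u ++ face_down b /\
    (block b = [::] \/ exists p u' c, [/\ block b = rcons p c, u = rcons u' c &
       sorted (fun x y => block_accepts I [:: y] x) (block b)]).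

Definition game_inv (g : config) : Prop :=
  [/\ size (build_stacks g) = size L,
      forall i, i < size L -> stack_inv (nth [::] L i) (nth empty_build (build_stacks g) i),
      forall c, multiplicity g c = (c \in deck I) &
      forall s c r, s \in suit_stacks g -> c \in s -> 0 < r <= rank c -> (suit c, r) \in s].

Lemma deck_uniq : uniq (deck I).
Proof. by rewrite /deck allpairs_uniq ?iota_uniq // => -[a b] [a' b'] _ _ /= [-> ->]. Qed.

Lemma count_initial c : sumn [seq count_mem c s | s <- L] = (c \in deck I).
Proof.
rewrite -count_flatten -(count_uniq_mem c deck_uniq).
by have /and4P[_ _ _ /permP->] := I_valid.
Qed.

Lemma game_inv_initial : game_inv (initial_config I).
Proof.
split=> /=; first by rewrite size_map.
- move=> i i_lt; rewrite (nth_map [::]) //; exists [::]; split=> //; by left.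
- move=> c; rewrite /multiplicity /= -map_comp -(count_initial c) map_nseq /=.
  rewrite (_ : sumn (nseq _ _) = 0); last by rewrite sumn_nseq.
  by congr sumn; apply: eq_map.
by move=> s c r /nseqP[-> _].
Qed.

Lemma sumn_two (T : Type) (F : T -> nat) x0 s i j : i < j < size s ->
  F (nth x0 s i) + F (nth x0 s j) <= sumn (map F s).
Proof.
elim: s i j => [|x s IH] [|i] [|j] //=; try lia.
  move=> js; rewrite leq_add2l; elim: s j js {IH} => [|y s IH] [|j] //=; try lia.
  by move=> /IH; lia.
by move=> ij; have := IH i j ij; lia.
Qed.

Lemma sumn_one (T : Type) (F : T -> nat) x0 s i : i < size s ->
  F (nth x0 s i) <= sumn (map F s).
Proof. elim: s i => [|x s IH] [|i] //=; first by lia. by move=> /IH; lia. Qed.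

Lemma suit_accepts_inv s c r : (forall d r, d \in s -> 0 < r <= rank d -> (suit d, r) \in s) ->
  suit_accepts s c -> 0 < r <= rank c -> (suit c, r) \in c :: s.
Proof.
move=> sP; case: c => a b; case: s sP => [|t s] sP /=.
  rewrite /rank /= => /eqP-> r1; by rewrite inE; apply/eqP; congr pair; lia.
rewrite /suit /rank /= => /andP[/eqP-> /eqP->] r_le; rewrite inE.
have [->|r_ne] := eqVneq r t.2.+1; first by rewrite eqxx.
apply/orP; right; apply: sP; rewrite ?mem_head // /rank.
by case/andP: r_le => -> r_le /=; rewrite -ltnS ltn_neqAle r_ne.
Qed.

(** The delicate case is a merge. The merged block inherits its bottom card from the receiving
    block, so it still ends with the card turned up last in that stack, and the only new pair of
    neighbours is the one tested by [block_accepts]. *)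
Lemma game_inv_move g g' : game_inv g -> move I g g' -> game_inv g'.
Proof.
move=> [] + + + + gg'.
case: gg' => [ss bs i c d Ei|ss bs i j p b d q e ij Ei Ej acc|ss bs i k c p d Ei k_lt acc];
  rewrite /multiplicity /= => szP stP multP suitP.
- have i_lt : i < size bs by apply: nth_build_lt; rewrite Ei.
  split=> //=.
  + by rewrite size_set_nth (maxn_idPr _).
  + move=> j j_lt; rewrite nth_set_nth /=; case: eqP => [->|_]; last exact: stP.
    have [|u [El _]] := stP i; first by rewrite -szP.
    exists (rcons u c); split; first by rewrite El Ei /= cat_rcons.
    by right; exists [::], u, c.
  + move=> x; rewrite -multP /multiplicity /=; congr addn.
    by have := sumn_put_nth (fun b => count_mem x (cards b)) empty_build (Build [:: c] d) i_lt;
      rewrite Ei /=; lia.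
- have i_lt : i < size bs by apply: nth_build_lt; rewrite Ei; case: (p).
  have j_lt : j < size bs by apply: nth_build_lt; rewrite Ej => -[E]; rewrite E in acc.
  have j_lt' : j < size (set_nth empty_build bs i (Build [::] d)).
    by rewrite size_set_nth (maxn_idPr _).
  split=> //=.
  + by rewrite size_set_nth (maxn_idPr j_lt') size_set_nth (maxn_idPr i_lt).
  + move=> k k_lt; rewrite nth_set_nth /=; case: eqP => [->|_].
      have [|u [El]] := stP j; first by rewrite -szP.
      rewrite Ej /= in El *; case=> [q0|]; first by rewrite q0 in acc.
      case=> p' [u' [c' [Eq Eu q_sorted]]]; exists u; split=> //=; right.
      exists (rcons p b ++ p'), u', c'; split=> //; first by rewrite Eq rcons_cat.
      have [|v [_]] := stP i; first by rewrite -szP.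
      rewrite Ei /= => -[|[_ [_ [_ [_ _]]]]]; first by case: (p).
      case: q acc q_sorted {Ej Eq} => // t q acc q_sorted p_sorted.
      rewrite cat_rcons -[_ ++ _]/(p ++ [:: b] ++ t :: q) catA cats1.
      have {}acc : block_accepts I [:: t] b := acc.
      case: p p_sorted {Ei} => [|x p] p_sorted; first by move: acc => /= ->.
      by rewrite /= cat_path; move: p_sorted acc => /= ->; rewrite last_rcons /= => ->.
    rewrite nth_set_nth /=; case: eqP => [->|_]; last exact: stP.
    have [|u [El _]] := stP i; first by rewrite -szP.
    by rewrite Ei /= in El; exists u; split=> //=; left.
  + move=> x; rewrite -multP /multiplicity /=; congr addn.
    have := sumn_put_nth (fun b => count_mem x (cards b)) empty_build (Build [::] d) i_lt.
    have := sumn_put_nth (fun b => count_mem x (cards b)) empty_build (Build (rcons p b ++ q) e) j_lt'.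
    rewrite nth_set_nth /= eq_sym (negbTE ij) Ei Ej /cards /= !count_cat.
    by lia.
- have i_lt : i < size bs by apply: nth_build_lt; rewrite Ei.
  split=> //=.
  + by rewrite size_set_nth (maxn_idPr _).
  + move=> j j_lt; rewrite nth_set_nth /=; case: eqP => [->|_]; last exact: stP.
    have [|u [El H]] := stP i; first by rewrite -szP.
    rewrite Ei /= in El H; exists u; split=> //=.
    case: p {Ei} H => [|x p] H; first by left.
    right; case: H => // -[p' [u' [c' [Ep Eu p_sorted]]]].
    case: p' Ep => [|y p'] //= [_ Ep]; exists p', u', c'; split=> //.
    exact: path_sorted p_sorted.
  + move=> x; rewrite -multP /multiplicity.
    have := sumn_put_nth (fun b => count_mem x (cards b)) empty_build (Build p d) i_lt.
    have := sumn_put_nth (fun s => count_mem x s) [::] (c :: nth [::] ss k) k_lt.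
    rewrite Ei /cards /=; move: (sumn _) (sumn _) (sumn _) (sumn _) => A B C D.
    by move: (nat_of_bool _) (count _ _) (count _ _) => E F G; lia.
  + move=> s x r; case/(nthP [::]) => j; rewrite size_set_nth (maxn_idPr _) // => j_lt <-.
    rewrite nth_set_nth /=; case: eqP => [_|_]; last by apply: suitP; rewrite mem_nth.
    rewrite inE => /orP[/eqP-> |xs r_le].
      by apply: suit_accepts_inv acc => y r' ys; apply: suitP; rewrite ?mem_nth.
    by rewrite inE orbC suitP // mem_nth.
Qed.

Section Facts.
Variable g : config.
Hypothesis gP : game_inv g.
Notation bs := (build_stacks g).
Notation on_suits := (flatten (suit_stacks g)).
Notation pile i := (nth empty_build bs i).

Lemma multiplicity_le1 c : multiplicity g c <= 1.
Proof. by case: gP => _ _ -> _; case: (_ \in _). Qed.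

Lemma cards_pile_lt i c : c \in cards (pile i) -> i < size bs.
Proof. by case: ltnP => // le; rewrite nth_default. Qed.

Lemma cards_pile_inj i j c : c \in cards (pile i) -> c \in cards (pile j) -> i = j.
Proof.
move=> ci cj; have i_lt := cards_pile_lt ci; have j_lt := cards_pile_lt cj.
have := multiplicity_le1 c; rewrite /multiplicity.
have H k l : k < l < size bs -> c \in cards (pile k) -> c \in cards (pile l) ->
    1 < sumn [seq count_mem c (cards b) | b <- bs].
  move=> kl; have := sumn_two (fun b => count_mem c (cards b)) empty_build kl.
  by rewrite -!has_pred1 !has_count; lia.
case: (ltngtP i j) => // ij.
  by have := H i j; rewrite ij j_lt ci cj => /(_ isT isT isT); lia.
by have := H j i; rewrite ij i_lt ci cj => /(_ isT isT isT); lia.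
Qed.

Lemma cards_pile_uniq i : uniq (cards (pile i)).
Proof.
have [i_lt|le] := ltnP i (size bs); last by rewrite nth_default.
have: forall c, count_mem c (cards (pile i)) <= 1.
  move=> c; apply: leq_trans (multiplicity_le1 c).
  exact: leq_trans (sumn_one (fun b => count_mem c (cards b)) empty_build i_lt) (leq_addl _ _).
elim: (cards _) => //= x s IH H; rewrite IH ?andbT; last by move=> c; have := H c; lia.
by rewrite -has_pred1 has_count -leqNgt; have := H x; rewrite eqxx add1n ltnS.
Qed.

Lemma suits_not_pile i c : c \in on_suits -> c \notin cards (pile i).
Proof.
move=> cs; apply/negP=> ci; have i_lt := cards_pile_lt ci.
have := multiplicity_le1 c; rewrite /multiplicity.
have := sumn_one (fun b => count_mem c (cards b)) empty_build i_lt.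
move: cs ci; rewrite -!has_pred1 !has_count count_flatten; lia.
Qed.

Lemma card_place c : c \in deck I -> c \in on_suits \/ exists i, c \in cards (pile i).
Proof.
case: gP => _ _ multP _ cI; have := multP c; rewrite cI /multiplicity => E.
have [c_on|c_off] := boolP (c \in on_suits); [by left|right].
have {}E : 0 < sumn [seq count_mem c (cards b) | b <- bs].
  have : count_mem c on_suits = 0 by apply/count_memPn.
  by rewrite count_flatten; lia.
have : has (fun b => c \in cards b) bs.
  elim: bs E => //= b s IH; case: (boolP (c \in cards b)) => //= cb.
  by rewrite (count_memPn cb).
by case/hasP=> b /(nthP empty_build)[i _ <-] ci; exists i.
Qed.

Lemma suits_lower c r : c \in on_suits -> 0 < r <= rank c -> (suit c, r) \in on_suits.
Proof.
case: gP => _ _ _ suitP /flattenP[s ss cs] r_le.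
by apply/flattenP; exists s => //; apply: suitP cs r_le.
Qed.

Lemma pile_initial i : i < size L -> uniq (nth [::] L i).
Proof.
apply: uniq_nth_flatten; have [_ _ _ /perm_uniq->] := and4P I_valid.
exact: deck_uniq.
Qed.

Lemma face_down_initial i c : c \in face_down (pile i) -> i < size L /\ c \in nth [::] L i.
Proof.
case: gP => sz stP _ _ ci.
have i_lt : i < size L by rewrite -sz; apply: (@cards_pile_lt _ c); rewrite mem_cat ci orbT.
by split=> //; have [u [-> _]] := stP i i_lt; rewrite mem_cat ci orbT.
Qed.

Lemma initial_inj i j c : i < size L -> j < size L ->
  c \in nth [::] L i -> c \in nth [::] L j -> i = j.
Proof.
move=> i_lt j_lt ci cj; have le1 : sumn [seq count_mem c s | s <- L] <= 1.
  by rewrite count_initial; case: (_ \in _).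
move: ci cj; rewrite -!has_pred1 !has_count => ci cj; case: (ltngtP i j) => // ij.
  have := leq_trans (sumn_two (count_mem c) [::] (introT andP (conj ij j_lt))) le1.
  by move: ci cj; move: (count _ _) (count _ _) => a b; lia.
have := leq_trans (sumn_two (count_mem c) [::] (introT andP (conj ij i_lt))) le1.
by move: ci cj; move: (count _ _) (count _ _) => a b; lia.
Qed.

Lemma released i c : i < size L -> c \in nth [::] L i -> c \in deck I ->
  c \notin face_down (pile i) ->
  (forall p b, block (pile i) = rcons p b -> b <> c) ->
  c \in on_suits \/ exists y, lies_on g c y.
Proof.
move=> i_lt ci cI c_up c_moved; case: (card_place cI) => [|[j cj]]; [by left|right].
have j_lt : j < size L by case: gP => <- _ _ _; apply: cards_pile_lt cj.
move: (cj); rewrite mem_cat => /orP[cb|cd]; last first.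
  have [_ cLj] := face_down_initial cd.
  by case/negP: c_up; rewrite (initial_inj i_lt j_lt ci cLj).
case: gP => _ /(_ j j_lt)[u [Lj]] + _ _.
case=> [b0|[p [u' [b [Eb Eu _]]]]]; first by rewrite b0 in cb.
have bLj : b \in nth [::] L j by rewrite Lj Eu mem_cat mem_rcons mem_head.
have [bc|bc] := eqVneq b c.
  rewrite bc in bLj Eb; have ij := initial_inj i_lt j_lt ci bLj.
  by case: (c_moved p c) => //; rewrite ij.
move: cb; rewrite Eb mem_rcons inE eq_sym (negbTE bc) /= => cp.
case/splitPr: cp Eb => p1 [|y p2] Eb.
  by exists b, j, p1, [::]; rewrite Eb rcons_cat.
by exists y, j, p1, (rcons p2 b); rewrite Eb rcons_cat.
Qed.

Lemma lies_on_accepts c y : lies_on g c y ->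
  [/\ block_accepts I [:: y] c, y \notin flatten [seq face_down b | b <- bs]
    & y \notin on_suits].
Proof.
move=> [i [p [q Ei]]].
have yi : y \in block (pile i) by rewrite Ei mem_cat !inE eqxx !orbT.
have yc : y \in cards (pile i) by rewrite mem_cat yi.
have i_lt : i < size L by case: gP => <- _ _ _; apply: cards_pile_lt yc.
split.
- case: gP => _ /(_ i i_lt)[u [_]] + _ _; rewrite Ei => -[|[p' [u' [b [_ _]]]]].
    by case: (p).
  case: (p) => [|x p0]; rewrite /= ?cat_path; first by case/andP.
  by case/and3P=> _ _ /andP[].
- apply/negP=> /flatten_mapP[b /(nthP empty_build)[j _ <-] yj].
  have yj' : y \in cards (pile j) by rewrite mem_cat yj orbT.
  have := cards_pile_uniq i; rewrite /cards cat_uniq => /and3P[_ /hasP[]].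
  by exists y => //; rewrite (cards_pile_inj yc yj').
- by apply/negP=> /(suits_not_pile i); rewrite yc.
Qed.

Lemma cards_pile_deck i c : c \in cards (pile i) -> c \in deck I.
Proof.
move=> ci; case: gP => _ _ multP _; have := multP c; rewrite /multiplicity.
have := sumn_one (fun b => count_mem c (cards b)) empty_build (cards_pile_lt ci).
move: ci; rewrite -has_pred1 has_count; case: (c \in deck I) => //.
by move: (count _ _) (sumn _) (sumn _) => x y z; lia.
Qed.

Lemma lies_on_deck c y : lies_on g c y -> y \in deck I.
Proof.
move=> [i [p [q Ei]]]; apply: (@cards_pile_deck i).
by rewrite mem_cat Ei mem_cat !inE eqxx !orbT.
Qed.

Lemma lies_on_inj c c' y : lies_on g c y -> lies_on g c' y -> c = c'.
Proof.
move=> [i [p [q Ei]]] [j [p' [q' Ej]]].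
have yi : y \in cards (pile i) by rewrite mem_cat Ei mem_cat !inE eqxx !orbT.
have yj : y \in cards (pile j) by rewrite mem_cat Ej mem_cat !inE eqxx !orbT.
have ij := cards_pile_inj yi yj; rewrite -{}ij in Ej.
have := cards_pile_uniq i; rewrite /cards cat_uniq => /and3P[+ _ _].
rewrite Ei => Eu; move: Ei; rewrite Ej => E.
have ind s x t : uniq (s ++ [:: x, y & t]) -> index y (s ++ [:: x, y & t]) = (size s).+1.
  rewrite cat_uniq /= => /and5P[_ /norP[_ /norP[ys _]] xt _ _].
  by rewrite index_cat (negbTE ys) /= eqxx; move: xt; rewrite inE => /norP[/negbTE-> _]; rewrite addn1.
have := ind p' c' q'; rewrite E ind // => /(_ Eu)[] Es.
by move/(congr1 (fun s => nth c s (size p))): E; rewrite {1}Es !nth_cat !ltnn !subnn /= => ->.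
Qed.

(** Cards are turned up from the top. If a card below [c] has been turned up, then [c] is not the
    last one turned up in its stack, hence not the bottom card of the block there, and [released]
    applies. *)
Lemma above_released i u c w d : i < size L -> nth [::] L i = u ++ c :: w -> d \in w ->
  d \notin face_down (pile i) -> c \in deck I ->
  c \in on_suits \/ exists y, lies_on g c y.
Proof.
move=> i_lt El dw d_up cI; have Lu := pile_initial i_lt.
case: gP => _ /(_ i i_lt)[v [Ev bP]] _ _.
have ds : d \in v.
  have : d \in nth [::] L i by rewrite El mem_cat inE dw !orbT.
  by rewrite Ev mem_cat (negbTE d_up) orbF.
have cs : c \in v /\ (forall v' b, v = rcons v' b -> b <> c).
  have d_ge : size u < index d (nth [::] L i).
    move: Lu; rewrite El cat_uniq /= => /and4P[_ /norP[_ dP] cw _].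
    rewrite index_cat; case: ifP => [du|_].
      by case/negP: dP; apply/hasP; exists d.
    by rewrite /=; case: eqP => [cd|_]; [rewrite cd dw in cw|rewrite addnS ltnS leq_addr].
  have d_lt : index d (nth [::] L i) < size v by rewrite Ev index_cat ds index_mem.
  have ic : index c (nth [::] L i) = size u.
    move: Lu; rewrite El cat_uniq /= => /and4P[_ /norP[cu _] _ _].
    by rewrite index_cat (negbTE cu) /= eqxx addn0.
  have cv : c \in v.
    apply: contraLR (ltn_trans d_ge d_lt) => cv.
    by rewrite -leqNgt -ic Ev index_cat (negbTE cv) leq_addr.
  split=> // v' b Evb bc.
  have cv' : c \notin v'.
    by move: Lu; rewrite Ev Evb bc cat_uniq rcons_uniq => /andP[/andP[]].
  have Ec : size u = size v'.
    by rewrite -ic Ev index_cat cv Evb bc -cats1 index_cat (negbTE cv') /= eqxx addn0.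
  by have := leq_ltn_trans d_ge d_lt; rewrite Evb size_rcons Ec ltnn.
apply: (released i_lt) => //.
- by rewrite El mem_cat mem_head orbT.
- by move: Lu; rewrite Ev cat_uniq => /and3P[_ /hasPn H _]; apply/negP=> /H /negP; case: cs.
move=> p b Ep; case: bP => [b0|[p' [v' [b' [Ep' Ev' _]]]]]; first by rewrite b0 in Ep; case: (p) Ep.
move: Ep; rewrite Ep' => /rcons_inj[_ <-]; exact: (cs.2 v').
Qed.

End Facts.
End Invariant.

(** * From satisfiability to Klondike *)

(* The literal [l] is the variable [l./2], negated when [l] is even. *)
Definition satisfies (val : nat -> bool) (Phi : seq (seq nat)) : bool :=
  all (has (fun l => val l./2 == odd l)) Phi.

(** Names for the build stacks. Positions of the game can then be described by functions on names,
    while [index] in the list [piles] gives the actual places. *)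
Inductive pile :=
  Stock | Choice of nat | Slot of nat | Occ of nat & nat | Clause of nat.

Lemma pile_eq_dec (p q : pile) : {p = q} + {p <> q}.
Proof. by decide equality; apply: eq_comparable. Defined.

HB.instance Definition _ := hasDecEq.Build pile (compareP pile_eq_dec).

Section Reduction.
Variables (v : nat) (Phi : seq (seq nat)).
Notation K := (size Phi).

(* The ranks above [K.+2] are used in triples: one rank for cards to be moved,
   one for the cards receiving them, and one left unused as a separator. *)
Definition slot_rank (x : nat) : nat := K.+3 + 3 * x.

(* Suits: 0 and 1 are red and hold the cards to be moved, [2 + l] is red and
   holds the tokens of the literal [l], [2 + 2 * v + l] is black and holds the
   receiving cards of [l]. *)
Definition choice_card (l : nat) : card := (odd l : nat, slot_rank l./2).
Definition token (l r : nat) : card := (2 + l, r).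
Definition receptor (l x : nat) : card := (2 + 2 * v + l, (slot_rank x).+1).
Definition clause_card (k : nat) : card := (0, slot_rank (v + k)).

Definition occurs (l k : nat) : bool := l \in nth [::] Phi k.

(** There is a pile [Occ l k] for every pair, whether or not [l] occurs in the clause. The tokens of
    [l] thus fill the ranks from 1 to [K.+1] without a gap and can be played in one run once the
    token of rank 1 is free. *)
Definition pile_cards (p : pile) : stack :=
  match p with
  | Stock => [:: (0, K.+1)]
  | Choice l => [:: choice_card l; token l 1]
  | Slot x => [:: receptor 0 x]
  | Occ l k => token l k.+2 :: if occurs l k then [:: receptor l (v + k)] else [::]
  | Clause k => [:: clause_card k; (0, k.+1)]
  end.

Definition proper_piles : seq pile :=
  [seq Choice l | l <- iota 0 (2 * v)] ++ [seq Slot x | x <- iota 0 v] ++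
  flatten [seq [seq Occ l k | k <- iota 0 K] | l <- iota 0 (2 * v)] ++
  [seq Clause k | k <- iota 0 K].

Definition piles : seq pile := Stock :: proper_piles.

Definition pile_colors : seq bool := nseq (2 + 2 * v) true ++ nseq (2 * v) false.
Definition top_rank : nat := slot_rank (v + K).
Definition all_cards : seq card := deck (Instance pile_colors top_rank [::]).
Definition in_play : seq card := flatten [seq pile_cards p | p <- piles].
(** These cards keep the order of the deck, in which they are played at the end. While they are
    hidden, the cards of rank [K.+2] among them block the suits 0 and 1 for choice and clause
    cards. *)
Definition rest : seq card := [seq c <- all_cards | c \notin in_play].

Definition initial_pile (p : pile) : stack :=
  pile_cards p ++ if p == Stock then rest else [::].

Definition klondike_of : instance :=
  Instance pile_colors top_rank [seq initial_pile p | p <- piles].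

Definition proper (p : pile) : bool :=
  match p with
  | Stock => true
  | Choice l => l < 2 * v
  | Slot x => x < v
  | Occ l k => (l < 2 * v) && (k < K)
  | Clause k => k < K
  end.

Lemma map_notin (T : Type) (f : T -> pile) s q :
  (forall a, f a <> q) -> (q \in [seq f a | a <- s]) = false.
Proof. by move=> H; apply/negP; elim: s => //= a s IH; rewrite inE => /orP[/eqP/esym/H|]. Qed.

Lemma occ_notin q : (forall l k, Occ l k <> q) ->
  (q \in flatten [seq [seq Occ l k | k <- iota 0 K] | l <- iota 0 (2 * v)]) = false.
Proof. by move=> H; apply/negP=> /flatten_mapP[l _]; rewrite map_notin. Qed.

Lemma mem_piles p : (p \in piles) = proper p.
Proof.
rewrite inE !mem_cat.
have inj1 : injective Choice by move=> ? ? [].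
have inj2 : injective Slot by move=> ? ? [].
have inj3 : injective Clause by move=> ? ? [].
have ne q : q <> Stock -> (q == Stock) = false by move/eqP/negbTE.
case: p => [|l|x|l k|k]; rewrite ?eqxx // ne //=.
- by rewrite mem_map // mem_iota /= !map_notin // occ_notin //= !orbF.
- by rewrite map_notin // mem_map // mem_iota /= map_notin // occ_notin //= !orbF.
- rewrite !map_notin // orbF /=; apply/flatten_mapP/andP.
    case=> l'; rewrite mem_iota => /andP[_ l_lt] /mapP[k']; rewrite mem_iota => /andP[_ k_lt].
    by case=> -> ->.
  by move=> [l_lt k_lt]; exists l; rewrite ?mem_iota //; apply/mapP; exists k; rewrite ?mem_iota.
- by rewrite map_notin // map_notin // occ_notin // mem_map // mem_iota.
Qed.

Lemma piles_uniq : uniq piles.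
Proof.
rewrite /= !mem_cat !map_notin // occ_notin //= !cat_uniq !map_inj_uniq ?iota_uniq /=;
  try by move=> ? ? [].
rewrite -/(allpairs Occ _ _) allpairs_uniq ?iota_uniq //=; last by move=> [? ?] [? ?] _ _ [-> ->].
rewrite !andbT; apply/and3P; split; apply/hasPn=> p; rewrite ?mem_cat.
- case/or3P=> [/mapP[a _ ->]|/flatten_mapP[a _ /mapP[b _ ->]]|/mapP[a _ ->]]; by rewrite map_notin.
- case/orP=> [/flatten_mapP[a _ /mapP[b _ ->]]|/mapP[a _ ->]]; by rewrite map_notin.
- by case/mapP=> a _ ->; rewrite occ_notin.
Qed.

(** Recovers the pile of a card in play from its suit and rank. That such a function exists shows at
    once that different piles share no card. *)
Definition home (c : card) : pile :=
  let: (s, r) := c in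
  if s < 2 then
    if r <= K then Clause r.-1 else
    if r == K.+1 then Stock else
    let x := (r - K.+3) %/ 3 in
    if x < v then Choice (2 * x + s) else Clause (x - v)
  else if s < 2 + 2 * v then
    if r == 1 then Choice (s - 2) else Occ (s - 2) (r - 2)
  else
    let x := (r - K.+4) %/ 3 in
    if x < v then Slot x else Occ (s - (2 + 2 * v)) (x - v).

Lemma home_pile p c : proper p -> c \in pile_cards p -> home c = p.
Proof.
have div x : (K.+3 + 3 * x - K.+3) %/ 3 = x by rewrite addKn mulKn.
have div' x : ((K.+3 + 3 * x).+1 - K.+4) %/ 3 = x by rewrite subSS div.
have Hc x b : home (nat_of_bool b, slot_rank x) = if x < v then Choice (2 * x + b) else Clause (x - v).
  rewrite /= (_ : (b < 2) = true); last by case: b.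
  rewrite /slot_rank (_ : (_ <= K) = false); last by lia.
  rewrite (_ : (_ == K.+1) = false); last by lia.
  by rewrite div.
have Hr l x : home (receptor l x) = if x < v then Slot x else Occ l (x - v).
  rewrite /home /receptor (_ : (2 + 2 * v + l < 2) = false); last by lia.
  rewrite (_ : (2 + 2 * v + l < 2 + 2 * v) = false); last by lia.
  by rewrite /slot_rank div' addKn.
have Ht l r : l < 2 * v -> home (token l r) = if r == 1 then Choice l else Occ l (r - 2).
  move=> l_lt; rewrite /home /token (_ : (2 + l < 2) = false); last by lia.
  rewrite (_ : (2 + l < 2 + 2 * v) = true); last by lia.
  by rewrite addKn.
case: p => [|l|x|l k|k] /=.
- by move=> _; rewrite inE => /eqP->; rewrite /= ltnn eqxx.
- move=> l_lt; rewrite !inE => /orP[/eqP->|/eqP->]; last by rewrite Ht.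
  rewrite Hc (_ : l./2 < v); last by lia.
  by congr Choice; rewrite mul2n addnC odd_double_half.
- by move=> x_lt; rewrite inE => /eqP->; rewrite Hr x_lt.
- move=> /andP[l_lt k_lt]; rewrite inE => /orP[/eqP->|]; first by rewrite Ht // subn2.
  case: ifP => //= _; rewrite inE => /eqP->; rewrite Hr (_ : v + k < v = false); last by lia.
  by rewrite addKn.
- move=> k_lt; rewrite !inE => /orP[/eqP->|/eqP->]; last by rewrite /= k_lt.
  rewrite (Hc _ false) (_ : v + k < v = false); last by lia.
  by rewrite addKn.
Qed.

Lemma mem_all_cards c : (c \in all_cards) = (suit c < 2 + 4 * v) && (0 < rank c <= top_rank).
Proof.
have num : num_suits (Instance pile_colors top_rank [::]) = 2 + 4 * v.
  by rewrite /num_suits /= size_cat !size_nseq; lia.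
case: c => s r; rewrite /all_cards /deck num.
apply/allpairsP/andP=> [[[s' r'] [+ + [-> ->]]]|[s_lt r_le]].
  by rewrite !mem_iota /suit /rank /=; lia.
by exists (s, r); rewrite !mem_iota; split=> //; move: s_lt r_le; rewrite /suit /rank /=; lia.
Qed.

Ltac unfold_ranks := rewrite /suit /rank /receptor /token /clause_card /choice_card /slot_rank /=.

Lemma pile_cards_all p c : proper p -> c \in pile_cards p -> c \in all_cards.
Proof.
rewrite mem_all_cards /top_rank.
case: p => [|l|x|l k|k] /=.
- by move=> _; rewrite inE => /eqP->; unfold_ranks; lia.
- move=> l_lt; rewrite !inE => /orP[/eqP->|/eqP->]; unfold_ranks.
    have : odd l <= 1 by case: (odd l).
    by move: (nat_of_bool _); lia.
  by lia.
- by move=> x_lt; rewrite inE => /eqP->; unfold_ranks; lia.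
- move=> /andP[l_lt k_lt]; rewrite inE => /orP[/eqP->|]; first by unfold_ranks; lia.
  by case: ifP => //= _; rewrite inE => /eqP->; unfold_ranks; lia.
- by move=> k_lt; rewrite !inE => /orP[/eqP->|/eqP->]; unfold_ranks; lia.
Qed.

Lemma in_playP c : c \in in_play -> exists2 p, proper p & c \in pile_cards p.
Proof. by case/flatten_mapP=> p; rewrite mem_piles => ? ?; exists p. Qed.

Lemma mem_in_play p c : proper p -> c \in pile_cards p -> c \in in_play.
Proof. by move=> pp cp; apply/flatten_mapP; exists p; rewrite ?mem_piles. Qed.

Lemma in_play_uniq : uniq in_play.
Proof.
have: {subset piles <= proper} by move=> p; rewrite mem_piles.
rewrite /in_play; elim: piles piles_uniq => //= p ps IH /andP[p_ps ps_uniq] psP.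
rewrite cat_uniq IH // ?andbT; last by move=> q qps; apply: psP; rewrite inE qps orbT.
have pp : proper p by apply: psP; rewrite mem_head.
apply/andP; split; last first.
  apply/hasPn=> c /flatten_mapP[q qps cq]; apply/negP=> cp.
  have qp : proper q by apply: psP; rewrite inE qps orbT.
  by move: p_ps; rewrite -(home_pile pp cp) (home_pile qp cq) qps.
case: p pp {p_ps psP} => [|l|x|l k|k] //=.
- by rewrite andbT inE /choice_card /token; case: (odd l).
- by move=> _; case: ifP => //= _; rewrite inE /token /receptor; case: eqP => // -[]; lia.
- by rewrite andbT inE /clause_card /slot_rank => k_lt; case: eqP => // -[]; lia.
Qed.

Lemma mem_restE c : (c \in rest) = (c \notin in_play) && (c \in all_cards).
Proof. exact: (mem_filter (fun c => c \notin in_play) c all_cards). Qed.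

Lemma initial_buildsE : [seq initial_pile p | p <- piles] =
  ((0, K.+1) :: rest) :: [seq pile_cards p | p <- proper_piles].
Proof.
congr cons; apply/eq_in_map=> p pP; rewrite /initial_pile.
case: eqP => [p0|_]; last by rewrite cats0.
by move: piles_uniq; rewrite /= -p0 pP.
Qed.

Lemma klondike_of_valid : valid klondike_of.
Proof.
apply/and4P; split=> //.
rewrite -[deck _]/all_cards [initial_builds _]/=.
have E : perm_eq (flatten [seq initial_pile p | p <- piles]) (in_play ++ rest).
  rewrite initial_buildsE.
  by rewrite /in_play /= perm_cons perm_catC.
rewrite (permPl E) perm_sym; apply: uniq_perm.
- exact: deck_uniq.
- rewrite cat_uniq in_play_uniq filter_uniq ?deck_uniq // andbT /=.
  by apply/hasPn=> c cR; have := mem_restE c; rewrite [LHS]cR => /esym/andP[].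
move=> c; rewrite [RHS]mem_cat mem_restE; case: (boolP (c \in in_play)) => //=.
by case/in_playP=> p /pile_cards_all H /H.
Qed.

Lemma color_red s r : s < 2 + 2 * v -> color klondike_of (s, r) = true.
Proof. by move=> s_lt; rewrite /color /suit /= nth_cat size_nseq s_lt nth_nseq s_lt. Qed.

Lemma color_receptor l x : color klondike_of (receptor l x) = false.
Proof.
rewrite /color /suit /receptor /= nth_cat size_nseq ltnNge leq_addr /= nth_nseq.
by case: ifP.
Qed.

(** ** Soundness *)

Section Soundness.
Variable g : config.
Hypothesis gP : game_inv klondike_of g.
Notation on_suits := (flatten (suit_stacks g)).
Notation hidden := (flatten [seq face_down b | b <- build_stacks g]).
Hypothesis rest_hidden : {subset rest <= hidden}.

Let I_valid := klondike_of_valid.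

Lemma on_suits_visible c : c \in on_suits -> c \notin hidden.
Proof.
move=> cs; apply/negP=> /flatten_mapP[b /(nthP empty_build)[i _ <-] ci].
by have /negP[] := suits_not_pile I_valid gP i cs; rewrite mem_cat ci orbT.
Qed.

(** A suit stack contains all lower ranks of its suit, and these are visible, so a hidden card caps
    the height of its suit. *)
Lemma rest_blocks c r : c \in on_suits -> 0 < r <= rank c -> (suit c, r) \notin rest.
Proof.
move=> cs r_le; apply/negP=> /rest_hidden.
by apply/negP/on_suits_visible/(suits_lower gP).
Qed.

Lemma mem_rest s r : s < 2 -> r = K.+2 -> (s, r) \in rest.
Proof.
move=> s_lt ->; rewrite mem_restE mem_all_cards /suit /rank /top_rank /slot_rank /=.
apply/andP; split; last by lia.
apply/negP=> /in_playP[p pp cp]; have := home_pile pp cp.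
rewrite /home s_lt ltnNge leqnSn /= eqSS (gtn_eqF (ltnSn _)).
(* By truncated subtraction the rank just below the first slot is assigned to slot 0, so a single
   pile remains, and its two cards have other ranks or suits. *)
rewrite (_ : (K.+2 - K.+3) %/ 3 = 0); last by rewrite (eqP (leqnSn _)).
move=> Ep; move: cp; rewrite -{}Ep; case: ifP => [v0|v0].
  rewrite /= muln0 add0n !inE /token /choice_card /slot_rank => /orP[] /eqP[]; lia.
rewrite /= !inE /clause_card /slot_rank => /orP[] /eqP[]; lia.
Qed.

Lemma choice_not_on_suits l : choice_card l \notin on_suits.
Proof.
apply/negP=> cs; have r_le : 0 < K.+2 <= rank (choice_card l) by rewrite /rank /choice_card /slot_rank /=; lia.
by have /negP[] := rest_blocks cs r_le; apply: mem_rest => //; rewrite /suit /=; case: (odd l).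
Qed.

Lemma clause_not_on_suits k : clause_card k \notin on_suits.
Proof.
apply/negP=> cs; have r_le : 0 < K.+2 <= rank (clause_card k) by rewrite /rank /clause_card /slot_rank /=; lia.
by have /negP[] := rest_blocks cs r_le; apply: mem_rest.
Qed.

(** A red card needs a visible black card beneath it. As [rest] is hidden, that card is in play, and
    the only black cards in play are receptors; the rank then determines the slot. *)
Lemma lies_on_receptor s r y : s < 2 + 2 * v -> lies_on g (s, r) y ->
  exists l x, [/\ y = receptor l x, r = slot_rank x, y \notin hidden &
     (x < v /\ l = 0) \/ (exists k, [/\ x = v + k, k < K, l < 2 * v & occurs l k])].
Proof.
move=> s_lt on_y; have y_all : y \in all_cards := lies_on_deck I_valid gP on_y.
have [/andP[+ /eqP ry] y_vis _] := lies_on_accepts I_valid gP on_y.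
rewrite color_red // => cy.
have : y \in in_play.
  apply: contraR y_vis => y_out; apply: rest_hidden.
  by rewrite mem_restE y_out.
case/in_playP=> p pp yp.
case: p pp yp => [|l|x|l k|k] /= pp; rewrite !inE.
- by move=> /eqP Ey; move: cy; rewrite Ey color_red.
- case/orP=> /eqP Ey; move: cy; rewrite Ey color_red //.
    by case: (odd l).
- move=> /eqP Ey; exists 0, x; split=> //; last by left.
  by move: ry; rewrite Ey /rank /= => -[].
- case/orP=> [/eqP Ey|]; first by move: cy; rewrite Ey color_red //; lia.
  case: ifP => //= occ; rewrite inE => /eqP Ey; exists l, (v + k).
  split=> //; first by move: ry; rewrite Ey /rank /= => -[].
  by right; exists k; case/andP: pp.
- by case/orP=> /eqP Ey; move: cy; rewrite Ey color_red.
Qed.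

Lemma pile_nth p : proper p ->
  index p piles < size (initial_builds klondike_of) /\
  nth [::] (initial_builds klondike_of) (index p piles) = initial_pile p.
Proof.
rewrite -mem_piles => pp; rewrite -[initial_builds _]/[seq initial_pile p | p <- piles].
rewrite size_map index_mem pp; split=> //.
by rewrite (nth_map Stock) ?index_mem // nth_index.
Qed.

Lemma above c d p : proper p -> pile_cards p = [:: c; d] -> d \notin hidden ->
  c \in on_suits \/ exists y, lies_on g c y.
Proof.
move=> pp Ep d_vis; have [i_lt Ei] := pile_nth pp.
have p_stock : p != Stock by apply/eqP=> p0; rewrite p0 in Ep.
apply: (@above_released _ I_valid g gP _ [::] c [:: d] d i_lt) => //.
- by rewrite Ei /initial_pile (negbTE p_stock) cats0.
- by rewrite mem_head.
- apply: contra d_vis => dd; apply/flatten_mapP.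
  exists (nth empty_build (build_stacks g) (index p piles)) => //.
  by apply: mem_nth; case: gP => -> _ _ _.
- by have := pile_cards_all (c := c) pp; rewrite Ep mem_head => /(_ isT).
Qed.

Lemma token_lower l r : token l r.+1 \in on_suits -> token l 1 \in on_suits.
Proof. by move=> /(suits_lower gP)/(_ (_ : 0 < 1 <= _)); apply; rewrite /rank. Qed.

(** With the token gone, the choice card above it has left its place. Its suit stack is blocked, so
    it lies on a receptor, and its rank leaves only the one of its variable. *)
Lemma token_choice l : l < 2 * v -> token l 1 \in on_suits ->
  lies_on g (choice_card l) (receptor 0 l./2).
Proof.
move=> l_lt ts.
have [cs|[y cy]] := @above (choice_card l) (token l 1) (Choice l) l_lt erefl (on_suits_visible ts).
  by case/negP: (choice_not_on_suits l).
have s_lt : odd l < 2 + 2 * v by case: (odd l); lia.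
have [l' [x [Ey rx _ H]]] := lies_on_receptor s_lt cy.
move: rx; rewrite /slot_rank => rx; have Ex : x = l./2 by lia.
case: H => [[_ l0]|[k [Ek _ _ _]]]; first by rewrite -Ex -l0 -Ey.
by lia.
Qed.

Lemma clause_satisfied k : k < K -> (0, k.+1) \in on_suits ->
  exists2 l, occurs l k & l < 2 * v /\ token l 1 \in on_suits.
Proof.
move=> k_lt fs.
have [cs|[y cy]] := @above (clause_card k) (0, k.+1) (Clause k) k_lt erefl (on_suits_visible fs).
  by case/negP: (clause_not_on_suits k).
have [l [x [Ey rx y_vis H]]] := lies_on_receptor (isT : 0 < 2 + 2 * v) cy.
move: rx; rewrite /slot_rank => rx; have Ex : x = v + k by lia.
case: H => [[x_lt _]|[k' [Ek _ l_lt occ]]]; first by lia.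
have {}Ek : k' = k by lia.
rewrite {}Ek in occ; exists l => //; split=> //.
have pp : proper (Occ l k) by rewrite /= l_lt.
have Ep : pile_cards (Occ l k) = [:: token l k.+2; y] by rewrite /= occ Ey Ex.
(* The receptor is visible, so the token above it has left its pile. The rank of the token is below
   all slots, so no receptor takes it and it must be on its suit stack; by then the token of rank 1
   is there as well. *)
have [ts|[z tz]] := above pp Ep y_vis; first exact: token_lower ts.
have s_lt : 2 + l < 2 + 2 * v by rewrite ltn_add2l.
by have [l' [x' [_ rx' _ _]]] := lies_on_receptor s_lt tz; move: rx'; rewrite /slot_rank; lia.
Qed.

Lemma key_satisfies : all (all (fun l => l < 2 * v)) Phi -> (0, K.+1) \in on_suits ->
  exists val, satisfies val Phi.
Proof.
(* A variable is true when its positive literal has released its token of rank 1. If a clause is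
   witnessed by a negative literal, its variable is indeed false: otherwise the choice cards of both
   literals would lie directly on the same slot card. *)
move=> PhiP key; exists (fun x => token (2 * x).+1 1 \in on_suits).
apply/(all_nthP [::]) => k k_lt.
have fs : (0, k.+1) \in on_suits.
  by have := suits_lower gP key (r := k.+1); apply; rewrite /rank /=; lia.
have [l occ [l_lt ts]] := clause_satisfied k_lt fs.
apply/hasP; exists l => //; apply/eqP.
have El : l = 2 * l./2 + odd l by rewrite mul2n addnC odd_double_half.
case l_odd: (odd l) El => El; first by rewrite -[(2 * _).+1]addn1 -El ts.
apply/negP=> ts'; have l_lt' : (2 * l./2).+1 < 2 * v by lia.
have half' : (2 * l./2).+1./2 = l./2 by lia.
have := token_choice l_lt ts; have := token_choice l_lt' ts'; rewrite half' => on1 on2.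
have [] := lies_on_inj I_valid gP on1 on2.
by rewrite l_odd /= oddM.
Qed.

End Soundness.

Lemma nth_stock : nth [::] (initial_builds klondike_of) 0 = [::] ++ (0, K.+1) :: rest.
Proof. by []. Qed.

Lemma map_set_nth_id (T U : Type) (f : T -> U) (x0 : T) s i y :
  i < size s -> f y = f (nth x0 s i) -> map f (set_nth x0 s i y) = map f s.
Proof. by elim: s i => [|x s IH] [|i] //= i_lt E; rewrite ?E ?IH. Qed.

Lemma move_hidden g g' : move klondike_of g g' ->
  [seq face_down b | b <- build_stacks g'] = [seq face_down b | b <- build_stacks g] \/
  exists ss bs i c d, [/\ g = Config ss bs, nth empty_build bs i = Build [::] (c :: d)
    & g' = Config ss (set_nth empty_build bs i (Build [:: c] d))].
Proof.
case=> [ss bs i c d Ei|ss bs i j p b d q e ij Ei Ej acc|ss bs i k c p d Ei k_lt acc].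
- by right; exists ss, bs, i, c, d.
- left; have i_lt : i < size bs by apply: nth_build_lt; rewrite Ei; case: (p).
  have j_lt : j < size bs by apply: nth_build_lt; rewrite Ej => -[E]; rewrite E in acc.
  rewrite /= map_set_nth_id.
  + by rewrite map_set_nth_id // Ei.
  + by rewrite size_set_nth (maxn_idPr i_lt).
  + by rewrite nth_set_nth /= eq_sym (negbTE ij) Ej.
- left; have i_lt : i < size bs by apply: nth_build_lt; rewrite Ei.
  by rewrite /= map_set_nth_id // Ei.
Qed.

(** All of [rest] is hidden at the start and visible after a win, so some move turns up the first of
    these cards. At that moment the key card has left its stack. No receptor has a rank fit for it,
    so it is on its suit stack, and the configuration before the move yields the assignment. *)
Lemma klondike_sound : all (all (fun l => l < 2 * v)) Phi -> winnable klondike_of ->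
  exists val, satisfies val Phi.
Proof.
move=> PhiP [g g_reach g_won]; have I_valid := klondike_of_valid.
have := game_inv_initial I_valid.
have : {subset rest <= flatten [seq face_down b | b <- build_stacks (initial_config klondike_of)]}.
  move=> c cR; apply/flatten_mapP; exists (Build [::] (initial_pile Stock)); first exact: mem_head.
  by rewrite /= /initial_pile eqxx mem_cat cR orbT.
elim: g_reach g_won => {g} [g g_won rest_hidden gP|g g1 g2 gg1 _ IH g_won rest_hidden gP].
  (* A card that belongs to [rest] for every formula; a win contradicts its being face down. *)
  have cR : (1, K.+2) \in rest by apply: mem_rest.
  have c_all : (1, K.+2) \in all_cards by move: cR; rewrite mem_restE => /andP[].
  by have /negP[] := on_suits_visible gP (g_won _ c_all); apply: rest_hidden.
have g1P := game_inv_move I_valid gP gg1; have {}IH := fun H => IH g_won H g1P.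
case: (move_hidden gg1) => [E|[ss [bs [i [c [d [Eg Ei Eg1]]]]]]].
  by apply: IH => c /rest_hidden; rewrite E.
have [H|/allPn[c' cR cV]] := boolP (all (mem (flatten [seq face_down b | b <- build_stacks g1])) rest).
  by apply: IH => c' /(allP H).
have bs_lt : i < size bs by apply: nth_build_lt; rewrite Ei.
have lt0 : 0 < size (initial_builds klondike_of) by [].
have visible k : c' \notin face_down (nth empty_build (build_stacks g1) k).
  have [k_lt|le] := ltnP k (size (build_stacks g1)); last by rewrite nth_default.
  apply: contra cV => ck; apply/flatten_mapP; exists (nth empty_build (build_stacks g1) k) => //.
  exact: mem_nth.
have [key|[y /= key_y]] := above_released I_valid g1P lt0 nth_stock cR (visible 0)
    (pile_cards_all (isT : proper Stock) (mem_head _ _)).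
  apply: (key_satisfies gP rest_hidden PhiP).
  by move: key; rewrite Eg Eg1.
suff g_key_y : lies_on g (0, K.+1) y.
  have [l [x [_ Ex _ _]]] := lies_on_receptor gP rest_hidden (isT : 0 < 2 + 2 * v) g_key_y.
  by move: Ex; rewrite /slot_rank; lia.
(* The block created by the move is a single card, so the two cards are neighbours in another block,
   which the move left unchanged. *)
case: key_y => k [p [q]]; rewrite Eg1 /= nth_set_nth /=; case: eqP => [_|_] Ek.
  by case: p Ek => [|? [|? ?]].
by exists k, p, q; rewrite Eg.
Qed.

End Reduction.

(** ** Completeness *)

Lemma reach_trans (T : Type) (R : T -> T -> Prop) x y z :
  clos_refl_trans_1n T R x y -> clos_refl_trans_1n T R y z -> clos_refl_trans_1n T R x z.
Proof. by elim=> // a b c ab _ IH /IH; apply: rt1n_trans ab. Qed.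

Lemma reach_step (T : Type) (R : T -> T -> Prop) x y :
  R x y -> clos_refl_trans_1n T R x y.
Proof. by move=> xy; apply: rt1n_trans xy (rt1n_refl _ _ _). Qed.

(** In a run of tokens a pile contributes its top card or nothing; this lemma and the next provide
    the hypothesis of [greedy] on piles in these two cases. *)
Lemma prefix_filter1 (T : eqType) (u cs : seq T) a :
  uniq u -> a \in u -> (forall x, x \in cs -> x \notin u) ->
  prefix [seq x <- u | x \in a :: cs] (a :: cs).
Proof.
move=> u_uniq au csu.
have -> : [seq x <- u | x \in a :: cs] = [seq x <- u | x == a].
  apply: eq_in_filter => x xu; rewrite inE; case: eqP => //= _.
  by apply/negP=> /csu; rewrite xu.
by rewrite filter_pred1_uniq //= eqxx prefix0s.
Qed.

Lemma prefix_filter0 (T : eqType) (u cs : seq T) :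
  (forall x, x \in cs -> x \notin u) -> prefix [seq x <- u | x \in cs] cs.
Proof.
move=> csu; rewrite (eq_in_filter (a2 := pred0)) ?filter_pred0 ?prefix0s // => x xu.
by apply/negP=> /csu; rewrite xu.
Qed.

(* The order in which the cards are played to the suit stacks at the end. *)
Definition card_lt (c d : card) : bool := (c.1 < d.1) || (c.1 == d.1) && (c.2 < d.2).

Lemma card_lt_trans : transitive card_lt.
Proof. by move=> [a b] [c d] [e f]; rewrite /card_lt /=; lia. Qed.

Lemma card_lt_irr : irreflexive card_lt.
Proof. by move=> [a b]; rewrite /card_lt /=; lia. Qed.

Lemma sorted_deck I : sorted card_lt (deck I).
Proof.
rewrite sorted_pairwise; last exact: card_lt_trans.
rewrite /deck; move: (iota 1 _) (iota_ltn_sorted 1 (max_rank I)) => rs rs_sorted.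
elim: (num_suits I) 0 => //= k IH a.
rewrite pairwise_cat IH andbT; apply/andP; split.
  apply/allrelP=> c d /mapP[r _ ->] /allpairsP[[s' r'] /= []].
  by rewrite mem_iota => s_ge _ ->; rewrite /card_lt /=; lia.
rewrite -sorted_pairwise; last exact: card_lt_trans.
apply: (homo_sorted (e := ltn)) rs_sorted.
by move=> x y xy; rewrite /card_lt /= ltnn eqxx.
Qed.

(** * Playing cards in a prescribed order *)

Section Complete.
Variables (v : nat) (Phi : seq (seq nat)) (m : nat).
Notation K := (size Phi).
Notation I := (klondike_of v Phi).
Notation piles := (piles v Phi).
Notation reach := (clos_refl_trans_1n config (move I)).

Definition suit_stack (s r : nat) : stack := [seq (s, i) | i <- rev (iota 1 r)].

(** A suit stack is determined by its height, so a configuration amounts to two functions and a move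
    to a pointwise update of them. *)
Definition cfg (h : nat -> nat) (B : pile -> build_stack) : config :=
  Config [seq suit_stack s (h s) | s <- iota 0 m] [seq B p | p <- piles].

Definition upd_pile (B : pile -> build_stack) p b := fun q => if q == p then b else B q.
Definition upd_height (h : nat -> nat) s := fun t => if t == s then (h s).+1 else h t.

Lemma cfg_ext h h' B B' : (forall s, s < m -> h s = h' s) ->
  (forall p, p \in piles -> B p = B' p) -> cfg h B = cfg h' B'.
Proof.
move=> hh BB; congr Config; apply/eq_in_map => // s.
by rewrite mem_iota => /hh->.
Qed.

Lemma set_nth_piles B p b : p \in piles ->
  set_nth empty_build [seq B q | q <- piles] (index p piles) b =
  [seq upd_pile B p b q | q <- piles].
Proof.
elim: piles (piles_uniq v Phi) => //= q ps IH /andP[q_ps ps_uniq].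
rewrite inE {1}/upd_pile; have [-> _|pq /= pps] := eqVneq p q.
  rewrite ?eqxx /= ?eqxx; congr cons; apply/eq_in_map=> x xps; rewrite /upd_pile.
  by case: eqP xps q_ps => // -> ->.
by rewrite ?[q == p]eq_sym ?(negbTE pq) /= IH.
Qed.

Lemma nth_piles B p : p \in piles -> nth empty_build [seq B q | q <- piles] (index p piles) = B p.
Proof. by move=> pp; rewrite (nth_map p) ?index_mem // nth_index. Qed.

Lemma reach_turn h B p c d : p \in piles -> B p = Build [::] (c :: d) ->
  reach (cfg h B) (cfg h (upd_pile B p (Build [:: c] d))).
Proof.
move=> pp Ep; apply: reach_step; rewrite /cfg -set_nth_piles //.
by apply: TurnUp; rewrite nth_piles.
Qed.

Lemma reach_block h B p q a x d w e : p \in piles -> q \in piles -> p != q ->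
  B p = Build (rcons a x) d -> B q = Build w e -> block_accepts I w x ->
  reach (cfg h B) (cfg h (upd_pile (upd_pile B p (Build [::] d)) q (Build (rcons a x ++ w) e))).
Proof.
move=> pp qq pq Ep Eq acc; apply: reach_step; rewrite /cfg -!set_nth_piles //.
apply: (MoveBlock _ _ _ _ acc); rewrite ?nth_piles //.
apply: contra pq => /eqP E; apply/eqP.
by rewrite -(nth_index Stock pp) E nth_index.
Qed.

Lemma reach_suit h B p a b d s : p \in piles -> s < m -> B p = Build ((s, (h s).+1) :: a) d ->
  b = Build a d ->
  reach (cfg h B) (cfg (upd_height h s) (upd_pile B p b)).
Proof.
move=> pp s_lt Ep ->; apply: reach_step; rewrite {2}/cfg -set_nth_piles //.
have nth_s : nth [::] [seq suit_stack t (h t) | t <- iota 0 m] s = suit_stack s (h s).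
  by rewrite (nth_map 0) ?size_iota // nth_iota.
have -> : [seq suit_stack t (upd_height h s t) | t <- iota 0 m] =
    set_nth [::] [seq suit_stack t (h t) | t <- iota 0 m] s ((s, (h s).+1) :: suit_stack s (h s)).
  apply: (@eq_from_nth _ [::]).
    by rewrite size_set_nth !size_map size_iota (maxn_idPr _).
  move=> i; rewrite size_map size_iota => i_lt; rewrite nth_set_nth /=.
  rewrite !(nth_map 0) ?size_iota // nth_iota // add0n /upd_height.
  case: eqP => // ->; rewrite /suit_stack -[(h s).+1]addn1 iotaD rev_cat map_cat /= add1n.
  by rewrite addn1.
rewrite -{1}nth_s; apply: MoveToSuit; first by rewrite nth_piles.
  by rewrite size_map size_iota.
rewrite nth_s /suit_stack; case: (h s) => [|r]; first by rewrite /= /rank.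
by rewrite -[r.+1]addn1 iotaD rev_cat /= /suit /rank /= addn1 add1n !eqxx.
Qed.

Lemma reach_inv g g' : game_inv I g -> reach g g' -> game_inv I g'.
Proof.
move=> + H; elim: H => // g1 g2 g3 g12 _ IH gP; apply: IH.
exact: (game_inv_move (klondike_of_valid v Phi) gP g12).
Qed.

Section Piles.
Variables (h : nat -> nat) (B : pile -> build_stack).
Hypothesis gP : game_inv I (cfg h B).

Lemma pile_uniq p : p \in piles -> uniq (cards (B p)).
Proof.
move=> pp; have := cards_pile_uniq (klondike_of_valid v Phi) gP (index p piles).
by rewrite nth_piles.
Qed.

Lemma pile_inj p q c : p \in piles -> q \in piles ->
  c \in cards (B p) -> c \in cards (B q) -> p = q.
Proof.
move=> pp qq cp cq; have := cards_pile_inj (klondike_of_valid v Phi) gP (i := index p piles)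
  (j := index q piles) (c := c).
rewrite !nth_piles // => /(_ cp cq) E.
by rewrite -(nth_index Stock pp) E nth_index.
Qed.

(** A face-down top card is turned up first. Filters describe the result in the same way whether [c]
    was visible or not, which is the form that [greedy] iterates. *)
Lemma reach_play p c t : p \in piles -> cards (B p) = c :: t -> suit c < m ->
  rank c = (h (suit c)).+1 ->
  exists B1, [/\ reach (cfg h B) (cfg (upd_height h (suit c)) (upd_pile B p B1)),
    cards B1 = t,
    block B1 = [seq x <- block (B p) | x != c] &
    face_down B1 = [seq x <- face_down (B p) | x != c]].
Proof.
move=> pp Et s_lt r_c; have := pile_uniq pp; rewrite Et /= => /andP[c_t _].
have rem (s : stack) : {subset s <= t} -> [seq x <- s | x != c] = s.
  move=> st; apply/all_filterP/allP=> x /st xt; apply: contra c_t => /eqP<-; exact: xt.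
have Ec : c = (suit c, (h (suit c)).+1) by rewrite -r_c; case: (c).
move: Et; rewrite /cards; case Ep: (B p) => [[|x a] d] /= Et.
  exists (Build [::] t); split=> //=; last by rewrite Et /= eqxx rem.
  have Ep' : B p = Build [::] (c :: t) by rewrite Ep Et.
  apply: reach_trans (reach_turn h pp Ep') _.
  rewrite (_ : cfg (upd_height _ _) _ = cfg (upd_height h (suit c))
    (upd_pile (upd_pile B p (Build [:: c] t)) p (Build [::] t))).
    by apply: (reach_suit (a := [::]) (d := t)) => //; rewrite /upd_pile eqxx -Ec.
  by apply: cfg_ext => // q _; rewrite /upd_pile; case: eqP.
case: Et => xc Et; exists (Build a d); split=> //=.
- by apply: (reach_suit (a := a) (d := d)) => //; rewrite Ep xc -Ec.
- by rewrite xc eqxx /= rem // => y ya; rewrite -Et mem_cat ya.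
- by rewrite rem // => y yd; rewrite -Et mem_cat yd orbT.
Qed.

End Piles.

(** The order [u] agrees with every pile, whose cards in [u] form its top part in this order, and
    with every suit, whose cards in [u] continue its stack. So the first card of [u] is playable,
    and both conditions pass on to the tail of [u]. The runs of tokens and the final phase are
    instances. *)
Lemma greedy u h B : game_inv I (cfg h B) -> uniq u ->
  (forall p, p \in piles -> prefix [seq c <- u | c \in cards (B p)] (cards (B p))) ->
  (forall c, c \in u -> suit c < m /\ exists2 p, p \in piles & c \in cards (B p)) ->
  (forall s, [seq c <- u | suit c == s] =
     [seq (s, r) | r <- iota (h s).+1 (count (fun c => suit c == s) u)]) ->
  reach (cfg h B) (cfg (fun s => h s + count (fun c => suit c == s) u)
    (fun p => Build [seq c <- block (B p) | c \notin u] [seq c <- face_down (B p) | c \notin u])).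
Proof.
elim: u h B => [|c u IH] h B gP u_uniq pre mem_u suits.
  rewrite (_ : cfg (fun s => _) _ = cfg h B); first exact: rt1n_refl.
  apply: cfg_ext => [s _|p _]; first by rewrite addn0.
  by case: (B p) => a d /=; rewrite !(eq_filter (a2 := predT)) ?filter_predT.
have [s_lt [p pp cp]] := mem_u c (mem_head _ _).
have /andP[c_u uu] := u_uniq.
have [t Et] : exists t, cards (B p) = c :: t.
  have := pre p pp; rewrite /= cp; case: (cards (B p)) => [|x t] //=.
  by case: eqP => // <- _; exists t.
have r_c : rank c = (h (suit c)).+1.
  by have := suits (suit c); rewrite /= eqxx /= => -[Ec _]; rewrite {1}Ec.
have [B1 [c_reach EB1 Eb Ed]] := reach_play gP pp Et s_lt r_c.
apply: (reach_trans c_reach).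
have g1P := reach_inv gP c_reach.
have off q : q \in piles -> q != p -> c \notin cards (B q).
  by move=> qq qp; apply: contra qp => cq; apply/eqP; exact: (pile_inj gP qq pp cq cp).
have := IH _ _ g1P uu.
rewrite (_ : cfg (fun s => upd_height h (suit c) s + _) _ =
  cfg (fun s => h s + count (fun d => suit d == s) (c :: u))
    (fun q => Build [seq x <- block (B q) | x \notin c :: u]
                    [seq x <- face_down (B q) | x \notin c :: u])); last first.
  apply: cfg_ext => [s _|q qq].
    by rewrite /upd_height /= eq_sym; case: eqP => [->|_]; lia.
  rewrite /upd_pile; case: eqP => [->|/eqP qp].
    rewrite Eb Ed -!filter_predI; congr Build; apply: eq_filter => x /=;
      by rewrite inE negb_or andbC.
  have := off q qq qp; rewrite mem_cat negb_or => /andP[cb cd].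
  congr Build; apply: eq_in_filter => x xb; rewrite inE negb_or.
    by have [xc|//] := eqVneq x c; rewrite -xc xb in cb.
  by have [xc|//] := eqVneq x c; rewrite -xc xb in cd.
apply.
- move=> q qq; rewrite /upd_pile; case: eqP => [_|/eqP qp].
    have := pre p pp; rewrite /= cp EB1 Et /= eqxx /=.
    rewrite (eq_in_filter (a2 := mem t)) // => x xu; rewrite /= inE.
    by case: eqP xu c_u => // -> ->.
  by have := pre q qq; rewrite /= (negbTE (off q qq qp)).
- move=> x xu; have [|x_lt [q qq xq]] := mem_u x; first by rewrite inE xu orbT.
  split=> //; exists q => //; rewrite /upd_pile; case: eqP => // qp.
  move: xq; rewrite qp Et EB1 inE => /orP[/eqP xc|//].
  by rewrite -xc xu in c_u.
- move=> s; have := suits s; rewrite /= /upd_height [s == _]eq_sym.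
  by case: eqP => [<- [_]|//].
Qed.

End Complete.

Local Arguments initial_pile : simpl never.

Lemma mem_pair (T : eqType) (x a b : T) : x \in [:: a; b] -> x = a \/ x = b.
Proof. by rewrite !inE => /orP[/eqP|/eqP]; [left|right]. Qed.

Lemma mem_single (T : eqType) (x a : T) : x \in [:: a] -> x = a.
Proof. by rewrite inE => /eqP. Qed.

(** * The strategy given by a satisfying assignment *)

Section Strategy.
Variables (v : nat) (Phi : seq (seq nat)) (val : nat -> bool) (m : nat).
Hypothesis PhiP : all (all (fun l => l < 2 * v)) Phi.
Hypothesis valP : satisfies val Phi.
Hypothesis m_eq : m = 2 + 4 * v.
Notation K := (size Phi).
Notation I := (klondike_of v Phi).
Notation piles := (piles v Phi).
Notation reach := (clos_refl_trans_1n config (move I)).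
Notation cfg := (cfg v Phi m).
Notation initial_pile := (initial_pile v Phi).
Notation pile_cards := (pile_cards v Phi).
Notation choice_card := (choice_card Phi).
Notation receptor := (receptor v Phi).
Notation clause_card := (clause_card v Phi).
Notation rest := (rest v Phi).
Notation in_play := (in_play v Phi).
Notation all_cards := (all_cards v Phi).
Notation home := (home v Phi).

Definition holds (l : nat) : bool := val l./2 == odd l.
Definition true_literal (x : nat) : nat := 2 * x + val x.

Lemma true_literal_half x : (true_literal x)./2 = x.
Proof. by rewrite /true_literal; case: (val x); lia. Qed.

Lemma true_literal_odd x : odd (true_literal x) = val x.
Proof. by rewrite /true_literal oddD oddM; case: (val x). Qed.

Lemma holds_true_literal l : holds l -> l = true_literal l./2.
Proof.
by move=> /eqP E; rewrite /true_literal E mul2n addnC odd_double_half.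
Qed.

Lemma true_literal_holds x : holds (true_literal x).
Proof. by rewrite /holds true_literal_half true_literal_odd. Qed.

Lemma true_literal_lt x : x < v -> true_literal x < 2 * v.
Proof. by rewrite /true_literal; case: (val x); lia. Qed.

(* The position once the literals of the first [t] variables are chosen and the
   tokens of the true ones are played. *)
Definition chosen (t : nat) (p : pile) : build_stack :=
  match p with
  | Choice l => if (l./2 < t) && holds l then Build [::] [::] else Build [::] (initial_pile p)
  | Slot x => if x < t then Build [:: choice_card (true_literal x); receptor 0 x] [::]
              else Build [::] (initial_pile p)
  | Occ l k => if (l./2 < t) && holds l then Build [::] (behead (pile_cards p))
               else Build [::] (initial_pile p)
  | _ => Build [::] (initial_pile p)
  end.

Definition height (t s : nat) : nat :=
  if [&& 2 <= s, s < 2 + 2 * v, (s - 2)./2 < t & holds (s - 2)] then K.+1 else 0.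

Lemma initial_pileE p : p != Stock -> initial_pile p = pile_cards p.
Proof. by rewrite /initial_pile => /negbTE->; rewrite cats0. Qed.

Lemma initial_home p c : p \in piles -> c \in initial_pile p -> c \in in_play -> home c = p.
Proof.
rewrite mem_piles /initial_pile mem_cat => pp /orP[/(home_pile pp)//|].
by case: ifP => // _; rewrite mem_restE => /andP[/negbTE->].
Qed.

Lemma chosen_cards t p c : c \in cards (chosen t p) ->
  c \in initial_pile p \/ exists x, c = choice_card (true_literal x).
Proof.
case: p => [|l|x|l k|k] /=; rewrite /cards; try by left.
- by case: ifP => // _; left.
- case: ifP => _ /= cP; last by left.
  have : (c == choice_card (true_literal x)) || (c == receptor 0 x).
    by move: cP; clear; rewrite !inE.
  case/orP=> /eqP->; first by right; exists x.
  by left; rewrite initial_pileE //; exact: mem_head.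
- case: ifP => _ cP; last by left.
  by left; rewrite initial_pileE //; apply: (@mem_behead _ (pile_cards (Occ l k))).
Qed.

Lemma token_inj l r l' r' : token l r = token l' r' -> l = l' /\ r = r'.
Proof. by rewrite /token => -[]; lia. Qed.

Definition tokens (l : nat) : seq card := [seq token l r | r <- iota 1 K.+1].

Lemma mem_tokens l c : c \in tokens l -> exists r, c = token l r /\ 0 < r <= K.+1.
Proof. by case/mapP=> r; rewrite mem_iota => r_le ->; exists r. Qed.

Lemma token_home l c : l < 2 * v -> c \in tokens l ->
  c \in in_play /\ (home c = Choice l \/ exists2 k, k < K & home c = Occ l k).
Proof.
move=> l_lt /mem_tokens[[|[|r]] [-> r_le]] //.
  have lp : proper v Phi (Choice l) by [].
  have cl : token l 1 \in pile_cards (Choice l) by rewrite !inE eqxx orbT.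
  by split; [exact: mem_in_play lp cl|left; exact: home_pile lp cl].
have lp : proper v Phi (Occ l r) by rewrite /= l_lt.
have cl : token l r.+2 \in pile_cards (Occ l r) by exact: mem_head.
by split; [exact: mem_in_play lp cl|right; exists r => //; exact: home_pile lp cl].
Qed.

Lemma receptor_tokens l l' x : l < 2 * v -> receptor l' x \notin tokens l.
Proof.
by move=> l_lt; apply/negP=> /mem_tokens[r [[]]]; rewrite /receptor /token; lia.
Qed.

Lemma choice_tokens l l' : choice_card l' \notin tokens l.
Proof. by apply/negP=> /mem_tokens[r [[]]]; case: (odd l') => // /eqP. Qed.

Lemma tokens_uniq l : uniq (tokens l).
Proof. by rewrite map_inj_uniq ?iota_uniq // => r r' /token_inj[]. Qed.

Lemma count_tokens l s : count (fun c => suit c == s) (tokens l) = if s == 2 + l then K.+1 else 0.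
Proof.
rewrite /tokens count_map; case: eqP => [->|sl].
  rewrite (eq_count (a2 := predT)) ?count_predT ?size_iota // => r.
  by rewrite /= /suit /= eqxx.
by rewrite (eq_count (a2 := pred0)) ?count_pred0 // => r; apply/eqP; rewrite /suit /=; lia.
Qed.

(** Moving the choice card of the true literal onto the slot card exposes the token of rank 1. The
    other tokens of this literal are on top of their piles already, so all of them can be played in
    increasing rank. *)
Lemma choose_literal t : t < v -> game_inv I (cfg (height t) (chosen t)) ->
  reach (cfg (height t) (chosen t)) (cfg (height t.+1) (chosen t.+1)).
Proof.
move=> t_lt gP; set l := true_literal t.
have l_lt : l < 2 * v by apply: true_literal_lt.
have l_half : l./2 = t by apply: true_literal_half.
have l_holds : holds l by apply: true_literal_holds.
have pl : Choice l \in piles by rewrite mem_piles.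
have pt : Slot t \in piles by rewrite mem_piles.
have E1 : chosen t (Choice l) = Build [::] [:: choice_card l; token l 1].
  by rewrite /= l_half ltnn /= initial_pileE.
pose B1 := upd_pile (chosen t) (Choice l) (Build [:: choice_card l] [:: token l 1]).
have E2 : B1 (Slot t) = Build [::] [:: receptor 0 t].
  by rewrite /B1 /upd_pile /= ltnn initial_pileE.
pose B2 := upd_pile B1 (Slot t) (Build [:: receptor 0 t] [::]).
have acc : block_accepts I [:: receptor 0 t] (choice_card l).
  rewrite /= color_receptor color_red; last by case: (odd l); lia.
  by rewrite /rank /= l_half eqxx.
have E3 : B2 (Choice l) = Build (rcons [::] (choice_card l)) [:: token l 1].
  by rewrite /B2 /B1 /upd_pile; case: eqP => // _; rewrite eqxx.
have E4 : B2 (Slot t) = Build [:: receptor 0 t] [::] by rewrite /B2 /upd_pile eqxx.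
have R1 := reach_turn m (height t) pl E1.
have R2 := reach_turn m (height t) pt E2.
have R3 := reach_block m (height t) pl pt isT E3 E4 acc.
have {R1 R2 R3} R := reach_trans R1 (reach_trans R2 R3).
set B3 := upd_pile (upd_pile B2 _ _) _ _ in R.
have B3l : B3 (Choice l) = Build [::] [:: token l 1].
  by rewrite /B3 /upd_pile; case: eqP => // _; rewrite eqxx.
have B3t : B3 (Slot t) = Build [:: choice_card l; receptor 0 t] [::].
  by rewrite /B3 /upd_pile eqxx.
have B3E p : p != Choice l -> p != Slot t -> B3 p = chosen t p.
  by move=> /negbTE p1 /negbTE p2; rewrite /B3 /B2 /B1 /upd_pile p1 p2.
have off p c : p \in piles -> p != Choice l -> (forall k, p != Occ l k) ->
    c \in cards (B3 p) -> c \notin tokens l.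
  move=> pp p1 p3; have [->|p2] := eqVneq p (Slot t).
    rewrite B3t !inE => /orP[/eqP->|/eqP->]; first exact: choice_tokens.
    exact: receptor_tokens.
  rewrite B3E // => /chosen_cards[ci|[x ->]]; last exact: choice_tokens.
  apply/negP=> /(token_home l_lt)[c_play]; rewrite (initial_home pp ci c_play).
  case=> [/eqP|[k _ /eqP]]; [by apply/negP|by apply/negP].
have B3o k : B3 (Occ l k) = Build [::] (pile_cards (Occ l k)).
  by rewrite B3E //= l_half ltnn initial_pileE.
apply: (reach_trans R).
have gP3 := reach_inv gP R.
rewrite (_ : cfg (height t.+1) (chosen t.+1) =
  cfg (fun s => height t s + count (fun c => suit c == s) (tokens l))
   (fun p => Build [seq c <- block (B3 p) | c \notin tokens l]
                   [seq c <- face_down (B3 p) | c \notin tokens l])).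
  apply: greedy => //.
  - exact: tokens_uniq.
  - move=> p pp; have [->|p1] := eqVneq p (Choice l).
      rewrite B3l; apply: prefix_filter1 (tokens_uniq l) _ _ => //.
      by apply/mapP; exists 1; rewrite ?mem_iota.
    case: (boolP [exists k : 'I_K, p == Occ l k]) => [/existsP[k /eqP->]|/existsPn p3].
      rewrite B3o; apply: prefix_filter1 (tokens_uniq l) _ _.
        by apply/mapP; exists k.+2; rewrite ?mem_iota //=; have := ltn_ord k; lia.
      move=> x; case: ifP => // _; rewrite inE => /eqP->; exact: receptor_tokens.
    apply: prefix_filter0 => x; apply: off => // k; apply/eqP=> pk.
    have k_lt : k < K by move: pp; rewrite pk mem_piles /= => /andP[].
    by have := p3 (Ordinal k_lt); rewrite pk eqxx.
  - move=> c cl; split.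
      by have [r [-> _]] := mem_tokens cl; rewrite /suit /= m_eq; lia.
    have [[|[|r]] [Ec r_le]] := mem_tokens cl => //.
      by exists (Choice l) => //; rewrite Ec B3l mem_head.
    by exists (Occ l r); rewrite ?mem_piles /= ?l_lt // Ec B3o mem_head.
  - move=> s; rewrite count_tokens; case: eqP => [->|sl].
      rewrite /height addKn l_half ltnn !andbF (eq_in_filter (a2 := predT)) ?filter_predT //.
      by move=> c /mem_tokens[r [-> _]]; rewrite /suit /= eqxx.
    rewrite (eq_in_filter (a2 := pred0)) ?filter_pred0 //.
    by move=> c /mem_tokens[r [-> _]]; apply/eqP; rewrite /suit /=; lia.
apply: cfg_ext => [s s_lt|p pp].
  rewrite count_tokens /height; case: eqP => [->|sl].
    by rewrite addKn l_half ltnn ltnSn l_holds !andbF /= !andbT ltn_add2l l_lt.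
  rewrite addn0; case: (leqP 2 s) => //= s_ge; case: (ltnP s) => //= s_lt'.
  case h: (holds (s - 2)); rewrite ?andbF ?andbT // ltnS leq_eqVlt.
  case: eqP => //= st; case: sl; rewrite /l -st -holds_true_literal //; lia.
have keep q : q \in piles -> q != Choice l -> (forall k, q != Occ l k) ->
    Build [seq c <- block (B3 q) | c \notin tokens l] [seq c <- face_down (B3 q) | c \notin tokens l] = B3 q.
  move=> qq q1 q3; have := fun c => off q c qq q1 q3; case: (B3 q) => [a d] /= H.
  by congr Build; apply/all_filterP/allP=> x xa; apply: H; rewrite /cards mem_cat xa ?orbT.
have other x : x != t -> (x < t.+1) = (x < t) by move=> xt; rewrite ltnS leq_eqVlt (negbTE xt).
have only_l l' : holds l' -> l' != l -> l'./2 != t.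
  by move=> h; apply: contra => /eqP lt; rewrite (holds_true_literal h) lt.
case: p pp => [|l'|x|l' k|k] pp.
- by rewrite keep // B3E.
- have [->|ll] := eqVneq l' l.
    rewrite B3l /= l_half ltnSn l_holds /=; congr Build.
    by rewrite (_ : token l 1 \in tokens l) //; apply/mapP; exists 1; rewrite ?mem_iota.
  have lc : Choice l' != Choice l by apply: contra ll => /eqP[->].
  rewrite keep // B3E //=; case h: (holds l'); rewrite ?andbF // !andbT other //.
  exact: only_l h ll.
- have [->|xt] := eqVneq x t.
    by rewrite keep // B3t /= ltnSn.
  have xs : Slot x != Slot t by apply: contra xt => /eqP[->].
  by rewrite keep // B3E //= other.
- have [El|ll] := eqVneq l' l.
    rewrite El B3o /= l_half ltnSn l_holds /=; congr Build.
    have k_lt : k < K by move: pp; rewrite mem_piles => /andP[].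
    rewrite (_ : token l k.+2 \in tokens l) /=; last first.
      by apply/mapP; exists k.+2; rewrite ?mem_iota //; lia.
    by case: ifP => //= _; rewrite receptor_tokens.
  have lc k' : Occ l' k != Occ l k' by apply: contra ll => /eqP[->].
  rewrite keep // B3E //=; case h: (holds l'); rewrite ?andbF // !andbT other //.
  exact: only_l h ll.
- by rewrite keep // B3E.
Qed.

Lemma choose_literals t : t <= v -> game_inv I (cfg (height 0) (chosen 0)) ->
  reach (cfg (height 0) (chosen 0)) (cfg (height t) (chosen t)).
Proof.
move=> + gP; elim: t => [|t IH] t_le; first exact: rt1n_refl.
have R := IH (ltnW t_le); apply: (reach_trans R).
exact: choose_literal t_le (reach_inv gP R).
Qed.

Definition witness (k : nat) : nat := nth 0 (nth [::] Phi k) (find holds (nth [::] Phi k)).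

Lemma witnessP k : k < K ->
  [/\ occurs Phi (witness k) k, holds (witness k) & witness k < 2 * v].
Proof.
move=> k_lt; have has_k : has holds (nth [::] Phi k) by move/(all_nthP [::]): valP; apply.
have occ : occurs Phi (witness k) k by apply: mem_nth; rewrite -has_find.
split=> //; first exact: nth_find.
by move/(all_nthP [::]): PhiP => /(_ k k_lt)/allP; apply.
Qed.

(* The position once the first [t] clauses are satisfied. *)
Definition satisfied (t : nat) (p : pile) : build_stack :=
  match p with
  | Clause k => if k < t then Build [::] [:: (0, k.+1)] else chosen v p
  | Occ l k => if (k < t) && (l == witness k)
               then Build [:: clause_card k; receptor l (v + k)] [::] else chosen v p
  | _ => chosen v p
  end.

(** The token of a true literal no longer covers its receptor in this clause, and this receptor
    takes the clause card. Nothing goes to the suit stacks yet. *)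
Lemma satisfy_clause t : t < K ->
  reach (cfg (height v) (satisfied t)) (cfg (height v) (satisfied t.+1)).
Proof.
move=> t_lt; have [occ w_holds w_lt] := witnessP t_lt; set l := witness t in occ w_holds w_lt *.
have pc : Clause t \in piles by rewrite mem_piles.
have po : Occ l t \in piles by rewrite mem_piles /= w_lt.
have l_half : l./2 < v by lia.
have E1 : satisfied t (Occ l t) = Build [::] [:: receptor l (v + t)].
  by rewrite /= ltnn /= l_half w_holds /= occ.
pose B1 := upd_pile (satisfied t) (Occ l t) (Build [:: receptor l (v + t)] [::]).
have E2 : B1 (Clause t) = Build [::] [:: clause_card t; (0, t.+1)].
  by rewrite /B1 /upd_pile /= ltnn initial_pileE.
pose B2 := upd_pile B1 (Clause t) (Build [:: clause_card t] [:: (0, t.+1)]).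
have acc : block_accepts I [:: receptor l (v + t)] (clause_card t).
  by rewrite /= color_receptor color_red // /rank /= eqxx.
have E3 : B2 (Clause t) = Build (rcons [::] (clause_card t)) [:: (0, t.+1)].
  by rewrite /B2 /upd_pile eqxx.
have E4 : B2 (Occ l t) = Build [:: receptor l (v + t)] [::].
  by rewrite /B2 /B1 /upd_pile eqxx.
have R1 := reach_turn m (height v) po E1.
have R2 := reach_turn m (height v) pc E2.
have R3 := reach_block m (height v) pc po isT E3 E4 acc.
apply: (reach_trans R1 (reach_trans R2 _)).
rewrite (_ : cfg _ (satisfied t.+1) = cfg (height v) (upd_pile
   (upd_pile B2 (Clause t) (Build [::] [:: (0, t.+1)])) (Occ l t)
   (Build (rcons [::] (clause_card t) ++ [:: receptor l (v + t)]) [::]))) //.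
apply: cfg_ext => // p pp; rewrite /B2 /B1 /upd_pile.
have [->|p1] := eqVneq p (Occ l t); first by rewrite /= ltnSn eqxx.
have [->|p2] := eqVneq p (Clause t); first by rewrite /= ltnSn.
case: p p1 p2 {pp} => // [l' k|k] p1 p2 /=.
  rewrite ltnS leq_eqVlt; have [Ek|//] := eqVneq k t.
  have [El|_] := eqVneq l' (witness k); last by rewrite !andbF.
  by rewrite El Ek eqxx in p1.
by rewrite ltnS leq_eqVlt; have [Ek|//] := eqVneq k t; rewrite Ek eqxx in p2.
Qed.

Lemma satisfy_clauses t : t <= K ->
  reach (cfg (height v) (satisfied 0)) (cfg (height v) (satisfied t)).
Proof.
elim: t => [|t IH] t_le; first exact: rt1n_refl.
exact: reach_trans (IH (ltnW t_le)) (satisfy_clause t_le).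
Qed.

Definition remaining : seq card := [seq c <- all_cards | height v (suit c) < rank c].

Lemma mem_remaining c : (c \in remaining) = (height v (suit c) < rank c) && (c \in all_cards).
Proof. exact: (mem_filter (fun c => height v (suit c) < rank c) c all_cards). Qed.

Lemma sorted_remaining : sorted card_lt remaining.
Proof. exact: sorted_filter card_lt_trans _ _ (sorted_deck _). Qed.

Lemma height_token l : l < 2 * v -> height v (2 + l) = if holds l then K.+1 else 0.
Proof.
move=> l_lt; rewrite /height addKn ltn_add2l l_lt /=.
by rewrite (_ : l./2 < v) //; lia.
Qed.

Lemma height_black l : height v (2 + 2 * v + l) = 0.
Proof. by rewrite /height (_ : _ < 2 + 2 * v = false) ?andbF //; lia. Qed.

Lemma remaining_cards p c : p \in piles -> c \in cards (satisfied K p) -> c \in remaining.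
Proof.
have all_pile q x : proper v Phi q -> x \in pile_cards q -> x \in all_cards.
  exact: pile_cards_all.
rewrite mem_piles => pp.
have receptor_rem l x : receptor l x \in all_cards -> receptor l x \in remaining.
  by move=> H; rewrite mem_remaining H height_black.
have choice_rem l : l < 2 * v -> choice_card l \in remaining.
  move=> l_lt; rewrite mem_remaining (all_pile (Choice l)) // ?inE ?eqxx // andbT.
  by rewrite /suit /height /=; case: (odd l).
have clause_rem k : k < K -> clause_card k \in remaining.
  by move=> k_lt; rewrite mem_remaining (all_pile (Clause k)) // ?inE ?eqxx.
case: p pp => [|l|x|l k|k] pp; rewrite /cards /satisfied.
- rewrite /chosen /= /initial_pile /= inE => /orP[/eqP->|].
    by rewrite mem_remaining (all_pile Stock) // ?inE ?eqxx.
  rewrite mem_restE => /andP[c_out c_all]; rewrite mem_remaining c_all andbT.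
  rewrite /height; case: ifP => [/and4P[s_ge s_lt _ _]|_].
    rewrite ltnNge; apply: contra c_out => r_le.
    have l_lt : suit c - 2 < 2 * v by lia.
    move: c_all; rewrite mem_all_cards => /andP[_ /andP[r_gt _]].
    have Ec : c = token (suit c - 2) (rank c) by rewrite /token subnKC //; case: (c).
    case r1: (rank c) r_gt r_le Ec => [|[|r]] // _ r_le ->.
      by apply: (@mem_in_play _ _ (Choice (suit c - 2))) => //; rewrite !inE eqxx orbT.
    apply: (@mem_in_play _ _ (Occ (suit c - 2) r)); first by rewrite /= l_lt.
    exact: mem_head.
  by move: c_all; rewrite mem_all_cards => /andP[_ /andP[]].
- rewrite /chosen; case: ifP => //= h; rewrite initial_pileE // => /mem_pair[->|->].
    exact: choice_rem.
  rewrite mem_remaining (all_pile (Choice l)) // ?inE ?eqxx ?orbT // andbT /suit /= height_token //.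
  by move: h; rewrite (_ : l./2 < v) /= => [->//|]; move: pp => /=; lia.
- move: (pp) => /= x_lt; rewrite /chosen x_lt /= => /mem_pair[->|->].
    by apply: choice_rem; apply: true_literal_lt.
  by apply: receptor_rem; apply: (all_pile (Slot x)); rewrite // inE.
- have /andP[l_lt k_lt] := pp; have receptor_occ : occurs Phi l k -> receptor l (v + k) \in remaining.
    by move=> occ; apply: receptor_rem; apply: (all_pile (Occ l k)); rewrite //= occ !inE eqxx orbT.
  case: ifP => [/andP[_ /eqP El]|_].
    move=> /mem_pair[->|->]; first exact: clause_rem.
    by apply: receptor_occ; rewrite El; case: (witnessP k_lt).
  rewrite /chosen; have -> : l./2 < v by lia.
  case h: (holds l); rewrite /= ?initial_pileE //.
    by case: ifP => // occ /mem_single->; apply: receptor_occ.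
  rewrite inE => /orP[/eqP->|]; last by case: ifP => // occ /mem_single->; apply: receptor_occ.
  rewrite mem_remaining (all_pile (Occ l k)) ?mem_head // andbT /suit /= height_token //.
  by rewrite h.
- rewrite (_ : k < K) //= => /mem_single->; rewrite mem_remaining (all_pile (Clause k)) //.
  by rewrite !inE eqxx orbT.
Qed.

(** The suits are numbered for this purpose: cards to be moved come before tokens, and tokens before
    receptors, so whatever covers a token or a receptor precedes it. At the start only the clause
    piles are out of order, a clause card covering a lower card of suit 0; satisfying the clauses
    repairs exactly these. *)
Lemma sorted_cards p : p \in piles -> sorted card_lt (cards (satisfied K p)).
Proof.
have lt_receptor c l x : suit c < 2 + 2 * v -> card_lt c (receptor l x).
  by rewrite /card_lt /suit /receptor /= => ?; rewrite (_ : _ < _) //; lia.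
have lt_token c l r : suit c < 2 -> card_lt c (token l r).
  by rewrite /card_lt /suit /token /= => ?; rewrite (_ : _ < _) //; lia.
have odd2 l : odd l < 2 by case: (odd l).
rewrite mem_piles; case: p => [|l|x|l k|k] pp; rewrite /cards /satisfied /chosen /=.
- rewrite /initial_pile /= path_sortedE; last exact: card_lt_trans.
  have -> : sorted card_lt rest by exact: sorted_filter card_lt_trans _ _ (sorted_deck _).
  rewrite andbT.
  apply/allP=> -[s r] cR; move: (cR); rewrite mem_restE => /andP[c_out].
  rewrite mem_all_cards => /andP[_ /andP[r_gt _]].
  rewrite /card_lt /=; case: s cR c_out r_gt => [|s] //= _ c_out; rewrite /rank /= => r_gt.
  rewrite ltnNge; apply: contra c_out; rewrite leq_eqVlt => /orP[/eqP->|r_lt].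
    by apply: (@mem_in_play _ _ Stock) => //; rewrite inE.
  case: r r_gt r_lt => // r _ r_lt.
  by apply: (@mem_in_play _ _ (Clause r)) => //=; rewrite !inE eqxx orbT.
- by case: ifP => //= _; rewrite andbT lt_token // /suit /= odd2.
- have x_lt : x < v := pp; rewrite x_lt /= andbT lt_receptor // /suit /=.
  by case: (odd _); lia.
- case: ((k < K) && (l == witness k)) => //=.
  case: ((l./2 < v) && holds l) => /=; first by case: (occurs Phi l k).
  case: (occurs Phi l k) => //=.
  by rewrite andbT lt_receptor // /suit /=; move: pp => /= /andP[]; lia.
- by have k_lt : k < K := pp; rewrite k_lt.
Qed.

Lemma sorted_suit s r n : sorted card_lt [seq (s, i) | i <- iota r n].
Proof.
apply: (homo_sorted (e := ltn)) (iota_ltn_sorted r n) => x y xy.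
by rewrite /card_lt /= ltnn eqxx.
Qed.

Lemma play_remaining : game_inv I (cfg (height v) (satisfied K)) ->
  exists2 g, reach (cfg (height v) (satisfied K)) g & won I g.
Proof.
move=> gP; have I_valid := klondike_of_valid v Phi.
have rem_uniq : uniq remaining by rewrite filter_uniq ?deck_uniq.
have suits s : [seq c <- remaining | suit c == s] =
    [seq (s, r) | r <- iota (height v s).+1 (count (fun c => suit c == s) remaining)].
  (* Both sides are strictly sorted, so it is enough to compare their elements. Beyond the suits of
     the deck nothing remains, whence [n] is 0 there. *)
  have [n En] : exists n, [seq c <- remaining | suit c == s] =
      [seq (s, r) | r <- iota (height v s).+1 n].
    exists (if s < m then top_rank v Phi - height v s else 0).
    apply: (irr_sorted_eq card_lt_trans card_lt_irr) => [||[a b]].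
    - exact: sorted_filter card_lt_trans _ _ sorted_remaining.
    - exact: sorted_suit.
    rewrite mem_filter mem_remaining mem_all_cards /suit /rank /= -m_eq.
    apply/andP/mapP => [[/eqP-> /and3P[b_gt a_lt b_le]]|[r + [-> ->]]].
      by exists b => //; rewrite a_lt mem_iota; lia.
    by rewrite mem_iota eqxx; case: (s < m); lia.
  by move: (En) => /(congr1 size); rewrite size_filter size_map size_iota En => <-.
have pre p : p \in piles ->
    prefix [seq c <- remaining | c \in cards (satisfied K p)] (cards (satisfied K p)).
  (* Pile and filtered list are strictly sorted with the same elements, so the whole pile is played,
     from top to bottom. *)
  move=> pp; have -> : [seq c <- remaining | c \in cards (satisfied K p)] = cards (satisfied K p).
    apply: (irr_sorted_eq card_lt_trans card_lt_irr).
    - exact: sorted_filter card_lt_trans _ _ sorted_remaining.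
    - exact: sorted_cards.
    move=> c; rewrite mem_filter; case: (boolP (c \in cards _)) => //= cc.
    by rewrite (remaining_cards pp cc).
  exact: prefix_refl.
have placed c : c \in remaining ->
    suit c < m /\ exists2 p, p \in piles & c \in cards (satisfied K p).
  move=> cR; move: (cR); rewrite mem_remaining mem_all_cards => /andP[r_gt c_all].
  split; first by case/andP: c_all; rewrite m_eq.
  have cI : c \in deck I by rewrite -[deck _]/all_cards mem_all_cards.
  case: (card_place I_valid gP cI) => [/flatten_mapP[s _]|[i ci]].
    case/mapP=> r; rewrite mem_rev mem_iota => r_le Ec.
    by move: r_gt; rewrite Ec /suit /rank /=; lia.
  have i_lt := cards_pile_lt ci; rewrite size_map in i_lt.
  exists (nth Stock piles i); first exact: mem_nth.
  by move: ci; rewrite (nth_map Stock).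
have R := greedy gP rem_uniq pre placed suits.
have gP' := reach_inv gP R; eexists; first exact: R.
(* Every card in a pile belonged to [remaining] and has been played, so by the invariant all cards
   of the deck are on the suit stacks. *)
move=> c cI; case: (card_place I_valid gP' cI) => [//|[i ci]].
have i_lt := cards_pile_lt ci; rewrite size_map in i_lt.
have pp : nth Stock piles i \in piles by exact: mem_nth.
move: ci; rewrite (nth_map Stock) // /cards /= -filter_cat mem_filter => /andP[c_out c_in].
by rewrite (remaining_cards pp c_in) in c_out.
Qed.

End Strategy.

Lemma klondike_complete v (Phi : seq (seq nat)) val :
  all (all (fun l => l < 2 * v)) Phi -> satisfies val Phi -> winnable (klondike_of v Phi).
Proof.
move=> PhiP valP; pose m := 2 + 4 * v.
have I_valid := klondike_of_valid v Phi.
have m_suits : num_suits (klondike_of v Phi) = m.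
  by rewrite /num_suits /= size_cat !size_nseq /m; lia.
have E : initial_config (klondike_of v Phi) =
    cfg v Phi m (height v Phi val 0) (chosen v Phi val 0).
  rewrite /initial_config m_suits /cfg; congr Config.
    have const_map (T U : Type) (s : seq T) (x : U) : [seq x | _ <- s] = nseq (size s) x.
      by elim: s => //= y s ->.
    rewrite (eq_map (g := fun=> [::])) ?const_map ?size_iota //.
    by move=> s; rewrite /suit_stack /height !andbF.
  rewrite -[initial_builds _]/[seq initial_pile v Phi p | p <- piles v Phi] -map_comp.
  by apply: eq_map => -[|l|x|l k|k].
have gP := game_inv_initial I_valid; rewrite E in gP.
have R1 := choose_literals PhiP valP erefl (leqnn v) gP.
have E0 : chosen v Phi val v =1 satisfied v Phi val 0 by case.
have gP1 := reach_inv gP R1.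
have E1 : cfg v Phi m (height v Phi val v) (chosen v Phi val v) =
          cfg v Phi m (height v Phi val v) (satisfied v Phi val 0).
  by apply: cfg_ext => // p _; apply: E0.
rewrite E1 in R1 gP1.
have R2 := satisfy_clauses (m := m) PhiP valP erefl (leqnn (size Phi)).
have [g R3 g_won] := play_remaining PhiP valP erefl (reach_inv gP1 R2).
by exists g => //; rewrite E; apply: (reach_trans R1 (reach_trans R2 R3)).
Qed.

Theorem klondike_of_winnable v (Phi : seq (seq nat)) :
  all (all (fun l => l < 2 * v)) Phi ->
  winnable (klondike_of v Phi) <-> exists val, satisfies val Phi.
Proof.
by move=> PhiP; split=> [|[val]]; [exact: klondike_sound|exact: klondike_complete].
Qed.

(** * From Turing machines to satisfiability *)

Section Tableau.
Variable M : machine.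
Notation sym := (option (bool + aux_symbol M)).
Notation nt := (extra_tapes M).+1.

(* What the tableau records at distance [j] from the heads: the control state
   and, for every tape, the symbols [j] cells to the left and to the right of
   the head. *)
Definition site : finType := (state M * {ffun 'I_nt -> sym * sym})%type.

Definition left_cells (T : tape (aux_symbol M)) : seq sym := under T :: before T.
Definition right_cells (T : tape (aux_symbol M)) : seq sym := under T :: after T.

Definition site_of (c : mconfig M) (j : nat) : site :=
  (control c, [ffun i => (nth None (left_cells (tapes c i)) j,
                          nth None (right_cells (tapes c i)) j)]).

(** [l], [c] and [r] come from the distances [j.-1], [j] and [j.+1]. When the head moves, one half
    of the tape gets closer by a cell and the other recedes, while the written symbol ends up at
    distance 0 or 1. Only these two distances are special; all larger ones follow a common rule. *)
Definition next_cells (j : nat) (a : sym * direction) (l c r : sym * sym) : sym * sym :=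
  match a.2 with
  | MoveLeft => (r.1, if j == 0 then r.1 else if j == 1 then a.1 else l.2)
  | MoveRight => (if j == 0 then r.2 else if j == 1 then a.1 else l.1, r.2)
  | Stay => if j == 0 then (a.1, a.1) else c
  end.

Definition next_site (j : nat) (s0 sl s sr : site) : site :=
  if delta s0.1 [ffun i => (s0.2 i).1] is Some (q, act)
  then (q, [ffun i => next_cells j (act i) (sl.2 i) (s.2 i) (sr.2 i)])
  else s.

Lemma site_mstep c j :
  site_of (mstep c) j =
  next_site j (site_of c 0) (site_of c j.-1) (site_of c j) (site_of c j.+1).
Proof.
rewrite /next_site /mstep /transition /=.
rewrite (_ : [ffun i => ([ffun _ => _] i).1] = [ffun i => under (tapes c i)]); last first.
  by apply/ffunP=> i; rewrite !ffunE.
case: (delta _ _) => [[q act]|//]; congr pair; apply/ffunP=> i; rewrite !ffunE /=.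
rewrite /next_cells /left_cells /right_cells; case: (tapes c i) => b u a.
case: (act i) => s [] /=; case: j => [|[|j]] //=;
  by rewrite ?nth_behead // -?nth0; case: b; case: a.
Qed.

Definition initial_site (first : bool) (b : option bool) : site :=
  let a : sym := omap inl b in
  (start M, [ffun i => if i == ord0 then (if first then a else None, a) else (None, None)]).

Lemma site_initial x j :
  site_of (initial M x) j = initial_site (j == 0) (nth None [seq Some b | b <- x] j).
Proof.
have cellsE y k : nth None [seq Some (inl b) | b <- y] k =
    omap inl (nth None [seq Some b | b <- y] k) :> sym.
  by elim: y k => [|b y IH] [|k] //=.
congr pair; apply/ffunP=> i; rewrite !ffunE /left_cells /right_cells; case: eqP => _ /=.
  by case: x => [|b x]; case: j => [|j] //=; rewrite ?nth_nil ?cellsE.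
by case: j => [|j]; rewrite /= ?nth_nil.
Qed.

Definition accepting (s : site) : bool := (s.2 ord0).2 == Some (inl true).

Lemma accepting_output c b : output c = [:: b] -> accepting (site_of c 0) = b.
Proof.
rewrite /output /output_of_tape /accepting /= ffunE /=.
by case: (under _) => [[[] | a]|] //= [<-].
Qed.

(** Since a halted machine stays put, the tableau can have a fixed number of rows although the
    running time varies. *)
Lemma iter_halted u c n : halted (iter u (@mstep M) c) -> u <= n ->
  iter n (@mstep M) c = iter u (@mstep M) c.
Proof.
move=> h /subnK<-; rewrite iterD; elim: (n - u) => //= k ->.
by move: h; rewrite /halted /mstep; case: (transition _).
Qed.

Definition num (s : site) : nat := enum_rank s.
Notation S := #|site|.

Lemma num_lt s : num s < S. Proof. exact: ltn_ord. Qed.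

Lemma num_inj : injective num. Proof. by move=> s t /val_inj/enum_rank_inj. Qed.

Section Formula.
Variables (N W p : nat) (x : seq bool).

(* [2 * y + 1] and [2 * y] are the positive and the negative literal of the
   variable [y]; here [y] says that the site at distance [j] at time [t] is the
   one numbered [c]. *)
Definition site_var (t j c : nat) : nat := (t * W + j) * S + c.
Definition is_site (t j c : nat) : nat := (2 * site_var t j c).+1.
Definition not_site (t j c : nat) : nat := 2 * site_var t j c.

(** For a fixed machine this is a finite table, and three values of [k] cover all distances. The
    construction of the formula can therefore treat the tables as constants. *)
Definition rules (k : nat) : seq (nat * nat * (nat * nat) * nat) :=
  [seq (num q.1.1, num q.1.2, (num q.2.1, num q.2.2), num (next_site k q.1.1 q.1.2 q.2.1 q.2.2))
  | q <- enum {: (site * site) * (site * site)}].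

Definition rules_at (j : nat) := if j == 0 then rules 0 else if j == 1 then rules 1 else rules 2.

Definition rule_clause (t j : nat) (r : nat * nat * (nat * nat) * nat) : seq nat :=
  [:: not_site t 0 r.1.1.1; not_site t j.-1 r.1.1.2; not_site t j r.1.2.1;
      not_site t j.+1 r.1.2.2; is_site t.+1 j r.2].

(** The part of [encode_pair x y] that does not depend on the certificate [y]. *)
Definition prefix_bits : seq bool := encode_seq (fun b => [:: b]) x.
Notation n := (size prefix_bits).

Definition num_true_first := num (initial_site true (Some true)).
Definition num_false_first := num (initial_site true (Some false)).
Definition num_true := num (initial_site false (Some true)).
Definition num_false := num (initial_site false (Some false)).
Definition num_blank := num (initial_site false None).

Definition input_num (j : nat) : nat :=
  if j == 0 then (if nth false prefix_bits j then num_true_first else num_false_first)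
  else (if nth false prefix_bits j then num_true else num_false).

Definition rejecting : seq nat := [seq num s | s <- enum site & ~~ accepting s].

(** In the guessed cells a blank forces blanks to its right, so they spell a certificate of any
    length up to [p]. A cell may satisfy several values at once; one of them can then be selected,
    and the rules force all its consequences. *)
Definition formula : seq (seq nat) :=
  flatten [seq flatten [seq [seq rule_clause t j r | r <- rules_at j] | j <- iota 0 W.-1]
          | t <- iota 0 N] ++
  [seq [:: is_site 0 j (input_num j)] | j <- iota 0 n] ++
  flatten [seq [:: [:: is_site 0 j num_blank; is_site 0 j num_true; is_site 0 j num_false];
                   [:: not_site 0 j num_blank; is_site 0 j.+1 num_blank]] | j <- iota n p] ++
  [seq [:: is_site 0 j num_blank] | j <- iota (n + p) (W - (n + p))] ++
  [seq [:: not_site N 0 c] | c <- rejecting].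

Lemma input_numE j y : j < n ->
  input_num j = num (initial_site (j == 0) (nth None [seq Some b | b <- prefix_bits ++ y] j)).
Proof.
move=> j_lt; rewrite (nth_map false) ?size_cat ?ltn_addr // nth_cat j_lt /input_num.
by case: eqP => _; case: (nth _ _ _).
Qed.

Lemma prefix_bits_gt0 : 0 < n. Proof. by rewrite size_encode_seq. Qed.

Section Assignment.
Variable val : nat -> bool.

Lemma is_siteE t j c : (val (is_site t j c)./2 == odd (is_site t j c)) = val (site_var t j c).
Proof. by rewrite /is_site /= mul2n uphalf_double odd_double; case: (val _). Qed.

Lemma not_siteE t j c : (val (not_site t j c)./2 == odd (not_site t j c)) = ~~ val (site_var t j c).
Proof. by rewrite /not_site mul2n half_double odd_double; case: (val _). Qed.

Notation holds t j s := (val (site_var t j (num s))).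

Lemma satisfies_formula : satisfies val formula <->
  [/\ forall t j s0 sl s sr, t < N -> j.+1 < W ->
        holds t 0 s0 -> holds t j.-1 sl -> holds t j s -> holds t j.+1 sr ->
        holds t.+1 j (next_site j s0 sl s sr),
      forall j, j < n -> val (site_var 0 j (input_num j)),
      forall j, n <= j < n + p ->
        [|| val (site_var 0 j num_blank), val (site_var 0 j num_true)
          | val (site_var 0 j num_false)] /\
        (val (site_var 0 j num_blank) -> val (site_var 0 j.+1 num_blank)),
      forall j, n + p <= j < W -> val (site_var 0 j num_blank)
    & forall s, ~~ accepting s -> ~~ holds N 0 s].
Proof.
rewrite /satisfies /formula !all_cat; split.
- case/and5P=> /allP H1 /allP H2 /allP H3 /allP H4 /allP H5; split.
  + move=> t j s0 sl s sr t_lt j_lt h0 hl h hr.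
    pose q : (site * site) * (site * site) := (s0, sl, (s, sr)).
    pose r := (num s0, num sl, (num s, num sr), num (next_site j s0 sl s sr)).
    have r_in : r \in rules_at j.
      have q_in : q \in enum {: (site * site) * (site * site)} by rewrite mem_enum.
      by rewrite /r /rules_at; case: j {j_lt hl h hr r} => [|[|j]] /=;
        apply/mapP; exists q.
    have /H1 : rule_clause t j r \in flatten [seq flatten [seq [seq rule_clause t j r | r <- rules_at j]
        | j <- iota 0 W.-1] | t <- iota 0 N].
      apply/flatten_mapP; exists t; first by rewrite mem_iota.
      apply/flatten_mapP; exists j; first by rewrite mem_iota; lia.
      exact: map_f.
    by rewrite /rule_clause /= !not_siteE is_siteE h0 hl h hr /= orbF.
  + move=> j j_lt; have /H2 : [:: is_site 0 j (input_num j)] \in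
        [seq [:: is_site 0 j (input_num j)] | j <- iota 0 n].
      by apply/mapP; exists j; rewrite ?mem_iota.
    by rewrite /= is_siteE orbF.
  + move=> j j_in; have mem c : c \in [:: [:: is_site 0 j num_blank; is_site 0 j num_true; is_site 0 j num_false];
        [:: not_site 0 j num_blank; is_site 0 j.+1 num_blank]] -> has (fun l => val l./2 == odd l) c.
      by move=> cj; apply: H3; apply/flatten_mapP; exists j; rewrite ?mem_iota.
    split; first by have := mem _ (mem_head _ _); rewrite /= !is_siteE orbF.
    by have := mem _ (mem_last _ _); rewrite /= not_siteE is_siteE orbF => /orP[/negbTE->|].
  + move=> j j_in; have /H4 : [:: is_site 0 j num_blank] \in
        [seq [:: is_site 0 j num_blank] | j <- iota (n + p) (W - (n + p))].
      by apply/mapP; exists j; rewrite ?mem_iota //; lia.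
    by rewrite /= is_siteE orbF.
  + move=> s s_rej; have /H5 : [:: not_site N 0 (num s)] \in [seq [:: not_site N 0 c] | c <- rejecting].
      by apply: map_f; apply: map_f; rewrite mem_filter s_rej mem_enum.
    by rewrite /= not_siteE orbF.
- move=> [H1 H2 H3 H4 H5]; apply/and5P; split; apply/allP=> c.
  + case/flatten_mapP=> t; rewrite mem_iota => /andP[_ t_lt].
    case/flatten_mapP=> j; rewrite mem_iota => /andP[_ j_lt] /mapP[r r_in ->].
    have [q Er] : exists q : (site * site) * (site * site), r =
        (num q.1.1, num q.1.2, (num q.2.1, num q.2.2), num (next_site j q.1.1 q.1.2 q.2.1 q.2.2)).
      by move: r_in; rewrite /rules_at; case: j {j_lt} => [|[|j]] /= /mapP[q _ ->]; exists q.
    rewrite /rule_clause Er /= !not_siteE is_siteE orbF.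
    have := H1 t j q.1.1 q.1.2 q.2.1 q.2.2 t_lt; case: (holds t 0 _) => //=; case: (holds t j.-1 _) => //=.
    case: (holds t j _) => //=; case: (holds t j.+1 _) => //= -> //; lia.
  + by case/mapP=> j; rewrite mem_iota => /andP[_ j_lt] ->; rewrite /= is_siteE orbF H2.
  + case/flatten_mapP=> j; rewrite mem_iota => /H3[a b]; rewrite !inE => /orP[/eqP->|/eqP->] /=.
      by rewrite !is_siteE orbF.
    by rewrite not_siteE is_siteE orbF; case: (val _) b => //= ->.
  + by case/mapP=> j; rewrite mem_iota => j_in ->; rewrite /= is_siteE orbF H4 //; lia.
  + case/mapP=> k /mapP[s]; rewrite mem_filter => /andP[s_rej _] -> ->.
    by rewrite /= not_siteE orbF H5.
Qed.

End Assignment.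

Hypothesis W_gt : N + n + p < W.

Lemma formula_sound val : satisfies val formula ->
  exists2 y, size y <= p & accepting (site_of (iter N (@mstep M) (initial M (encode_pair x y))) 0).
Proof.
case/satisfies_formula=> step input guess blanks reject.
pose blank i := val (site_var 0 (n + i) num_blank).
(* The certificate is cut at the first guessed blank. Before it, a cell is read as [true] whenever
   this value is permitted, and otherwise [false] must hold there. *)
pose r := find blank (iota 0 p).
have r_le : r <= p by rewrite -[p](size_iota 0) find_size.
pose y := [seq val (site_var 0 (n + i) num_true) | i <- iota 0 r].
have size_y : size y = r by rewrite size_map size_iota.
exists y; first by rewrite size_y.
have blank_r i : i <= p - r -> val (site_var 0 (n + r + i) num_blank).
  elim: i => [|i IH] i_le; last first.
    by rewrite addnS; apply: (proj2 (guess _ _)); [lia|apply: IH; lia].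
  rewrite addn0; have [r_lt|r_ge] := ltnP r p; last by apply: blanks; lia.
  have has_blank : has blank (iota 0 p) by rewrite has_find size_iota.
  by have := nth_find 0 has_blank; rewrite -/r nth_iota.
have init j : j < W -> val (site_var 0 j (num (site_of (initial M (encode_pair x y)) j))).
  move=> j_lt; rewrite site_initial -/prefix_bits.
  have [j_n|j_n] := ltnP j n; first by rewrite -input_numE //; apply: input.
  have j_ne0 : (j == 0) = false by have := prefix_bits_gt0; lia.
  rewrite j_ne0; have [j_r|j_r] := ltnP j (n + r); last first.
    rewrite nth_default; last by rewrite size_map size_cat size_y.
    have [j_p|j_p] := leqP j (n + p); last by apply: blanks; lia.
    by have := blank_r (j - (n + r)); rewrite subnKC //; apply; lia.
  rewrite (nth_map false) ?size_cat ?size_y // nth_cat ltnNge j_n /=.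
  have i_lt : j - n < r by lia.
  rewrite (nth_map 0) ?size_iota // nth_iota // add0n subnKC //.
  have j_in : n <= j < n + p by lia.
  have [+ _] := guess j j_in.
  have -> : val (site_var 0 j num_blank) = false.
    have := before_find 0 i_lt; rewrite nth_iota; last by lia.
    by rewrite /blank add0n subnKC.
  by case E: (val (site_var 0 j num_true)).
(* Each step uses the neighbour one cell farther out, so the part under control shrinks by one
   distance per step. The width [W] is large enough for distance 0 to be left at time [N]. *)
have sim t j : t <= N -> t + j < W ->
    val (site_var t j (num (site_of (iter t (@mstep M) (initial M (encode_pair x y))) j))).
  elim: t j => [|t IH] j t_le tj; first exact: init.
  rewrite iterS site_mstep; apply: step; try (apply: IH); lia.
apply/negPn/negP => /reject; rewrite sim //; lia.
Qed.

Lemma formula_complete y : size y <= p ->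
  accepting (site_of (iter N (@mstep M) (initial M (encode_pair x y))) 0) ->
  exists val, satisfies val formula.
Proof.
move=> y_le acc; pose c t := iter t (@mstep M) (initial M (encode_pair x y)).
(* Division by [S] and by [W] inverts [site_var], so a variable is true exactly when the actual run
   has that site at that time and distance. *)
pose val k := num (site_of (c (k %/ S %/ W)) ((k %/ S) %% W)) == k %% S.
have W_gt0 : 0 < W by lia.
have valE t j s : j < W -> val (site_var t j (num s)) = (site_of (c t) j == s).
  move=> j_lt; have S_gt0 : 0 < S := leq_ltn_trans (leq0n _) (num_lt s).
  rewrite /val /site_var divnMDl // (divn_small (num_lt s)) addn0 !modnMDl (modn_small (num_lt s)).
  by rewrite divnMDl // (divn_small j_lt) addn0 (modn_small j_lt) (inj_eq num_inj).
exists val; apply/satisfies_formula; split.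
- move=> t j s0 sl s sr t_lt j_lt; rewrite !valE; try by lia.
  move=> /eqP<- /eqP<- /eqP<- /eqP<-; by rewrite /c iterS site_mstep.
- by move=> j j_lt; rewrite (input_numE y) // valE ?site_initial //; lia.
- move=> j j_in; rewrite !valE ?site_initial; try by lia.
  have j_ne0 : (j == 0) = false by have := prefix_bits_gt0; lia.
  rewrite j_ne0 /=; split.
    by case: (nth _ _ _) => [[]|]; rewrite eqxx ?orbT.
  have [j_y|j_y] := ltnP (j - n) (size y); last first.
    by rewrite [nth _ _ j.+1]nth_default ?eqxx // size_map size_cat -/prefix_bits; lia.
  rewrite (nth_map false) ?size_cat -/prefix_bits; last by lia.
  rewrite nth_cat (_ : j < n = false) => [/eqP[]|]; last by lia.
  by move/ffunP/(_ ord0); rewrite !ffunE eqxx.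
- move=> j j_in; rewrite valE ?site_initial; last by lia.
  have -> : (j == 0) = false by have := prefix_bits_gt0; lia.
  by rewrite nth_default // size_map size_cat -/prefix_bits; lia.
- by move=> s s_rej; rewrite valE //; apply: contra s_rej => /eqP<-.
Qed.

End Formula.
End Tableau.

(** * The reduction is computable in polynomial time *)

Lemma pf_nat_of_bool (E : Type) {rE : rep E} (b : E -> bool) :
  pf b -> pf (fun e => nat_of_bool (b e)).
Proof.
move=> pfb; apply: pf_ext (pf_if pfb (pf_const 1) (pf_const 0)) => e.
by case: (b e).
Qed.

Lemma pf_nseq (E T : Type) {rE : rep E} {rT : rep T} (n : E -> nat) (x : E -> T) :
  pf n -> pf x -> pf (fun e => nseq (n e) (x e)).
Proof.
move=> pfn pfx; apply: (pf_ext (f := fun e => [seq x e | _ <- nseq (n e) tt])).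
  by move=> e; rewrite map_nseq.
apply: (pf_map (f := fun e _ => x e)); first exact: pf_nseq_tt.
exact: pf_comp pfx (pf_fst pf_id).
Qed.

Lemma pf_sumn (E : Type) {rE : rep E} (l : E -> seq nat) : pf l -> pf (fun e => sumn (l e)).
Proof.
move=> pfl; apply: (pf_ext (f := fun e => size (flatten [seq nseq n tt | n <- l e]))).
  by move=> e; elim: (l e) => //= n s IH; rewrite size_cat size_nseq IH.
apply: pf_size_seq; apply: (pf_flatmap (f := fun _ n => nseq n tt)) => //.
exact: pf_nseq_tt (pf_snd pf_id).
Qed.

Lemma pf_prefix_bits (E : Type) {rE : rep E} (x : E -> seq bool) :
  pf x -> pf (fun e => prefix_bits (x e)).
Proof. by move=> pfx; apply: (pf_encode_seq (e := fun b => [:: b])) => //; pf_solve. Qed.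

Ltac pf_hook ::=
  lazymatch goal with
  | |- pf (fun e => nat_of_bool (@?b e)) => apply: pf_nat_of_bool
  | |- pf (fun e => nseq (@?n e) (@?x e)) => apply: pf_nseq
  | |- pf (fun e => sumn (@?l e)) => apply: pf_sumn
  | |- pf (fun e => prefix_bits (@?x e)) => apply: pf_prefix_bits
  | |- pf (fun e => deck (@?x e)) => apply: pf_deck
  | |- pf (fun e => encode (@?x e)) => apply: pf_encode
  | |- pf (fun e => in_mem (@?x e) (mem (@?l e))) => apply: pf_mem
  | |- pf_equality _ => first [exact: pf_equality_nat | exact: pf_equality_card]
  end.

Lemma pf_formula (M : machine) (E : Type) {rE : rep E} (N W p : E -> nat) (x : E -> seq bool) :
  pf N -> pf W -> pf p -> pf x -> pf (fun e => formula M (N e) (W e) (p e) (x e)).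
Proof.
move=> pfN pfW pfp pfx.
rewrite /formula /rule_clause /is_site /not_site /site_var /rules_at /input_num.
by pf_solve.
Qed.

(** The piles spelled out with lists and numbers, the types that carry a [rep], so that the
    construction can be recognised as polynomial-time. *)
Definition proper_builds (v : nat) (Phi : seq (seq nat)) : seq stack :=
  [seq [:: choice_card Phi l; token l 1] | l <- iota 0 (2 * v)] ++
  [seq [:: receptor v Phi 0 x] | x <- iota 0 v] ++
  flatten [seq [seq token l k.+2 ::
                  (if occurs Phi l k then [:: receptor v Phi l (v + k)] else [::])
               | k <- iota 0 (size Phi)] | l <- iota 0 (2 * v)] ++
  [seq [:: clause_card v Phi k; (0, k.+1)] | k <- iota 0 (size Phi)].

Lemma proper_buildsE v Phi :
  [seq pile_cards v Phi p | p <- proper_piles v Phi] = proper_builds v Phi.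
Proof.
rewrite /proper_piles !map_cat -!map_comp map_flatten -map_comp; congr (_ ++ (_ ++ (_ ++ _))).
by congr flatten; apply: eq_map => l; rewrite /= -map_comp.
Qed.

Lemma pf_klondike_of (E : Type) {rE : rep E} (v : E -> nat) (Phi : E -> seq (seq nat)) :
  pf v -> pf Phi -> pf (fun e => klondike_of (v e) (Phi e)).
Proof.
move=> pfv pfPhi.
have pf_builds : pf (fun e => proper_builds (v e) (Phi e)).
  rewrite /proper_builds /choice_card /token /receptor /clause_card /slot_rank /occurs.
  by pf_solve.
have pf_all : pf (fun e => all_cards (v e) (Phi e)).
  by rewrite /all_cards /pile_colors /top_rank /slot_rank; pf_solve.
pose play e := (0, (size (Phi e)).+1) :: flatten (proper_builds (v e) (Phi e)).
have pf_play : pf play by rewrite /play; pf_solve.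
pose builds e := ((0, (size (Phi e)).+1) :: [seq c <- all_cards (v e) (Phi e) | c \notin play e])
  :: proper_builds (v e) (Phi e).
apply: (pf_ext (f := fun e => Instance (pile_colors (v e)) (top_rank (v e) (Phi e)) (builds e))).
  move=> e; rewrite /klondike_of; congr Instance; rewrite /builds initial_buildsE.
  by rewrite /rest /in_play /piles /= proper_buildsE.
rewrite /builds /pile_colors /top_rank /slot_rank; pf_solve.
Qed.

Lemma klondike_encode I : klondike (encode I) <-> valid I /\ winnable I.
Proof.
split=> [[J [Jv /encode_inj-> Jw]]|[Iv Iw]]; first by split.
by exists I.
Qed.

Lemma klondike_NP_hard : NP_hard klondike.
Proof.
move=> L [V [[M [a' [d' HM]]] [a [d HL]]]].
pose p (x : seq bool) := a * size x ^ d + a.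
(* The time bound of the verifier at the largest size that a pair with an admissible certificate can
   have. *)
pose N (x : seq bool) := a' * (size (prefix_bits x) + p x) ^ d' + a'.
pose W x := N x + size (prefix_bits x) + p x + 1.
pose Phi x := formula M (N x) (W x) (p x) x.
(* The number of variables only has to exceed every variable occurring; the sum of all literals does
   so and is easily computed. *)
pose v x := sumn (flatten (Phi x)) + 1.
have PhiP x : all (all (fun l => l < 2 * v x)) (Phi x).
  apply/allP=> c cP; apply/allP=> l lc.
  have : l \in flatten (Phi x) by apply/flattenP; exists c.
  rewrite /v; elim: (flatten _) => //= k s IH; rewrite inE => /orP[/eqP->|/IH]; lia.
exists (fun x => encode (klondike_of (v x) (Phi x))).
  apply: (pf_polytime (f := fun x => encode (klondike_of (v x) (Phi x)))).
  have pfp : pf p by rewrite /p; pf_solve.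
  have pfN : pf N by rewrite /N; pf_solve.
  have pfW : pf W by rewrite /W; pf_solve.
  have pfPhi : pf Phi by apply: pf_formula => //; exact: pf_id.
  have pfv : pf v by rewrite /v; pf_solve.
  by apply: pf_encode; apply: pf_klondike_of.
move=> x; rewrite klondike_encode klondike_of_winnable //.
have accE y : size y <= p x -> accepting (site_of (iter (N x) (@mstep M) (initial M (encode_pair x y))) 0)
    = V (encode_pair x y).
  move=> y_le; have [u u_le [u_halted u_out]] := HM (encode_pair x y).
  rewrite (iter_halted u_halted); first exact: accepting_output.
  apply: leq_trans u_le _; rewrite /N leq_add2r leq_mul2l; apply/orP; right.
  have le : size (encode_pair x y) <= size (prefix_bits x) + p x by rewrite size_cat leq_add2l.
  by case: (d') => // k; rewrite leq_exp2r.
have W_gt : N x + size (prefix_bits x) + p x < W x by rewrite /W addn1.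
rewrite HL; split=> [[y y_le Vy]|[_ [val /(formula_sound W_gt)[y y_le acc]]]].
  split; first exact: klondike_of_valid.
  by apply: (formula_complete W_gt y_le); rewrite accE.
by exists y => //; rewrite -accE.
Qed.

Theorem theorem1 : NP_complete klondike.
Proof. by split; [exact: klondike_in_NP|exact: klondike_NP_hard]. Qed.
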